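(* Assume that $\alpha\in(0,1)\cup(1,2)$. Let $q\ge2$ and let $\psi_1,\dots,\psi_q$ be positive coefficients such that $$\sum_{j=1}^q\psi_j^{\alpha+i\theta}\neq0\qquad\text{for all }\theta\in\mathbb{R}.\qquad( * )$$ Let $Z_1,\dots,Z_q$ be i.i.d. random variables (with generic element $Z$) such that $$X_q=\sum_{j=1}^q\psi_jZ_j\ \text{ has a totally skewed to the right $\alpha$-stable distribution.}$$ Then $Z$ has a totally skewed to the right $\alpha$-stable distribution. Conversely, if positive coefficients $\psi_1,\dots,\psi_q$ do not satisfy $( * )$, then there exists $Z$ that does not have an $\alpha$-stable law but, for i.i.d. copies $Z_1,\dots,Z_q$ of $Z$, the sum $X_q=\sum_{j=1}^q\psi_jZ_j$ is $\alpha$-stable.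
   Context: An $\alpha$-stable distribution ($0<\alpha<2$) is totally skewed to the right if its Lévy measure is concentrated on the positive half-line $(0,\infty)$ (equivalently, its skewness parameter is $\beta=1$). Stable distributions here are not required to be strictly stable (arbitrary shifts are allowed). *)

(* Defs.v *)
From HB Require Import structures.
From mathcomp Require Import all_boot all_order all_algebra.
From mathcomp Require Import all_classical all_reals all_analysis.
From mathcomp Require Import complex.
Set Implicit Arguments.
Unset Strict Implicit.
Unset Printing Implicit Defensive.
Import Order.TTheory GRing.Theory Num.Theory.
Import numFieldNormedType.Exports.
Local Open Scope classical_set_scope.
Local Open Scope ring_scope.
Local Open Scope complex_scope.

Section complex_functions.
Context {R : realType}.

Definition cexp (z : R[i]) : R[i] :=
  let: x +i* y := z in (expR x * cos y) +i* (expR x * sin y).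

(* [x ^ z] for a base [x > 0], with the real logarithm of [x]; the value at
   [x <= 0] is irrelevant. *)
Definition cpow (x : R) (z : R[i]) : R[i] := cexp ((ln x)%:C * z).

(* Componentwise; meaningful when both components are integrable. *)
Definition Cintegral d (T : measurableType d) (mu : {measure set T -> \bar R})
    (f : T -> R[i]) : R[i] :=
  Rintegral mu setT (fun x => complex.Re (f x)) +i*
  Rintegral mu setT (fun x => complex.Im (f x)).

End complex_functions.

Section laws_on_the_line.
Context {R : realType}.

(* Set functions carry junk values outside the sigma-algebra, so laws are
   compared on Borel sets only, and not by Leibniz equality. *)
Definition same_law (m1 m2 : set R -> \bar R) : Prop :=
  forall A, measurable A -> m1 A = m2 A.

(* Taking some [A j] to be the full space gives the product rule for every
   subfamily. *)
Definition independent_RVs d (T : measurableType d) (P : probability T R)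
    (n : nat) (Z : 'I_n -> {RV P >-> R}) : Prop :=
  forall A : 'I_n -> set R, (forall j, measurable (A j)) ->
    P [set w | forall j, A j (Z j w)] = (\prod_(j < n) P (Z j @^-1` A j))%E.

Definition iid_RVs d (T : measurableType d) (P : probability T R)
    (n : nat) (Z : 'I_n -> {RV P >-> R}) : Prop :=
  independent_RVs Z /\
  forall j k, same_law (distribution P (Z j)) (distribution P (Z k)).

Definition nondegenerate (mu : probability R R) : Prop :=
  forall x : R, mu [set x] != 1%E.

(* [mu] is stable with index [alpha]: for independent [Y1], [Y2] of law [mu] and
   all [a, b > 0], the law of [a Y1 + b Y2] is that of [c Y1 + D], where
   [c ^ alpha = a ^ alpha + b ^ alpha] and [D] is an arbitrary real (it is the
   strictly stable laws that have [D = 0]). *)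
Definition stable (alpha : R) (mu : probability R R) : Prop :=
  nondegenerate mu /\
  forall a b : R, 0 < a -> 0 < b -> exists D : R,
    same_law
      (pushforward (mu \x mu)%E
         (fun y : R * R => (a * y.1 + b * y.2 : R)))
      (pushforward mu
         (fun y : R => ((a `^ alpha + b `^ alpha) `^ alpha^-1 * y + D : R))).

Definition charfun (mu : probability R R) (t : R) : R[i] :=
  Cintegral mu (fun x : R => cexp (0 +i* (t * x))).

Definition levy_integrable (nu : {measure set R -> \bar R}) : Prop :=
  nu [set 0] = 0%E /\
  (\int[nu]_(x in setT) (Num.min 1 (x ^+ 2))%:E < +oo)%E.

Definition levy_khintchine_exponent (b s : R)
    (nu : {measure set R -> \bar R}) (t : R) : R[i] :=
  (- (s * t ^+ 2 / 2)) +i* (b * t) +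
  Cintegral nu (fun x : R =>
    cexp (0 +i* (t * x)) - 1 - (0 +i* (t * x * \1_(`[-1, 1]) x))).

(* [mu] is infinitely divisible with Levy measure [nu]; here [b] is the drift
   and [s] the variance of the Gaussian part. *)
Definition is_levy_measure_of (nu : {measure set R -> \bar R})
    (mu : probability R R) : Prop :=
  levy_integrable nu /\
  exists b s : R, 0 <= s /\
    forall t : R, charfun mu t = cexp (levy_khintchine_exponent b s nu t).

Definition right_skewed_stable (alpha : R) (mu : probability R R) : Prop :=
  stable alpha mu /\
  exists nu : {measure set R -> \bar R},
    is_levy_measure_of nu mu /\ nu (~` `]0, +oo[) = 0%E.

End laws_on_the_line.

(* Main.v *)
Require Import Defs.
From HB Require Import structures.
From mathcomp Require Import all_boot all_order all_algebra.
From mathcomp Require Import all_classical all_reals all_analysis.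
From mathcomp Require Import complex.
From mathcomp Require Import measurable_realfun ring lra.
Set Implicit Arguments.
Unset Strict Implicit.
Unset Printing Implicit Defensive.
Import Order.TTheory GRing.Theory Num.Theory.
Import numFieldNormedType.Exports.
Local Open Scope classical_set_scope.
Local Open Scope ring_scope.
Local Open Scope complex_scope.

(* First part.  Since the Levy measure of [X] lives on [(0, +oo)], [X] has finite
   exponential moments [E exp(-s X)] for [s > 0]: the compound Poisson approximations
   of [X] have uniformly bounded ones.  Stability then forces
   [ln E exp(-s X) = k s^alpha + beta s].  For [phi s = ln E exp(-s Z)], corrected by
   a linear term, independence gives [sum_j phi(psi_j s) = k s^alpha], and convexity
   gives [|phi s| <= C s^alpha].  Hence [g x = exp(- alpha x) phi(exp x)], up to a
   constant, is a bounded continuous solution of the convolution equation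
   [sum_j psi_j^alpha g(x + ln psi_j) = 0], whose symbol
   [sum_j psi_j^(alpha + i t)] never vanishes; so it is [0], [phi s = k' s^alpha], and
   [Z] is distributed as [r X + m].

   Second part.  If [sum_j psi_j^(alpha + i theta) = 0], let [Z] be symmetric with
   Levy density proportional to [|x|^(- 1 - alpha) (1 + cos(theta ln |x|) / 2)].  The
   exponent of [psi_j Z] oscillates in [ln |t|] with frequency [theta] around a multiple
   of [|t|^alpha], and the oscillations cancel in the sum.  The law of [Z] is built
   from its integrable characteristic function, a limit of those of compound Poisson
   laws. *)

(** * Integration on the line *)

(** The logarithm of the characteristic function of [Z] is complex and comes with no growth bound.
    The Laplace transform is positive: its logarithm is real, and convexity supplies the bound. Some
    bound is indispensable, since zeros of the symbol at other complex frequencies give unbounded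
    exponential solutions of the convolution equation. Total skewness is what makes the transform
    finite. The condition [alpha != 1] enters twice: [2 ^ (1 / alpha) != 2] separates the linear
    term from [s ^ alpha], and [s ^ (alpha - 1)] tends to [0] at one end of the half-line, which
    fixes the sign of the corrected logarithm. The Fejer kernel is the common analytic tool. Its
    transform is a triangle with compact support, so the symbol has to be inverted on a bounded
    range of frequencies only; smoothing by it reduces the pairing of a test function with a measure
    to Fourier transforms; and its positivity makes the limit density of the second part
    nonnegative. In the second part the coefficient [1 / 2] keeps the Levy density away from [0];
    this yields a lower bound [c |t| ^ alpha] for the exponent, hence an integrable characteristic
    function. Non-stability rests on the injectivity of the exponent as a function of the
    density. *)

Notation L1 m f := (integrable m setT (EFin \o f)).

Section lebesgue_on_R.
Variable R : realType.

(* The Lebesgue measure of the library lives on the type [measurableTypeR R];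
   this copy lives on [R] with its canonical measurable structure. *)
Definition leb (A : set R) : \bar R := @lebesgue_measure R A.

Let leb0 : leb set0 = 0%E. Proof. exact: measure0. Qed.
Let leb_ge0 A : (0 <= leb A)%E. Proof. exact: measure_ge0. Qed.
Let leb_sigma_additive : semi_sigma_additive leb.
Proof.
by move=> F mF tF mUF; exact: (@measure_semi_sigma_additive _ _ _ (@lebesgue_measure R)).
Qed.

HB.instance Definition _ :=
  isMeasure.Build _ _ _ leb leb0 leb_ge0 leb_sigma_additive.

Let leb_sigma_finite : sigma_finite setT leb.
Proof. exact: (@sigma_finiteT _ _ _ (@lebesgue_measure R)). Qed.

HB.instance Definition _ := Measure_isSigmaFinite.Build _ _ _ leb leb_sigma_finite.

Lemma ge0_integral_leb (D : set R) (f : R -> \bar R) : measurable D ->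
  measurable_fun D f -> (forall x, D x -> 0 <= f x)%E ->
  (\int[leb]_(x in D) f x = \int[@lebesgue_measure R]_(x in D) f x)%E.
Proof.
move=> mD mf f0.
have h := @ge0_integral_pushforward _ _ (measurableTypeR R) R R idfun
  (@measurable_id _ _ setT) (@lebesgue_measure R) D f mD mf.
by rewrite -[RHS]h// => y; rewrite inE; exact: f0.
Qed.

Lemma integral_leb (D : set R) (f : R -> \bar R) : measurable D ->
  measurable_fun D f ->
  (\int[leb]_(x in D) f x = \int[@lebesgue_measure R]_(x in D) f x)%E.
Proof.
move=> mD mf; rewrite integralE [RHS]integralE; congr (_ - _)%E;
  apply: ge0_integral_leb => //.
- exact: measurable_funepos.
- exact: measurable_funeneg.
Qed.

Lemma integrable_leb (D : set R) (f : R -> \bar R) : measurable D ->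
  (@lebesgue_measure R).-integrable D f -> leb.-integrable D f.
Proof.
move=> mD /integrableP[mf fi]; apply/integrableP; split => //.
by rewrite ge0_integral_leb//; exact: measurableT_comp.
Qed.

End lebesgue_on_R.

Section real_integrals.
Context d (T : measurableType d) (R : realType).
Variable m : {measure set T -> \bar R}.
Implicit Types f g : T -> R.

Lemma L1_measurable f : L1 m f -> measurable_fun setT f.
Proof. by move=> /integrableP[/measurable_EFinP]. Qed.

Lemma L1_dom f g : measurable_fun setT f -> L1 m g ->
  (forall x, `|f x| <= g x) -> L1 m f.
Proof.
move=> mf ig fg; apply: le_integrable ig => //; first exact/measurable_EFinP.
move=> x _ /=; rewrite lee_fin; apply: le_trans (fg x) _; exact: ler_norm.
Qed.

Lemma L1_ge0 f : measurable_fun setT f -> (forall x, 0 <= f x) ->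
  (\int[m]_x (f x)%:E < +oo)%E -> L1 m f.
Proof.
move=> mf f0 fi; apply/integrableP; split; first exact/measurable_EFinP.
by rewrite (eq_integral (EFin \o f))// => x _ /=; rewrite ger0_norm.
Qed.

Lemma L1_lty f : L1 m f -> (\int[m]_x (f x)%:E < +oo)%E.
Proof. by move=> h; have := integrable_lty measurableT h. Qed.

Lemma L1K f : L1 m f -> (\int[m]_x f x)%:E = (\int[m]_x (f x)%:E)%E.
Proof.
by move=> fi; rewrite /Rintegral fineK//; exact: integrable_fin_num.
Qed.

Lemma L1D f g : L1 m f -> L1 m g -> L1 m (fun x => f x + g x).
Proof. by move=> fi gi; have := integrableD measurableT fi gi. Qed.

Lemma L1B f g : L1 m f -> L1 m g -> L1 m (fun x => f x - g x).
Proof. by move=> fi gi; have := integrableB measurableT fi gi. Qed.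

Lemma L1Z (k : R) f : L1 m f -> L1 m (fun x => k * f x).
Proof. by move=> fi; have := integrableZl measurableT k fi. Qed.

Lemma L1_norm f : L1 m f -> L1 m (fun x => `|f x|).
Proof. by move=> fi; have := integrable_norm fi. Qed.

Lemma L1M_bounded (k : R) f g : L1 m g -> measurable_fun setT f ->
  (forall x, `|f x| <= k) -> L1 m (fun x => f x * g x).
Proof.
move=> gi mf fk; apply: (@L1_dom _ (fun x => k * `|g x|)).
- by apply: measurable_funM => //; exact: L1_measurable.
- exact/L1Z/L1_norm.
- by move=> x; rewrite normrM ler_wpM2r.
Qed.

Lemma L1_sum (I : Type) (s : seq I) (h : I -> T -> R) :
  (forall i, L1 m (h i)) -> L1 m (fun x => \sum_(i <- s) h i x).
Proof.
move=> hi; elim: s => [|i s ih].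
  by rewrite (_ : (_ \o _) = (cst 0%E)) ?integrable0//; apply/funext => x /=;
    rewrite big_nil.
rewrite (_ : (_ \o _) = EFin \o (fun x => h i x + \sum_(j <- s) h j x)).
  exact: L1D.
by apply/funext => x /=; rewrite big_cons.
Qed.

Lemma Rintegral_sum (I : Type) (s : seq I) (h : I -> T -> R) :
  (forall i, L1 m (h i)) ->
  \int[m]_x (\sum_(i <- s) h i x) = \sum_(i <- s) \int[m]_x h i x.
Proof.
move=> hi; elim: s => [|i s ih].
  rewrite big_nil; under eq_Rintegral do rewrite big_nil.
  by rewrite /Rintegral integral0.
rewrite big_cons -ih -RintegralD//; last exact: L1_sum.
by apply: eq_Rintegral => x _; rewrite big_cons.
Qed.

Lemma le_norm_Rintegral f g : measurable_fun setT f -> L1 m g ->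
  (forall x, `|f x| <= g x) -> `|\int[m]_x f x| <= \int[m]_x g x.
Proof.
move=> mf gi fg; have fi := L1_dom mf gi fg.
apply: le_trans (le_normr_Rintegral measurableT fi) _.
by apply: le_Rintegral => //; exact: L1_norm.
Qed.

Lemma Rintegral_dct (f_ : nat -> T -> R) f g :
  (forall n, measurable_fun setT (f_ n)) -> L1 m g ->
  (forall n x, `|f_ n x| <= g x) ->
  (forall x, f_ n x @[n --> \oo] --> f x) ->
  L1 m f /\ \int[m]_x f_ n x @[n --> \oo] --> \int[m]_x f x.
Proof.
move=> mf gi fg ff.
have mfE : measurable_fun setT f.
  by apply: (measurable_fun_cvg mf) => x _; exact: ff.
have fi : L1 m f.
  apply: (L1_dom mfE gi) => x.
  have /cvg_norm/(cvg_lim (@norm_hausdorff _ _)) <- := ff x.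
  apply: limr_le; last by near=> n; exact: fg.
  by apply/cvg_ex; eexists; apply: cvg_norm; exact: ff.
split => //; apply: fine_cvg; rewrite fineK; last exact: integrable_fin_num.
apply: (@dominated_cvg _ _ _ m setT measurableT _ _ (EFin \o g)) => //.
- by move=> n; apply/measurable_EFinP; exact: mf.
- by move=> x _; apply/fine_cvgP; split; [exact: nearW|exact: ff].
- by move=> n x _ /=; rewrite lee_fin.
Unshelve. all: by end_near. Qed.

Lemma Rintegral_eq0 f : L1 m f -> (forall x, 0 <= f x) -> \int[m]_x f x = 0 ->
  ae_eq m setT f (cst 0).
Proof.
move=> fi f0 f00.
have := @ae_eq_integral_abs _ _ _ m setT measurableT (EFin \o f).
move=> /(_ (measurable_int _ fi)) [+ _].
have -> : (\int[m]_x `|(EFin \o f) x| = 0)%E.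
  rewrite -[RHS]/(0%:E) -f00 L1K//; apply: eq_integral => x _ /=.
  by rewrite ger0_norm.
by move=> /(_ erefl); apply: filterS => x /(_ I) /= [] ->.
Qed.

End real_integrals.

Section finite_measures.
Context d (T : measurableType d) (R : realType).
Variable m : {finite_measure set T -> \bar R}.

Lemma L1_bounded (k : R) (f : T -> R) : measurable_fun setT f ->
  (forall x, `|f x| <= k) -> L1 m f.
Proof.
move=> mf fk; apply: (L1_dom (g := cst k)) => //.
by apply: finite_measure_integrable_cst.
Qed.

End finite_measures.

Section fubini_real.
Context d1 d2 (T1 : measurableType d1) (T2 : measurableType d2) (R : realType).
Variable m1 : {sigma_finite_measure set T1 -> \bar R}.
Variable m2 : {sigma_finite_measure set T2 -> \bar R}.
Variables (f : T1 * T2 -> R) (g : T1 -> R) (h : T2 -> R).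
Hypotheses (mf : measurable_fun setT f) (gi : L1 m1 g) (hi : L1 m2 h).
Hypothesis fgh : forall x y, `|f (x, y)| <= g x * h y.

Lemma L1_section1 x : L1 m2 (fun y => f (x, y)).
Proof.
apply: (L1_dom _ (L1Z (g x) hi)) => [|y]; last exact: fgh.
by apply: measurableT_comp => //; exact: pair1_measurable.
Qed.

Lemma L1_section2 y : L1 m1 (fun x => f (x, y)).
Proof.
apply: (L1_dom _ (L1Z (h y) gi)) => [|x]; last by rewrite mulrC.
by apply: measurableT_comp => //; exact: pair2_measurable.
Qed.

(** By Tonelli, since the bound is a product, the integral of [|f|] is at most the product of the
    [L1] norms of [g] and [h]. *)
Lemma L1_prod : L1 (m1 \x m2)%E f.
Proof.
have mEf : measurable_fun setT (EFin \o f) by exact/measurable_EFinP.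
apply/integrable12ltyP => //.
apply: (@le_lt_trans _ _ (\int[m1]_x (`|g x| * \int[m2]_y `|h y|)%:E)%E).
  apply: ge0_le_integral => //.
  - by move=> x _; exact: integral_ge0.
  - apply: (@measurable_fun_fubini_tonelli_F _ _ _ _ _ m2 (abse \o (EFin \o f))) => //.
    - exact: measurableT_comp.
    - by move=> z; exact: abse_ge0.
  - apply/measurable_EFinP; apply: measurable_funM => //.
    by apply: measurableT_comp => //; exact: L1_measurable gi.
  - move=> x _; rewrite EFinM L1K; last exact: L1_norm.
    rewrite -ge0_integralZl//; last first.
      by apply/measurable_EFinP; apply: measurableT_comp => //; exact: L1_measurable hi.
    apply: ge0_le_integral => //.
    - apply: measurableT_comp => //; apply/measurable_EFinP.
      by apply: measurableT_comp => //; exact: pair1_measurable.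
    - apply/measurable_EFinP; apply: measurable_funM => //.
      by apply: measurableT_comp => //; exact: L1_measurable hi.
    - by move=> y _ /=; rewrite lee_fin -normrM (le_trans (fgh x y))// ler_norm.
apply: L1_lty; rewrite (_ : (fun x => _) =
   (fun x => (\int[m2]_y `|h y|) * `|g x|)); last by apply/funext => x; rewrite mulrC.
exact/L1Z/L1_norm.
Qed.

Lemma L1_fubini1 : L1 m1 (fun x => \int[m2]_y f (x, y)).
Proof.
have := integrable_fubini_F L1_prod; congr (integrable _ _).
by apply/funext => x /=; rewrite L1K//; exact: L1_section1.
Qed.

Lemma L1_fubini2 : L1 m2 (fun y => \int[m1]_x f (x, y)).
Proof.
apply: (@L1_dom _ _ _ _ _ (fun y => (\int[m1]_x g x) * h y)); last 2 first.
- exact: L1Z.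
- move=> y; rewrite mulrC -RintegralZl//.
  apply: le_norm_Rintegral => [||x]; last by rewrite mulrC.
  + exact: L1_measurable (L1_section2 y).
  + exact: L1Z.
apply/measurable_EFinP.
rewrite (_ : _ \o _ = fubini_G m1 (EFin \o f)).
  exact: measurable_fubini_G L1_prod.
by apply/funext => y /=; rewrite L1K//; exact: L1_section2.
Qed.

Lemma Rintegral_prod :
  \int[(m1 \x m2)%E]_z f z = \int[m1]_x \int[m2]_y f (x, y).
Proof.
apply: EFin_inj; rewrite L1K ?L1K; [|exact: L1_fubini1|exact: L1_prod].
rewrite -integral12_prod_meas1; last exact: L1_prod.
by apply: eq_integral => x _; rewrite L1K//; exact: L1_section1.
Qed.

Lemma Rfubini :
  \int[m1]_x \int[m2]_y f (x, y) = \int[m2]_y \int[m1]_x f (x, y).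
Proof.
apply: EFin_inj; rewrite !L1K; [|exact: L1_fubini2|exact: L1_fubini1].
under eq_integral => x _ do rewrite (L1K (L1_section1 x)).
under [RHS]eq_integral => x _ do rewrite (L1K (L1_section2 x)).
exact: Fubini L1_prod.
Qed.

End fubini_real.

(** * Images of weighted measures *)

Section image_measure.
Context d d' (T : measurableType d) (U : measurableType d') (R : realType).
Variables (m : {measure set T -> \bar R}) (w : T -> R) (J : T -> U).
Hypotheses (w_ge0 : forall x, 0 <= w x) (wi : L1 m w).
Hypothesis mJ : measurable_fun setT J.

(** The image under [J] of the measure with density [w] with respect to [m]. One construction thus
    gives laws ([w = 1]), exponential tilts and restrictions ([J] the identity), and measures given
    by a density in the logarithmic variable. *)
Definition image_measure_def (A : set U) : \bar R :=
  (\int[m]_(x in J @^-1` A) (w x)%:E)%E.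

Let mpre (A : set U) : measurable A -> measurable (J @^-1` A).
Proof. by move=> mA; rewrite -[X in measurable X]setTI; exact: mJ. Qed.

Let im0 : image_measure_def set0 = 0%E.
Proof. by rewrite /image_measure_def preimage_set0 integral_set0. Qed.

Let im_ge0 A : (0 <= image_measure_def A)%E.
Proof. by apply: integral_ge0 => x _; rewrite lee_fin. Qed.

Let im_sigma_additive : semi_sigma_additive image_measure_def.
Proof.
move=> F mF tF mUF; rewrite /image_measure_def preimage_bigcup.
rewrite ge0_integral_bigcup//=.
- by apply: is_cvg_ereal_nneg_natsum_cond => n _ _; exact: im_ge0.
- by move=> k; exact: mpre.
- by apply: measurable_funTS; exact: measurable_int wi.
- by move=> x _; rewrite lee_fin.
- apply/trivIsetP => /= i j _ _ ij; rewrite -preimage_setI.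
  by move/trivIsetP : tF => /(_ _ _ _ _ ij) ->//; rewrite preimage_set0.
Qed.

HB.instance Definition _ :=
  isMeasure.Build _ _ _ image_measure_def im0 im_ge0 im_sigma_additive.

Let im_finite : fin_num_fun image_measure_def.
Proof.
move=> A mA; apply: integrable_fin_num; first exact: mpre.
by apply: integrableS wi => //; exact: mpre.
Qed.

HB.instance Definition _ :=
  Measure_isFinite.Build _ _ _ image_measure_def im_finite.

Let im_indic (A : set U) : measurable A ->
  (\int[image_measure_def]_y (\1_A y)%:E = \int[m]_x (\1_A (J x) * w x)%:E)%E.
Proof.
move=> mA; rewrite integral_indic// setIT /= /image_measure_def.
rewrite integral_mkcond; apply: eq_integral => x _.
rewrite /patch indicE; have [xA|xA] := boolP (x \in J @^-1` A).
- by rewrite mem_set ?mul1r//; rewrite inE in xA.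
- by rewrite memNset ?mul0r//; rewrite notin_setE in xA.
Qed.

Import HBNNSimple.

Let im_nnsfun (h : {nnsfun U >-> R}) :
  (\int[image_measure_def]_y (h y)%:E = \int[m]_x (h (J x) * w x)%:E)%E.
Proof.
under [LHS]eq_integral do rewrite fimfunE -fsumEFin//.
rewrite [LHS]ge0_integral_fsum//; last 2 first.
  - by move=> r; exact/measurable_EFinP/measurableT_comp.
  - by move=> n x _; rewrite EFinM nnfun_muleindic_ge0.
under [RHS]eq_integral.
  move=> x _; rewrite EFinM fimfunE -fsumEFin// ge0_mule_fsuml; last first.
    by move=> r; rewrite EFinM nnfun_muleindic_ge0.
  over.
rewrite [RHS]ge0_integral_fsum//; last 2 first.
  - move=> r; apply: emeasurable_funM; last exact: measurable_int wi.
    apply/measurable_EFinP; apply: measurable_funM => //.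
    exact: measurableT_comp.
  - move=> n x _; apply: mule_ge0; last by rewrite lee_fin.
    by rewrite EFinM nnfun_muleindic_ge0.
apply: eq_fsbigr => r _.
have [->|r0] := eqVneq r 0%R.
  by rewrite !integral0_eq// => x _; rewrite ?mul0r ?mul0e.
have [r_lt0|r_ge0] := ltP r 0%R.
  have -> : h @^-1` [set r] = set0 by rewrite preimage_nnfun0.
  by rewrite !integral0_eq// => x _; rewrite indic0 ?mulr0 ?mul0e.
under eq_integral do rewrite EFinM.
rewrite ge0_integralZl//; [|exact/measurable_EFinP].
rewrite im_indic// -ge0_integralZl//; [|
  |by move=> x _; rewrite lee_fin mulr_ge0].
  by apply: eq_integral => x _; rewrite !EFinM muleA.
apply/measurable_EFinP; apply: measurable_funM; last exact: L1_measurable wi.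
exact: measurableT_comp.
Qed.

Lemma ge0_integral_image_measure (h : U -> R) : measurable_fun setT h ->
  (forall y, 0 <= h y) ->
  (\int[image_measure_def]_y (h y)%:E = \int[m]_x (h (J x) * w x)%:E)%E.
Proof.
move=> mh h0; have mhE : measurable_fun setT (EFin \o h) by exact/measurable_EFinP.
pose f_ := nnsfun_approx measurableT mhE.
have fh y : (EFin \o f_ ^~ y) n @[n --> \oo] --> (h y)%:E.
  by apply: (@cvg_nnsfun_approx _ _ _ _ measurableT _ mhE) => // x _; rewrite lee_fin.
have nd y a b : (a <= b)%N -> f_ a y <= f_ b y.
  by move=> ab; exact/lefP/nd_nnsfun_approx.
transitivity (limn (fun n => \int[image_measure_def]_y (f_ n y)%:E)%E).
  rewrite -monotone_convergence//=.
  - by apply: eq_integral => y _; apply/esym/cvg_lim => //; exact: fh.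
  - by move=> n; exact/measurable_EFinP.
  - by move=> n y _; rewrite lee_fin.
  - by move=> y _ a b ab; rewrite lee_fin nd.
under eq_fun do rewrite im_nnsfun.
rewrite -monotone_convergence//=.
- apply: eq_integral => x _; apply/cvg_lim => //.
  under eq_fun do rewrite EFinM.
  rewrite EFinM; apply: cvgeZr => //; exact: fh.
- move=> n; apply/measurable_EFinP; apply: measurable_funM; last exact: L1_measurable wi.
  exact: measurableT_comp.
- by move=> n x _; rewrite lee_fin mulr_ge0.
- by move=> x _ a b ab; rewrite lee_fin ler_wpM2r// nd.
Qed.

Lemma L1_image_measure (h : U -> R) : measurable_fun setT h ->
  L1 m (fun x => h (J x) * w x) -> L1 image_measure_def h.
Proof.
move=> mh hi; apply/integrableP; split; first exact/measurable_EFinP.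
rewrite (ge0_integral_image_measure (h := fun y => `|h y|))//; last first.
  exact: measurableT_comp.
rewrite (eq_integral (fun x => (`|h (J x) * w x|)%:E)); last first.
  by move=> x _; rewrite normrM (ger0_norm (w_ge0 x)).
exact/L1_lty/L1_norm.
Qed.

Lemma Rintegral_image_measure (h : U -> R) : measurable_fun setT h ->
  L1 m (fun x => h (J x) * w x) ->
  \int[image_measure_def]_y h y = \int[m]_x (h (J x) * w x).
Proof.
move=> mh hi.
have hpi := L1_measurable hi.
have split (f : R) : f = Num.max f 0 - Num.max (- f) 0.
  by rewrite /Num.max; case: ltP => ?; case: ltP => ?; lra.
pose hp y := Num.max (h y) 0; pose hn y := Num.max (- h y) 0.
have mhp : measurable_fun setT hp by exact: measurable_funrpos.
have mhn : measurable_fun setT hn by exact: measurable_funrneg.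
have hp0 y : 0 <= hp y by rewrite le_max lexx orbT.
have hn0 y : 0 <= hn y by rewrite le_max lexx orbT.
have aux (k : U -> R) : measurable_fun setT k -> (forall y, 0 <= k y) ->
    (forall y, k y <= `|h y|) -> L1 m (fun x => k (J x) * w x).
  move=> mk k0 kh; apply: (L1_dom _ (L1_norm hi)) => [|x].
    apply: measurable_funM; first exact: measurableT_comp.
    exact: L1_measurable wi.
  rewrite !normrM (ger0_norm (k0 _)) ler_wpM2r//.
have ip : L1 m (fun x => hp (J x) * w x).
  by apply: aux => // y; rewrite ge_max ler_norm normr_ge0.
have in_ : L1 m (fun x => hn (J x) * w x).
  by apply: aux => // y; rewrite ge_max -normrN ler_norm normr_ge0.
transitivity (\int[image_measure_def]_y (hp y - hn y)).
  by apply: eq_Rintegral => y _; exact: split.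
rewrite RintegralB//; [|exact: L1_image_measure|exact: L1_image_measure].
transitivity (\int[m]_x (hp (J x) * w x - hn (J x) * w x)); last first.
  by apply: eq_Rintegral => x _; rewrite -mulrBl -split.
rewrite RintegralB//; congr (_ - _); apply: EFin_inj; rewrite !L1K//;
  by [exact: ge0_integral_image_measure|exact: L1_image_measure].
Qed.

(** Packages the construction as an abstract finite measure with its transfer formula, which is all
    that later arguments use. *)
Lemma ex_image_measure : exists mu : {finite_measure set U -> \bar R},
  (forall A, measurable A -> mu A = \int[m]_(x in J @^-1` A) (w x)%:E)%E /\
  forall h : U -> R, measurable_fun setT h ->
  ((forall y, 0 <= h y) ->
     (\int[mu]_y (h y)%:E = \int[m]_x (h (J x) * w x)%:E)%E) /\
  (L1 m (fun x => h (J x) * w x) ->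
     L1 mu h /\ \int[mu]_y h y = \int[m]_x (h (J x) * w x)).
Proof.
exists image_measure_def; split=> // h mh; split.
  by move=> h0; exact: ge0_integral_image_measure.
by move=> hi; split; [exact: L1_image_measure|exact: Rintegral_image_measure].
Qed.

End image_measure.

Section measurability.
Context d (T : measurableType d) (R : realType).
Implicit Types f : T -> R.

Lemma measurable_cos_comp f : measurable_fun setT f ->
  measurable_fun setT (fun x => cos (f x)).
Proof.
by move=> mf; apply: (measurableT_comp (f := cos)) => //;
  apply: continuous_measurable_fun; exact: continuous_cos.
Qed.

Lemma measurable_sin_comp f : measurable_fun setT f ->
  measurable_fun setT (fun x => sin (f x)).
Proof.
by move=> mf; apply: (measurableT_comp (f := sin)) => //;
  apply: continuous_measurable_fun; exact: continuous_sin.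
Qed.

Lemma measurable_expR_comp f : measurable_fun setT f ->
  measurable_fun setT (fun x => expR (f x)).
Proof. by move=> mf; exact: (measurableT_comp (f := expR)). Qed.

Lemma measurable_norm_comp f : measurable_fun setT f ->
  measurable_fun setT (fun x => `|f x|).
Proof. by move=> mf; exact: (measurableT_comp (f := @Num.norm R R)). Qed.

Lemma measurable_exprn_comp f n : measurable_fun setT f ->
  measurable_fun setT (fun x => f x ^+ n).
Proof. by move=> mf; exact: measurable_funX. Qed.

Lemma measurable_oppr_comp f : measurable_fun setT f ->
  measurable_fun setT (fun x => - f x).
Proof. by move=> mf; under eq_fun do rewrite -sub0r; exact: measurable_funB. Qed.

End measurability.

Ltac meas := repeat first
  [ exact: measurable_cst | exact: measurable_id | assumption
  | exact: measurable_fst | exact: measurable_snd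
  | apply: measurable_cos_comp | apply: measurable_sin_comp
  | apply: measurable_expR_comp | apply: measurable_norm_comp
  | apply: measurable_exprn_comp
  | apply: measurable_funM | apply: measurable_funB | apply: measurable_funD
  | apply: measurable_oppr_comp ].

(** * Elementary trigonometric estimates *)

Section elementary.
Variable R : realType.
Implicit Types x y : R.

(** With [|c - x| <= |y - x|] in place of membership in an interval, the statement applies whatever
    the order of [x] and [y]; the case [y < x] follows by reflecting [f]. *)
Lemma MVT_R (f f' : R -> R) x y : (forall z : R, is_derive z 1 f (f' z)) ->
  exists2 c, `|c - x| <= `|y - x| & f y - f x = f' c * (y - x).
Proof.
move=> df.
wlog xy : f f' x y df / x <= y.
  move=> h; case: (leP x y) => [|/ltW yx]; first exact: h.
  have [||c cxy e] := h (fun z => f (- z)) (fun z => - f' (- z)) (- x) (- y).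
  - move=> z; rewrite -mulrN1; apply: (@is_derive1_comp R f -%R) => //.
  - by rewrite lerN2.
  exists (- c).
  - rewrite (_ : - c - x = - (c - - x)) ?normrN; last by ring.
    by rewrite (_ : y - x = - (- y - - x)) ?normrN; last by ring.
  - by rewrite !opprK in e; rewrite e; ring.
have cf : continuous f.
  move=> z; have [+ _] := df z.
  by move=> /derivable1_diffP/differentiable_continuous.
move: xy; rewrite le_eqVlt => /predU1P[<-|xy].
  by exists x; rewrite ?lexx// !subrr mulr0.
have [c + e] := MVT xy (fun z _ => df z) (continuous_subspaceT cf).
rewrite in_itv/= => /andP[xc cy]; exists c => //.
by rewrite !ger0_norm; lra.
Qed.

Lemma cos_norm_le1 x : `|cos x| <= 1. Proof. exact: cos_max. Qed.

Lemma sin_norm_le1 x : `|sin x| <= 1.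
Proof. by rewrite ler_norml sin_geN1 sin_le1. Qed.

Lemma sin_norm_le x : `|sin x| <= `|x|.
Proof.
have [c _] := @MVT_R sin cos 0 x (@is_derive_sin R).
rewrite sin0 !subr0 => ->; rewrite normrM.
by rewrite -[leRHS]mul1r ler_wpM2r// cos_norm_le1.
Qed.

Lemma sqr_ler_norm x y : `|x| <= `|y| -> x ^+ 2 <= y ^+ 2.
Proof. by move=> h; rewrite -(real_normK (num_real x)) -(real_normK (num_real y)) ler_sqr ?nnegrE. Qed.

Lemma one_sub_cos_ge0 x : 0 <= 1 - cos x. Proof. by rewrite subr_ge0 cos_le1. Qed.

Lemma one_sub_cosE x : 1 - cos x = 2 * sin (x / 2) ^+ 2.
Proof.
have e : x = (x / 2) *+ 2 by rewrite mulr2n; field.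
by rewrite {1}e cos_mulr2n cos2sin2; ring.
Qed.

Lemma one_sub_cos_le x : 1 - cos x <= x ^+ 2 / 2.
Proof.
rewrite one_sub_cosE.
have -> : x ^+ 2 / 2 = 2 * (x / 2) ^+ 2 by field.
by rewrite ler_pM2l// sqr_ler_norm// sin_norm_le.
Qed.

(** Two uses of the mean value theorem: the derivative [cos c - 1] is in turn at most
    [|c| <= |x|]. *)
Lemma sin_sub_le x : `|sin x - x| <= x ^+ 2.
Proof.
have [c] := @MVT_R (fun z => sin z - z) (fun z => cos z - 1) 0 x _.
rewrite sin0 !subr0 => cx ->; rewrite normrM -normrN opprB.
rewrite -(real_normK (num_real x)) expr2 ler_wpM2r//.
have [c' _] := @MVT_R cos (fun z => - sin z) 0 c (@is_derive_cos R).
rewrite cos0 subr0 -normrN opprB => ->; rewrite normrM normrN.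
by apply: le_trans cx; rewrite -[leRHS]mul1r ler_wpM2r// sin_norm_le1.
Qed.
End elementary.

(** * Affine changes of variable in Lebesgue integrals *)

Section affine_substitution.
Variable R : realType.
Variables (a b : R).
Hypothesis a_gt0 : 0 < a.

Let phi (x : measurableTypeR R) : measurableTypeR R := a * x + b.

Let mphi : measurable_fun setT phi.
Proof.
have : measurable_fun setT (fun x : R => a * x + b) by meas.
by [].
Qed.

(** The image of Lebesgue measure scaled by [a] has the right value on half-open intervals, and
    these values characterise Lebesgue measure. *)
Let lebesgue_affine (A : set R) : measurable A ->
  (a%:E * leb (phi @^-1` A) = leb A)%E.
Proof.
move=> mA; have a0 : 0 <= a by exact: ltW.
pose k : {nonneg R} := NngNum a0.
have := @lebesgue_measure_unique R (mscale k (pushforward (@lebesgue_measure R) phi)).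
move=> /(_ mphi) h; rewrite [RHS]h// => _ [[x y]] _ <-.
have pre : phi @^-1` `]x, y]%classic = `](x - b) / a, (y - b) / a]%classic.
  apply/seteqP; split => z /=; rewrite !in_itv/= /phi;
    by rewrite ltr_pdivrMr// ler_pdivlMr// ltrBlDr lerBrDr (mulrC z).
transitivity (a%:E * @lebesgue_measure R `](x - b) / a, (y - b) / a]%classic%R)%E; last first.
  by congr (_ * lebesgue_measure _)%E; rewrite -pre.
rewrite !lebesgue_measure_itv/= !lte_fin ltr_pM2r ?invr_gt0// ltrD2r.
case: ifPn => _; last by rewrite mule0.
by rewrite -!EFinB -EFinM; congr EFin; field; rewrite gt_eqF.
Qed.

Lemma ge0_integral_leb_affine (f : R -> R) : measurable_fun setT f ->
  (forall x, 0 <= f x) ->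
  (\int[@leb R]_x (f x)%:E = a%:E * \int[@leb R]_x (f (a * x + b))%:E)%E.
Proof.
move=> mf f0; have a0 : 0 <= a by exact: ltW.
pose k : {nonneg R} := NngNum a0.
pose psi (x : R) : R := a * x + b.
have mpsi : measurable_fun setT psi by meas.
have h := @ge0_integral_mscale _ R R (pushforward (@leb R) psi) setT measurableT k
  (EFin \o f).
transitivity (k%:num%:E * \int[pushforward (@leb R) psi]_x (EFin \o f) x)%E.
  rewrite -(h mpsi); first last.
  - by move=> x _; rewrite lee_fin.
  - exact/measurable_EFinP.
  by apply: eq_measure_integral => A mA _; first [exact: lebesgue_affine
    | exact: (esym (lebesgue_affine mA))].
rewrite ge0_integral_pushforward//; first exact/measurable_EFinP.
by move=> x _; rewrite lee_fin.
Qed.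

Lemma L1_leb_affine (f : R -> R) : L1 (@leb R) f ->
  L1 (@leb R) (fun x => f (a * x + b)).
Proof.
move=> fi; have mf := L1_measurable fi.
have mfa : measurable_fun setT (fun x => f (a * x + b)).
  by apply: (measurableT_comp mf); meas.
apply/integrableP; split; first exact/measurable_EFinP.
have := L1_lty (L1_norm fi).
rewrite (ge0_integral_leb_affine (f := fun x => `|f x|))//; last by meas.
move=> h; rewrite ltey; apply: contraTN h => /eqP ->.
by rewrite gt0_muley ?lte_fin// ltxx.
Qed.

Lemma Rintegral_leb_affine (f : R -> R) : L1 (@leb R) f ->
  \int[@leb R]_x f x = a * \int[@leb R]_x f (a * x + b).
Proof.
move=> fi; have mf := L1_measurable fi; have fai := L1_leb_affine fi.
(* [f = (|f| + f) - |f|] is a difference of nonnegative integrable functions. *)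
pose fp x := `|f x| + f x; pose fm x := `|f x|.
have fmi : L1 (@leb R) fm by exact: L1_norm.
have fpi : L1 (@leb R) fp by exact: L1D.
have key (h : R -> R) : L1 (@leb R) h -> (forall x, 0 <= h x) ->
    \int[@leb R]_x h x = a * \int[@leb R]_x h (a * x + b).
  move=> hi h0; apply: EFin_inj; rewrite EFinM !L1K//; last exact: L1_leb_affine.
  by apply: ge0_integral_leb_affine => //; exact: L1_measurable hi.
have fE x : f x = fp x - fm x by rewrite /fp /fm addrC addKr.
transitivity (\int[@leb R]_x (fp x - fm x)).
  by apply: eq_Rintegral => x _; exact: fE.
rewrite RintegralB// key//; last first.
  by move=> x; rewrite /fp -lerBlDr sub0r -normrN ler_norm.
rewrite (key fm fmi (fun x => normr_ge0 (f x))).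
rewrite -mulrBr -RintegralB//; [|exact: L1_leb_affine|exact: L1_leb_affine].
by congr (_ * _); apply: eq_Rintegral => x _; rewrite -fE.
Qed.

End affine_substitution.

Section fourier_continuity.
Context d (T : measurableType d) (R : realType).
Variable mu : {finite_measure set T -> \bar R}.
Variable X : T -> R.
Hypothesis mX : measurable_fun setT X.

Lemma L1_cos (t : R) : L1 mu (fun x => cos (t * X x)).
Proof. by apply: (@L1_bounded _ _ _ _ 1) => [|x]; [meas|exact: cos_norm_le1]. Qed.

Lemma L1_sin (t : R) : L1 mu (fun x => sin (t * X x)).
Proof. by apply: (@L1_bounded _ _ _ _ 1) => [|x]; [meas|exact: sin_norm_le1]. Qed.

Lemma continuous_cos_transform : continuous (fun t : R => \int[mu]_x cos (t * X x)).
Proof.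
move=> t; apply/(@cvg_nbhsP _ R^o) => u ut.
have [] // := @Rintegral_dct _ _ _ mu (fun n x => cos (u n * X x))
  (fun x => cos (t * X x)) (cst 1).
- by move=> n; meas.
- exact: finite_measure_integrable_cst.
- by move=> n x; exact: cos_norm_le1.
- move=> x; apply: (cvg_comp (fun n => u n * X x) cos _ (@continuous_cos R (t * X x))).
  by apply: cvgM => //; exact: cvg_cst.
Qed.

Lemma continuous_sin_transform : continuous (fun t : R => \int[mu]_x sin (t * X x)).
Proof.
move=> t; apply/(@cvg_nbhsP _ R^o) => u ut.
have [] // := @Rintegral_dct _ _ _ mu (fun n x => sin (u n * X x))
  (fun x => sin (t * X x)) (cst 1).
- by move=> n; meas.
- exact: finite_measure_integrable_cst.
- by move=> n x; exact: sin_norm_le1.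
- move=> x; apply: (cvg_comp (fun n => u n * X x) sin _ (@continuous_sin R (t * X x))).
  by apply: cvgM => //; exact: cvg_cst.
Qed.

End fourier_continuity.

(** * The Fejer kernel *)

Section calculus.
Variable R : realType.

Lemma is_derive_continuous (f f' : R -> R) :
  (forall z : R, is_derive z 1 f (f' z)) -> continuous f.
Proof.
by move=> df z; have [+ _] := df z => /derivable1_diffP/differentiable_continuous.
Qed.

Lemma is_derive_LRcontinuous (f f' : R -> R) (a b : R) :
  (forall z : R, is_derive z 1 f (f' z)) -> derivable_oo_LRcontinuous f a b.
Proof.
move=> df; have cf := is_derive_continuous df; split.
- by move=> z _; have [] := df z.
- by apply: cvg_at_right_filter; exact: cf.
- by apply: cvg_at_left_filter; exact: cf.
Qed.

Lemma is_derive_derive1 (f f' : R -> R) (z : R) :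
  is_derive z 1 f (f' z) -> f^`()%classic z = f' z.
Proof. by move=> df; rewrite derive1E; case: df. Qed.

Lemma Rintegral_FTC2 (f F : R -> R) (a b : R) : a < b ->
  (forall z : R, is_derive z 1 F (f z)) -> continuous f ->
  \int[@lebesgue_measure R]_(x in `[a, b]) f x = F b - F a.
Proof.
move=> ab dF cf; rewrite /Rintegral (@continuous_FTC2 _ f F)//.
- exact: continuous_subspaceT.
- exact: is_derive_LRcontinuous dF.
- by move=> x _; exact: is_derive_derive1.
Qed.

Lemma Rintegral_by_parts (F G f g : R -> R) (a b : R) : a < b ->
  (forall z : R, is_derive z 1 F (f z)) -> continuous f ->
  (forall z : R, is_derive z 1 G (g z)) -> continuous g ->
  \int[@lebesgue_measure R]_(x in `[a, b]) (F x * g x) =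
  (F b * G b - F a * G a) - \int[@lebesgue_measure R]_(x in `[a, b]) (f x * G x).
Proof.
move=> ab dF cf dG cg; apply: Rintegration_by_parts => //.
- exact: continuous_subspaceT.
- exact: is_derive_LRcontinuous dF.
- by move=> x _; exact: is_derive_derive1.
- exact: continuous_subspaceT.
- exact: is_derive_LRcontinuous dG.
- by move=> x _; exact: is_derive_derive1.
Qed.

Lemma L1_leb_itv (f : R -> R) (a b : R) : continuous f ->
  L1 (@leb R) (fun x => f x * \1_(`[a, b]) x).
Proof.
move=> cf.
have h : (@leb R).-integrable `[a, b]%classic (EFin \o f).
  apply: integrable_leb => //; apply: continuous_compact_integrable.
    exact: segment_compact.
  exact: continuous_subspaceT.
have := (integrable_mkcond (EFin \o f) (measurable_itv `[a, b])).1 h.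
congr (integrable _ _ _); apply/funext => x /=.
by rewrite /patch indicE; case: ifPn => _; rewrite ?mulr1 ?mulr0.
Qed.

Lemma Rintegral_leb_itv (f : R -> R) (a b : R) : continuous f ->
  \int[@leb R]_x (f x * \1_(`[a, b]) x) =
  \int[@lebesgue_measure R]_(x in `[a, b]) f x.
Proof.
move=> cf; transitivity (\int[@leb R]_(x in `[a, b]) f x).
  rewrite [RHS]Rintegral_mkcond; apply: eq_Rintegral => x _.
  by rewrite /patch indicE; case: ifPn => _; rewrite ?mulr1 ?mulr0.
rewrite /Rintegral integral_leb//; apply: measurable_funTS.
by apply/measurable_EFinP; exact: continuous_measurable_fun.
Qed.

Lemma L1_leb_cauchy : L1 (@leb R) (fun x => (1 + x ^+ 2)^-1).
Proof.
have cq : continuous (fun x : R => (1 + x ^+ 2)^-1) by exact: continuous_oneDsqrV.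
have q0 (x : R) : 0 <= (1 + x ^+ 2)^-1 by rewrite invr_ge0 addr_ge0// sqr_ge0.
apply: L1_ge0 => //; first exact: continuous_measurable_fun.
rewrite ge0_integral_leb//; [|apply/measurable_EFinP; exact: continuous_measurable_fun
  |by move=> x _; rewrite lee_fin].
rewrite ge0_symfun_integralT//; last by move=> x /=; rewrite sqrrN.
by rewrite -set_itvcy (integral0y_oneDsqr R) -EFinM ltry.
Qed.

End calculus.

Section fejer_kernel.
Variable R : realType.
Implicit Types x t : R.

(** Equal to [(sin (x / 2) / (x / 2)) ^ 2], the Fourier transform of the triangle [1 - |t|] on
    [[-1, 1]]. *)
Definition fejer x : R := if x == 0 then 1 else 2 * (1 - cos x) / x ^+ 2.

Lemma fejer_sqr x : x ^+ 2 * fejer x = 2 * (1 - cos x).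
Proof.
rewrite /fejer; case: eqVneq => [->|x0]; first by rewrite cos0 expr0n/=; ring.
by field.
Qed.

Lemma fejer_ge0 x : 0 <= fejer x.
Proof.
rewrite /fejer; case: ifPn => // _.
by rewrite divr_ge0 ?sqr_ge0// mulr_ge0// one_sub_cos_ge0.
Qed.

Lemma fejer_le1 x : fejer x <= 1.
Proof.
rewrite /fejer; case: eqVneq => // x0.
rewrite ler_pdivrMr ?exprn_even_gt0// mul1r.
by have := one_sub_cos_le x; lra.
Qed.

(** [(1 + x ^ 2) fejer x = fejer x + 2 (1 - cos x) <= 1 + 4]. *)
Lemma fejer_le x : fejer x <= 5 * (1 + x ^+ 2)^-1.
Proof.
have x2 : 0 <= x ^+ 2 by exact: sqr_ge0.
rewrite ler_pdivlMr; last lra.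
rewrite mulrDr mulr1 mulrC.
have := fejer_sqr x; have := fejer_le1 x; have := cos_geN1 x; lra.
Qed.

Let weight t := 2 * (1 - t).

Let weight_itv_ge0 t : 0 <= weight t * \1_(`[0, 1]) t.
Proof.
rewrite indicE; case: (boolP (t \in _)); rewrite ?mulr0//.
by rewrite inE/= in_itv/= /weight => /andP[? ?]; rewrite mulr1; lra.
Qed.

Let continuous_weight : continuous weight.
Proof.
apply: (@is_derive_continuous _ _ (fun=> - 2)) => z.
by apply: is_derive_eq; rewrite /= ?scaler0 ?scaler1 /GRing.scale/=; ring.
Qed.

(** The triangle is folded onto [[0, 1]] by evenness, whence the factor [2] in the weight. It is
    used as a measure so that Fubini and dominated convergence apply to it directly. *)
Lemma ex_fejer_measure : exists tau : {finite_measure set R -> \bar R},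
  (forall h : R -> R, continuous h -> L1 tau h /\
     \int[tau]_t h t =
     \int[@lebesgue_measure R]_(t in `[0, 1]) (2 * (1 - t) * h t)) /\
  forall x, fejer x = \int[tau]_t cos (x * t).
Proof.
have [tau [_ tauE]] := ex_image_measure weight_itv_ge0
  (L1_leb_itv 0 1 continuous_weight) (@measurable_id _ R setT).
have main (h : R -> R) : continuous h -> L1 tau h /\
     \int[tau]_t h t =
     \int[@lebesgue_measure R]_(t in `[0, 1]) (2 * (1 - t) * h t).
  move=> ch; have mh := continuous_measurable_fun ch.
  have [_] := tauE h mh.
  have cwh : continuous (fun t => weight t * h t).
    by move=> t; apply: continuousM; [exact: continuous_weight|exact: ch].
  have eqw : (fun t => h t * (weight t * \1_(`[0, 1]) t)) =
             (fun t => weight t * h t * \1_(`[0, 1]) t).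
    by apply/funext => t; ring.
  rewrite eqw => /(_ (L1_leb_itv 0 1 cwh)) [? ->]; split => //.
  exact: Rintegral_leb_itv.
exists tau; split => // x.
have ccos : continuous (fun t => cos (x * t)).
  apply: (@is_derive_continuous _ _ (fun t => - (x * sin (x * t)))) => t.
  by apply: is_derive_eq; rewrite /GRing.scale/=; ring.
have [_ ->] := main _ ccos.
rewrite /fejer; case: eqVneq => [->|x0].
  have dF (t : R) : is_derive t 1 (fun t => 2 * t - t ^+ 2) (weight t).
    by apply: is_derive_eq; rewrite /weight /GRing.scale/= ?expr1; ring.
  transitivity (\int[@lebesgue_measure R]_(t in `[0, 1]) weight t).
    by rewrite (Rintegral_FTC2 ltr01 dF)//; ring.
  by apply: eq_Rintegral => t _; rewrite mul0r cos0 mulr1.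
(* The antiderivative found by one integration by parts. *)
pose F t := 2 * ((1 - t) * sin (x * t) / x - cos (x * t) / x ^+ 2).
have dF (t : R) : is_derive t 1 F (weight t * cos (x * t)).
  by apply: is_derive_eq; rewrite /weight /GRing.scale/=; field.
have cf : continuous (fun t => weight t * cos (x * t)).
  by move=> t; apply: continuousM; [exact: continuous_weight|exact: ccos].
by rewrite (Rintegral_FTC2 ltr01 dF cf) /F !mulr1 !mulr0 cos0 sin0; field.
Qed.

Lemma continuous_fejer : continuous fejer.
Proof.
have [tau [_ h]] := ex_fejer_measure.
rewrite (_ : fejer = fun x => \int[tau]_t cos (x * t)); last exact/funext.
exact: (@continuous_cos_transform _ _ _ tau id).
Qed.

Lemma measurable_fejer : measurable_fun setT fejer.
Proof. exact: continuous_measurable_fun continuous_fejer. Qed.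

Lemma L1_fejer : L1 (@leb R) fejer.
Proof.
apply: (L1_dom measurable_fejer (L1Z 5 (@L1_leb_cauchy R))) => x.
by rewrite ger0_norm ?fejer_ge0// fejer_le.
Qed.

Definition fejer_mass : R := \int[@leb R]_x fejer x.

(** On [[0, 1]], [sin (x / 2) >= x / 2 - x ^ 2 / 4 >= x / 4], so the kernel is at least [1 / 4]
    there. *)
Lemma fejer_mass_gt0 : 0 < fejer_mass.
Proof.
have cq : continuous (fun _ : R => 4^-1 : R) by move=> x; exact: cvg_cst.
have : \int[@leb R]_x (4^-1 * \1_(`[0, 1]) x) <= fejer_mass.
  apply: le_Rintegral => //; [exact: L1_leb_itv|exact: L1_fejer|move=> x _].
  rewrite indicE; case: (boolP (x \in _)) => [|_]; last by rewrite mulr0 fejer_ge0.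
  rewrite inE/= in_itv/= mulr1 => /andP[x0 x1].
  rewrite /fejer; case: eqVneq => [_|xn0]; first by lra.
  have xgt0 : 0 < x by rewrite lt_def xn0.
  rewrite ler_pdivlMr ?exprn_gt0// one_sub_cosE.
  have := sin_sub_le (x / 2); rewrite ler_norml => /andP[+ _].
  set s := sin _ => hs.
  have s1 : x / 4 <= s by nra.
  have : (x / 4) ^+ 2 <= s ^+ 2 by rewrite ler_sqr ?nnegrE//; lra.
  nra.
have dF (t : R) : is_derive t 1 (fun t => 4^-1 * t) (4^-1).
  by apply: is_derive_eq; rewrite /GRing.scale/=; ring.
apply: lt_le_trans; rewrite Rintegral_leb_itv// (Rintegral_FTC2 ltr01 dF cq).
by rewrite mulr1 mulr0 subr0 invr_gt0.
Qed.

End fejer_kernel.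

(** * Test functions that determine a finite measure *)

Section measures_on_the_line.
Variable R : realType.

Lemma measure_unique_itv (m1 m2 : {finite_measure set R -> \bar R}) :
  (forall a b : R, a < b -> m1 `]a, b]%classic = m2 `]a, b]%classic) ->
  forall A, measurable A -> m1 A = m2 A.
Proof.
move=> h; apply: (@measure_unique _ R R (@ocitv R) (fun n => `](- n%:R), n%:R]%classic)).
- by [].
- exact: ocitvI.
- by move=> i; exists (- i%:R, i%:R).
- apply/seteqP; split => // x _.
  have := archi_boundP (normr_ge0 x); set n := Num.bound _ => xn.
  exists n => //=; rewrite in_itv/=.
  by move: xn; rewrite ltr_norml => /andP[-> /ltW].
- move=> _ [[a b]] _ <-; have [ab|ba] := ltP a b; first exact: h.
  by rewrite set_itv_ge ?measure0//= -leNgt.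
- by move=> k; rewrite ltey_eq fin_num_measure.
Qed.

Lemma ler_norm_minB (a b c d e : R) : `|a - c| <= e -> `|b - d| <= e ->
  `|Num.min a b - Num.min c d| <= e.
Proof.
by rewrite /Num.min !ler_norml => /andP[? ?] /andP[? ?];
  case: ltP => ?; case: ltP => ?; lra.
Qed.

Lemma ler_norm_maxB (a b c d e : R) : `|a - c| <= e -> `|b - d| <= e ->
  `|Num.max a b - Num.max c d| <= e.
Proof.
by rewrite /Num.max !ler_norml => /andP[? ?] /andP[? ?];
  case: ltP => ?; case: ltP => ?; lra.
Qed.

(* Continuous approximation of the indicator of [`]a, b]], piecewise linear with
   slopes at most [k]. *)
Definition trapezoid (k a b x : R) : R :=
  Num.max 0 (Num.min 1 (Num.min (k * (x - a)) (1 + k * (b - x)))).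

Lemma trapezoid_ge0 (k a b x : R) : 0 <= trapezoid k a b x.
Proof. by rewrite le_max lexx. Qed.

Lemma trapezoid_le1 (k a b x : R) : trapezoid k a b x <= 1.
Proof. by rewrite ge_max ler01 ge_min lexx. Qed.

Lemma trapezoid_lipschitz (k a b x y : R) : 0 <= k ->
  `|trapezoid k a b x - trapezoid k a b y| <= k * `|x - y|.
Proof.
move=> k0; have kxy : 0 <= k * `|x - y| by rewrite mulr_ge0.
apply: ler_norm_maxB; first by rewrite subrr normr0.
apply: ler_norm_minB; first by rewrite subrr normr0.
apply: ler_norm_minB.
  by rewrite -mulrBr (_ : _ - _ - _ = x - y) ?normrM ?(ger0_norm k0)//; ring.
rewrite (_ : _ - _ = k * (y - x)); last by ring.
by rewrite normrM (ger0_norm k0) distrC.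
Qed.

Lemma trapezoid_eq0 (k a b x : R) : 0 <= k -> x \notin `[a, b + k^-1] ->
  trapezoid k a b x = 0.
Proof.
move=> k0; rewrite in_itv/= negb_and -!ltNge => xab; apply: max_l.
case/orP : xab => [xa|bx].
  by rewrite !ge_min mulr_ge0_le0 ?orbT//; lra.
have [k00|kn0] := eqVneq k 0.
  by rewrite !ge_min k00 !mul0r lexx !orbT.
have kgt0 : 0 < k by rewrite lt_def kn0.
have : k * (b - x) <= -1.
  rewrite -ler_pdivlMl// mulrN1; lra.
by move=> ?; rewrite !ge_min; apply/orP; right; apply/orP; right; lra.
Qed.

Lemma trapezoid_eq1 (k a b x : R) : 0 <= k -> a + k^-1 <= x -> x <= b -> 0 < k ->
  trapezoid k a b x = 1.
Proof.
move=> k0 ax xb kgt0.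
have h1 : 1 <= k * (x - a) by rewrite -ler_pdivrMl// mulr1; lra.
have h2 : 0 <= k * (b - x) by rewrite mulr_ge0//; lra.
rewrite /trapezoid (_ : Num.min 1 _ = 1) ?max_r ?ler01//.
by apply: min_l; rewrite le_min h1/=; lra.
Qed.

(** The left ramp starts at [a] inside the interval and the right ramp starts at [b] outside it; so
    every trapezoid vanishes at [a], and the limit keeps [b]. *)
Lemma trapezoid_cvg (a b x : R) : trapezoid n.+1%:R a b x @[n --> \oo] --> (\1_(`]a, b]) x : R).
Proof.
rewrite indicE; have [xab|xab] := boolP (x \in `]a, b]).
  rewrite mem_set//; move: xab; rewrite in_itv/= => /andP[ax xb]; apply: cvg_near_cst; near=> n.
  apply: trapezoid_eq1 => //.
  rewrite -lerBrDl; apply: ltW.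
  by near: n; apply: (near_infty_natSinv_lt (PosNum (_ : 0 < x - a))); rewrite subr_gt0.
rewrite memNset/=; last exact/negP.
move: xab; rewrite in_itv/= negb_and -!leNgt -ltNge => /orP[xa|bx].
  apply: cvg_near_cst; apply: nearW => n.
  apply: max_l; rewrite !ge_min; apply/orP; right; apply/orP; left.
  by rewrite mulr_ge0_le0// subr_le0.
apply: cvg_near_cst; near=> n; apply: trapezoid_eq0 => //.
rewrite in_itv/= negb_and -!ltNge; apply/orP; right.
rewrite -ltrBrDl.
by near: n; apply: (near_infty_natSinv_lt (PosNum (_ : 0 < x - b))); rewrite subr_gt0.
Unshelve. all: by end_near. Qed.

Lemma lipschitz_continuous (g : R -> R) (L : R) :
  (forall x y, `|g x - g y| <= L * `|x - y|) -> continuous g.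
Proof.
move=> gL x; apply/cvgrPdist_le => e e0; near=> y.
apply: le_trans (gL x y) _.
have L1 : 0 < `|L| + 1 by rewrite ltr_wpDl.
apply: (@le_trans _ _ ((`|L| + 1) * `|x - y|)).
  by rewrite ler_wpM2r// (le_trans (ler_norm L))// lerDl.
rewrite -ler_pdivlMl// mulrC.
by near: y; apply: (@cvgr_dist_le _ _ _ _ _ id x) => //; rewrite divr_gt0.
Unshelve. all: by end_near. Qed.

Lemma continuous_trapezoid (k a b : R) : 0 <= k -> continuous (trapezoid k a b).
Proof. by move=> k0; apply: (@lipschitz_continuous _ k) => x y; exact: trapezoid_lipschitz. Qed.

Lemma measurable_trapezoid (k a b : R) : 0 <= k ->
  measurable_fun setT (trapezoid k a b).
Proof. by move=> k0; apply: continuous_measurable_fun; exact: continuous_trapezoid. Qed.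

Lemma L1_trapezoid (k a b : R) : 0 <= k -> L1 (@leb R) (trapezoid k a b).
Proof.
move=> k0; apply: (L1_dom (g := fun x => 1 * \1_(`[a, b + k^-1]) x)).
- exact: measurable_trapezoid.
- by apply: (@L1_leb_itv _ (fun=> 1)) => x; exact: cvg_cst.
- move=> x; rewrite mul1r indicE ger0_norm ?trapezoid_ge0//.
  have [xab|xab] := boolP (x \in `[a, b + k^-1]).
    by rewrite mem_set//; exact: trapezoid_le1.
  by rewrite trapezoid_eq0.
Qed.

Lemma finite_measure_unique (m1 m2 : {finite_measure set R -> \bar R}) :
  (forall k a b : R, 0 < k -> a < b ->
    \int[m1]_x trapezoid k a b x = \int[m2]_x trapezoid k a b x) ->
  forall A, measurable A -> m1 A = m2 A.
Proof.
move=> h; apply: measure_unique_itv => a b ab.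
have lim (m : {finite_measure set R -> \bar R}) :
    \int[m]_x trapezoid n.+1%:R a b x @[n --> \oo] --> fine (m `]a, b]%classic).
  have [] // := @Rintegral_dct _ _ _ m (fun n => trapezoid n.+1%:R a b)
    (fun x => \1_(`]a, b]) x) (cst 1).
  - by move=> n; exact: measurable_trapezoid.
  - exact: finite_measure_integrable_cst.
  - by move=> n x; rewrite ger0_norm ?trapezoid_ge0 ?trapezoid_le1.
  - by move=> x; exact: trapezoid_cvg.
  - by move=> _; rewrite /Rintegral integral_indic// setIT.
have e : fine (m1 `]a, b]%classic) = fine (m2 `]a, b]%classic).
  rewrite -(cvg_lim (@norm_hausdorff _ _) (lim m1)).
  rewrite -(cvg_lim (@norm_hausdorff _ _) (lim m2)).
  by congr (limn _); apply/funext => n; exact: h.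
by rewrite -[LHS]fineK ?fin_num_measure// e fineK ?fin_num_measure.
Qed.

End measures_on_the_line.

(** * Levy's continuity theorem *)

Section fejer_smoothing.
Variable R : realType.
Implicit Types (g : R -> R) (A x y : R).

(** Convolution with the Fejer kernel at scale [1 / A]. The kernel is not normalised, so the limit
    as [A] grows is [fejer_mass R * g x]. *)
Definition smoothing A g x : R := \int[@leb R]_u (fejer u * g (x + u / A)).

Lemma L1_smoothing A g x M : measurable_fun setT g -> (forall y, `|g y| <= M) ->
  L1 (@leb R) (fun u => fejer u * g (x + u / A)).
Proof.
move=> mg gM.
rewrite (_ : (fun u => _) = (fun u => g (x + u / A) * fejer u)); last first.
  by apply/funext => u; rewrite mulrC.
apply: (@L1M_bounded _ _ _ _ M) => //; first exact: L1_fejer.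
by apply: (measurableT_comp mg); meas.
Qed.

Lemma smoothing_uniform g (M L : R) : (forall y, `|g y| <= M) ->
  (forall x y, `|g x - g y| <= L * `|x - y|) -> 0 <= L ->
  exists2 e : nat -> R, e n @[n --> \oo] --> (0 : R) &
    forall n x, `|smoothing n.+1%:R g x - fejer_mass R * g x| <= e n.
Proof.
move=> gM gL L0; have cg := lipschitz_continuous gL.
have mg : measurable_fun setT g by exact: continuous_measurable_fun.
have M0 : 0 <= M by exact: le_trans (gM 0).
(* The Lipschitz bound alone would require a first moment, which the Fejer kernel does not have;
   capping it by [2 * M] makes it integrable, and dominated convergence sends its integral to
   [0]. *)
pose h n u := fejer u * Num.min (2 * M) (L * `|u| / n.+1%:R).
have min0 n u : 0 <= Num.min (2 * M) (L * `|u| / n.+1%:R).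
  by rewrite le_min !mulr_ge0.
have mh n : measurable_fun setT (h n).
  apply: measurable_funM; first exact: measurable_fejer.
  apply: continuous_measurable_fun; apply: (@lipschitz_continuous _ _ (L / n.+1%:R)).
  move=> x y; apply: ler_norm_minB.
    by rewrite subrr normr0 !mulr_ge0.
  rewrite -mulrBl -mulrBr !normrM (ger0_norm L0) (@ger0_norm _ (_^-1)) ?invr_ge0//.
  by rewrite mulrAC ler_wpM2l ?mulr_ge0// ler_dist_dist.
have hM n u : `|h n u| <= (2 * M) * fejer u.
  rewrite ger0_norm; last by rewrite mulr_ge0// fejer_ge0.
  by rewrite /h mulrC ler_wpM2r ?fejer_ge0// ge_min lexx.
have hi n : L1 (@leb R) (h n) by apply: (L1_dom (mh n) (L1Z (2 * M) (@L1_fejer R))).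
exists (fun n => \int[@leb R]_u h n u).
  have [] := @Rintegral_dct _ _ _ (@leb R) h (cst 0) _ mh (L1Z (2 * M) (@L1_fejer R)) hM.
    move=> u; rewrite -(mulr0 (fejer u)); apply: cvgM; first exact: cvg_cst.
    apply: (@squeeze_cvgr _ _ _ _ (cst 0) (fun n => L * `|u| * n.+1%:R^-1)).
    - by apply: nearW => n; rewrite min0 ge_min lexx orbT.
    - exact: cvg_cst.
    - rewrite -[X in _ --> X](mulr0 (L * `|u|)); apply: cvgM; first exact: cvg_cst.
      exact: cvg_harmonic.
  have z0 : \int[@leb R]_x (cst (0 : R) x) = 0 by rewrite /Rintegral integral0.
  by rewrite z0.
move=> n x; rewrite mulrC -RintegralZl//; last exact: L1_fejer.
rewrite -RintegralB//; [|exact: (L1_smoothing n.+1%:R x mg gM)|exact/L1Z/L1_fejer].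
apply: le_norm_Rintegral => // [|u].
  apply: measurable_funB.
    by have /L1_measurable := L1_smoothing n.+1%:R x mg gM.
  by apply: measurable_funM => //; exact: measurable_fejer.
rewrite (mulrC (g x)) -mulrBr normrM ger0_norm ?fejer_ge0// ler_wpM2l ?fejer_ge0//.
rewrite le_min; apply/andP; split.
  by rewrite mulr2n mulrDl mul1r (le_trans (ler_normB _ _))// lerD.
apply: le_trans (gL _ _) _; rewrite addrAC subrr add0r normrM.
by rewrite (@ger0_norm _ (_^-1)) ?invr_ge0// mulrA.
Qed.

(** With [y = x + u / A] the variable [x] moves into the kernel, where the cosine representation can
    act on it. *)
Lemma smoothingE A g x M : 0 < A -> measurable_fun setT g -> (forall y, `|g y| <= M) ->
  smoothing A g x = \int[@leb R]_y (A * (fejer (A * (y - x)) * g y)).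
Proof.
move=> A0 mg gM; have An0 : A != 0 by rewrite gt_eqF.
have i1 : L1 (@leb R) (fun y => fejer (A * (y - x)) * g y).
  rewrite (_ : (fun y => _) = (fun y => g y * fejer (A * y + - (A * x)))); last first.
    by apply/funext => y; rewrite mulrC mulrBr.
  apply: (@L1M_bounded _ _ _ _ M) => //.
  by apply: (@L1_leb_affine _ _ _ A0); exact: L1_fejer.
have Ai0 : 0 < A^-1 by rewrite invr_gt0.
rewrite RintegralZl// (Rintegral_leb_affine x Ai0 i1) mulrA divff// mul1r.
apply: eq_Rintegral => u _; congr (fejer _ * g _); last by rewrite addrC mulrC.
by rewrite addrK mulrA divff// mul1r.
Qed.

Lemma smoothing_pointwise g (M x l : R) : measurable_fun setT g ->
  (forall y, `|g y| <= M) ->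
  (forall u : R, g (x + u / n.+1%:R) @[n --> \oo] --> l) ->
  smoothing n.+1%:R g x @[n --> \oo] --> fejer_mass R * l.
Proof.
move=> mg gM gl.
have [|||_] := @Rintegral_dct _ _ _ (@leb R) (fun n u => fejer u * g (x + u / n.+1%:R))
  (fun u => fejer u * l) (fun u => M * fejer u) _ (L1Z M (@L1_fejer R)).
- move=> n; have /L1_measurable := L1_smoothing n.+1%:R x mg gM; exact.
- by move=> n u; rewrite normrM ger0_norm ?fejer_ge0// mulrC ler_wpM2r ?fejer_ge0.
- by move=> u; apply: cvgM => //; exact: cvg_cst.
rewrite (_ : \int[@leb R]_x0 (fejer x0 * l) = fejer_mass R * l)//.
rewrite mulrC -(RintegralZl _ measurableT (@L1_fejer R)).
by apply: eq_Rintegral => u _; rewrite mulrC.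
Qed.

End fejer_smoothing.

Section levy_continuity.
Variable R : realType.
Implicit Types m : {finite_measure set R -> \bar R}.

(** Real and imaginary parts of the Fourier transform. The argument is a bare set function, so that
    distributions and abstract finite measures are treated alike. *)
Definition costr (m : set R -> \bar R) (t : R) : R :=
  fine (\int[m]_x (cos (t * x))%:E).
Definition sintr (m : set R -> \bar R) (t : R) : R :=
  fine (\int[m]_x (sin (t * x))%:E).

Lemma costr0 m : costr m 0 = fine (m setT).
Proof.
rewrite /costr (_ : (fun x => _) = (fun=> 1%E)).
  by rewrite integral_cst// mul1e.
by apply/funext => x; rewrite mul0r cos0.
Qed.

Lemma Rintegral1 m : \int[m]_x 1 = fine (m setT).
Proof. by rewrite Rintegral_cst// mul1r. Qed.

Lemma costr_le m t : `|costr m t| <= fine (m setT).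
Proof.
rewrite -Rintegral1; apply: le_norm_Rintegral.
- by meas.
- exact: finite_measure_integrable_cst.
- by move=> x; exact: cos_norm_le1.
Qed.

Lemma sintr_le m t : `|sintr m t| <= fine (m setT).
Proof.
rewrite -Rintegral1; apply: le_norm_Rintegral.
- by meas.
- exact: finite_measure_integrable_cst.
- by move=> x; exact: sin_norm_le1.
Qed.

Lemma measurable_costr m : measurable_fun setT (costr m).
Proof.
by apply: continuous_measurable_fun; exact: (@continuous_cos_transform _ _ _ m id).
Qed.

Lemma measurable_sintr m : measurable_fun setT (sintr m).
Proof.
by apply: continuous_measurable_fun; exact: (@continuous_sin_transform _ _ _ m id).
Qed.

Variable tau : {finite_measure set R -> \bar R}.
Hypothesis tauE : forall x, fejer x = \int[tau]_t cos (x * t).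

(** The integral of [cos (A t (y - x))] against [m] in the variable [x], expanded by the addition
    formula. *)
Let shifted m (A y t : R) : R :=
  cos (A * t * y) * costr m (A * t) + sin (A * t * y) * sintr m (A * t).

Let shifted_le m A y t : `|shifted m A y t| <= 2 * fine (m setT).
Proof.
rewrite mulr2n mulrDl mul1r (le_trans (ler_normD _ _))// !normrM lerD//.
- by rewrite -[leRHS]mul1r ler_pM ?cos_norm_le1 ?costr_le.
- by rewrite -[leRHS]mul1r ler_pM ?sin_norm_le1 ?sintr_le.
Qed.

Let measurable_shifted m A y : measurable_fun setT (shifted m A y).
Proof.
apply: measurable_funD; apply: measurable_funM; try by meas.
- by apply: (measurableT_comp (measurable_costr m)); meas.
- by apply: (measurableT_comp (measurable_sintr m)); meas.
Qed.

(** The kernel is a cosine transform of the finite measure [tau]; exchanging the integrals leaves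
    only the transforms of [m]. *)
Lemma Rintegral_fejer m (A y : R) :
  \int[m]_x fejer (A * (y - x)) = \int[tau]_t
    (cos (A * t * y) * costr m (A * t) + sin (A * t * y) * sintr m (A * t)).
Proof.
under eq_Rintegral do rewrite tauE.
rewrite (@Rfubini _ _ _ _ _ m tau (fun z => cos (A * (y - z.1) * z.2)) (cst 1) (cst 1)).
- apply: eq_Rintegral => t _ /=.
  rewrite -!RintegralZl//; [|exact: (@L1_sin _ _ _ m id)|exact: (@L1_cos _ _ _ m id)].
  rewrite -RintegralD//; [|exact/L1Z/(@L1_cos _ _ _ m id)|exact/L1Z/(@L1_sin _ _ _ m id)].
  apply: eq_Rintegral => x _.
  by rewrite (_ : A * (y - x) * t = A * t * y - A * t * x) ?cosB//; ring.
- by meas.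
- exact: finite_measure_integrable_cst.
- exact: finite_measure_integrable_cst.
- by move=> x t; rewrite mulr1; exact: cos_norm_le1.
Qed.

(** A second exchange of integrals, allowed by the integrability of [g]: the pairing of [m] with a
    smoothed [g] depends on [m] only through [costr m] and [sintr m]. *)
Lemma Rintegral_smoothing m (A : R) (g : R -> R) (M : R) : 0 < A ->
  L1 (@leb R) g -> (forall y, `|g y| <= M) ->
  \int[m]_x smoothing A g x =
  \int[@leb R]_y (A * (g y * \int[tau]_t shifted m A y t)) /\
  L1 (@leb R) (fun y => A * (g y * \int[tau]_t shifted m A y t)).
Proof.
move=> A0 gi gM; have mg := L1_measurable gi.
under eq_Rintegral do rewrite (smoothingE _ A0 mg gM).
pose F (z : R * R) := A * (fejer (A * (z.2 - z.1)) * g z.2).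
have mF : measurable_fun setT F.
  apply: measurable_funM => //; apply: measurable_funM.
    by apply: (measurableT_comp (@measurable_fejer R)); meas.
  by apply: (measurableT_comp mg); meas.
have dF x y : `|F (x, y)| <= cst A x * `|g y|.
  rewrite /F !normrM (ger0_norm (ltW A0)) ler_pM2l//.
  by rewrite -[leRHS]mul1r ler_wpM2r// ger0_norm ?fejer_ge0 ?fejer_le1.
have iA : L1 m (cst A) by exact: finite_measure_integrable_cst.
have eq y : \int[m]_x F (x, y) = A * (g y * \int[tau]_t shifted m A y t).
  have iF : L1 m (fun x => fejer (A * (y - x))).
    apply: (@L1_bounded _ _ _ _ 1) => [|x].
      by apply: (measurableT_comp (@measurable_fejer R)); meas.
    by rewrite ger0_norm ?fejer_ge0 ?fejer_le1.
  rewrite -Rintegral_fejer -RintegralZl// -RintegralZl//; last exact: L1Z.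
  by apply: eq_Rintegral => x _; rewrite /F /= (mulrC (fejer _)).
split.
  rewrite (@Rfubini _ _ _ _ _ m (@leb R) F (cst A) (fun y => `|g y|) mF iA (L1_norm gi) dF).
  by apply: eq_Rintegral => y _; rewrite eq.
have := L1_fubini2 mF iA (L1_norm gi) dF.
by congr (integrable _ _ (EFin \o _)); apply/funext => y; rewrite eq.
Qed.

(** Two nested dominated convergences: in [t] against the finite measure [tau], with constant bound
    [2 * B], then in [y] against a multiple of [|g|]. *)
Lemma smoothing_cvg (m_ : nat -> {finite_measure set R -> \bar R}) m (A M : R) (g : R -> R) :
  0 < A -> L1 (@leb R) g -> (forall y, `|g y| <= M) ->
  (forall t, costr (m_ n) t @[n --> \oo] --> costr m t) ->
  (forall t, sintr (m_ n) t @[n --> \oo] --> sintr m t) ->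
  (exists B, forall n, fine (m_ n setT) <= B) ->
  \int[m_ n]_x smoothing A g x @[n --> \oo] --> \int[m]_x smoothing A g x.
Proof.
move=> A0 gi gM cc cs [B mB]; have mg := L1_measurable gi.
have [-> _] := Rintegral_smoothing m A0 gi gM.
under eq_fun => n do rewrite (Rintegral_smoothing (m_ n) A0 gi gM).1.
have B0 : 0 <= B by apply: le_trans (mB 0%N); exact: fine_ge0.
have le2 n y : `|\int[tau]_t shifted (m_ n) A y t| <= \int[tau]_t (2 * B).
  apply: le_norm_Rintegral => [||t]; first exact: measurable_shifted.
    exact: finite_measure_integrable_cst.
  by rewrite (le_trans (shifted_le _ _ _ _))// ler_wpM2l.
have [] // := @Rintegral_dct _ _ _ (@leb R)
  (fun n y => A * (g y * \int[tau]_t shifted (m_ n) A y t))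
  (fun y => A * (g y * \int[tau]_t shifted m A y t))
  (fun y => A * (\int[tau]_t (2 * B)) * `|g y|).
- by move=> n; have [_ /L1_measurable] := Rintegral_smoothing (m_ n) A0 gi gM.
- exact/L1Z/L1_norm.
- move=> n y; rewrite !normrM (ger0_norm (ltW A0)) -mulrA ler_pM2l//.
  by rewrite mulrC ler_wpM2r.
- move=> y; apply: cvgM; first exact: cvg_cst.
  apply: cvgM; first exact: cvg_cst.
  have [] // := @Rintegral_dct _ _ _ tau (fun n => shifted (m_ n) A y)
    (shifted m A y) (cst (2 * B)).
  + exact: finite_measure_integrable_cst.
  + by move=> n x; rewrite (le_trans (shifted_le _ _ _ _))// ler_wpM2l.
  + move=> t; apply: cvgD; (apply: cvgM; first exact: cvg_cst).
    * exact: cc.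
    * exact: cs.
Qed.

End levy_continuity.

Section levy_continuity_theorem.
Variable R : realType.
Implicit Types m : {finite_measure set R -> \bar R}.

Lemma measurable_smoothing (A M L : R) (g : R -> R) : (forall y, `|g y| <= M) ->
  (forall x y, `|g x - g y| <= L * `|x - y|) ->
  measurable_fun setT (smoothing A g).
Proof.
move=> gM gL; have mg : measurable_fun setT g.
  by apply: continuous_measurable_fun; exact: lipschitz_continuous gL.
apply: continuous_measurable_fun.
apply: (@lipschitz_continuous _ _ (fejer_mass R * L)) => x y.
rewrite -RintegralB//; [|exact: (L1_smoothing A x mg gM)|exact: (L1_smoothing A y mg gM)].
rewrite -mulrA mulrC -RintegralZl//; last exact: L1_fejer.
apply: le_norm_Rintegral => [||u].
- by apply: measurable_funB; [have /L1_measurable := L1_smoothing A x mg gM|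
    have /L1_measurable := L1_smoothing A y mg gM].
- exact/L1Z/L1_fejer.
- rewrite -mulrBr normrM (ger0_norm (fejer_ge0 u)) mulrC ler_wpM2r ?fejer_ge0//.
  by rewrite (le_trans (gL _ _))// (_ : _ - _ = x - y)//; ring.
Qed.

Lemma Rintegral_smoothing_approx m (A M L e : R) (g : R -> R) :
  (forall y, `|g y| <= M) -> (forall x y, `|g x - g y| <= L * `|x - y|) ->
  (forall x, `|smoothing A g x - fejer_mass R * g x| <= e) ->
  `|\int[m]_x smoothing A g x - fejer_mass R * \int[m]_x g x| <= e * fine (m setT).
Proof.
move=> gM gL ge; have mg : measurable_fun setT g.
  by apply: continuous_measurable_fun; exact: lipschitz_continuous gL.
have ig : L1 m g by exact: L1_bounded gM.
have ms := measurable_smoothing A gM gL.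
have is_ : L1 m (smoothing A g).
  apply: (@L1_bounded _ _ _ _ (e + fejer_mass R * M)) => // x.
  rewrite -(subrK (fejer_mass R * g x) (smoothing A g x)).
  rewrite (le_trans (ler_normD _ _))// lerD// normrM.
  by rewrite gtr0_norm ?fejer_mass_gt0// ler_pM2l ?fejer_mass_gt0.
rewrite -RintegralZl// -RintegralB//; last exact: L1Z.
rewrite -Rintegral_cst//; apply: le_norm_Rintegral => //.
- by apply: measurable_funB => //; exact: measurable_funM.
- exact: finite_measure_integrable_cst.
Qed.

(** The masses are the values [costr (m_ n) 0], which converge and so are bounded. Replacing [g] by
    its smoothing therefore costs a small amount uniformly in [n], and for smoothed functions
    convergence follows from that of the transforms. *)
Theorem levy_continuity (m_ : nat -> {finite_measure set R -> \bar R}) m (M L : R)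
    (g : R -> R) :
  (forall t, costr (m_ n) t @[n --> \oo] --> costr m t) ->
  (forall t, sintr (m_ n) t @[n --> \oo] --> sintr m t) ->
  L1 (@leb R) g -> (forall y, `|g y| <= M) -> 0 <= L ->
  (forall x y, `|g x - g y| <= L * `|x - y|) ->
  \int[m_ n]_x g x @[n --> \oo] --> \int[m]_x g x.
Proof.
move=> cc cs gi gM L0 gL.
have [tau [_ tauE]] := ex_fejer_measure R.
have [B [B0 mB mB']] : exists B, [/\ 0 < B, forall n, fine (m_ n setT) <= B
    & fine (m setT) <= B].
  have : cvgn (fun n => costr (m_ n) 0) by apply/cvg_ex; eexists; exact: cc.
  move=> /cvg_seq_bounded/pinfty_ex_gt0[B B0 hB].
  have mB n : fine (m_ n setT) <= B.
    have /= := hB n I; rewrite costr0 ger0_norm//; exact: fine_ge0.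
  exists B; split => //; rewrite -costr0.
  rewrite -(cvg_lim (@norm_hausdorff _ _) (cc 0)); apply: limr_le.
    by apply/cvg_ex; eexists; exact: cc.
  by apply: nearW => n; rewrite costr0.
have [e e0 he] := smoothing_uniform gM gL L0.
pose c := fejer_mass R; have c0 : 0 < c by exact: fejer_mass_gt0.
apply/cvgrPdist_le => eps eps0.
(* A smoothing error of this size against masses at most [B] contributes a third of [eps * c]; the
   factor [c], the mass of the kernel, is divided out at the end. *)
have d0 : 0 < eps * c / (3 * B) by rewrite divr_gt0 ?mulr_gt0.
have [N _ hN] := (cvgrPdist_le _ _).1 e0 _ d0.
have eN : e N <= eps * c / (3 * B).
  by have := hN N (leqnn N); rewrite /= sub0r normrN => /(le_trans (ler_norm _)).
have NA : 0 < N.+1%:R :> R by [].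
have scvg := smoothing_cvg tauE NA gi gM cc cs (ex_intro _ B mB).
have d1 : 0 < eps * c / 3 by rewrite divr_gt0 ?mulr_gt0.
near=> n.
have key m0 : fine (m0 setT) <= B ->
    `|\int[m0]_x smoothing N.+1%:R g x - c * \int[m0]_x g x| <= eps * c / 3.
  move=> m0B; apply: le_trans (Rintegral_smoothing_approx m0 gM gL (he N)) _.
  rewrite (_ : eps * c / 3 = eps * c / (3 * B) * B); last by field; rewrite gt_eqF.
  apply: (@le_trans _ _ (eps * c / (3 * B) * fine (m0 setT))).
    by rewrite ler_wpM2r//; exact: fine_ge0.
  by rewrite ler_pM2l.
have h1 := key m mB'; have h2 := key (m_ n) (mB n).
have h3 : `|\int[m]_x smoothing N.+1%:R g x - \int[m_ n]_x smoothing N.+1%:R g x|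
    <= eps * c / 3.
  by near: n; exact: (cvgrPdist_le _ _).1 scvg _ d1.
rewrite -(ler_pM2l c0) -[X in X * `|_|](gtr0_norm c0) -normrM mulrBr.
move: h1 h2 h3; rewrite !ler_norml => /andP[? ?] /andP[? ?] /andP[? ?].
by apply/andP; split; lra.
Unshelve. all: by end_near. Qed.

(** The continuity theorem for the constant sequence [m1] with limit [m2], tested on trapezoids. *)
Theorem measure_unique_fourier (m1 m2 : {finite_measure set R -> \bar R}) :
  (forall t, costr m1 t = costr m2 t) -> (forall t, sintr m1 t = sintr m2 t) ->
  forall A, measurable A -> m1 A = m2 A.
Proof.
move=> hc hs; apply: finite_measure_unique => k a b k0 ab.
have kge0 := ltW k0.
have hc' t : (fun=> costr m1 t) n @[n --> \oo] --> costr m2 t.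
  by rewrite -hc; exact: cvg_cst.
have hs' t : (fun=> sintr m1 t) n @[n --> \oo] --> sintr m2 t.
  by rewrite -hs; exact: cvg_cst.
have := @levy_continuity (fun=> m1) m2 1 k (trapezoid k a b) hc' hs'.
move=> /(_ (L1_trapezoid a b kge0) _ kge0 _) h.
have {}h : (fun=> \int[m1]_x trapezoid k a b x) n @[n --> \oo] -->
    \int[m2]_x trapezoid k a b x.
  apply: h => [y|x y]; last exact: trapezoid_lipschitz.
  by rewrite ger0_norm ?trapezoid_ge0// trapezoid_le1.
rewrite -(cvg_lim (@norm_hausdorff _ _) h).
by rewrite lim_cst//; exact: norm_hausdorff.
Qed.

End levy_continuity_theorem.

(** * Uniqueness of the bilateral Laplace transform *)

Section exponential_estimates.
Variable R : realType.
Implicit Types x y : R.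

Lemma is_derive_expRN x : is_derive x 1 (fun z : R => expR (- z)) (- expR (- x)).
Proof. by rewrite -mulrN1; apply: (@is_derive1_comp R expR -%R). Qed.

Lemma one_sub_expRN_le x : `|1 - expR (- x)| <= `|x| * expR `|x|.
Proof.
have [c + e] := MVT_R 0 x is_derive_expRN.
rewrite !subr0 oppr0 expR0 in e * => cx; rewrite -normrN opprB.
rewrite e normrM normrN mulrC ler_wpM2l// ger0_norm ?expR_ge0// ler_expR.
by apply: le_trans cx; rewrite -normrN ler_norm.
Qed.

Lemma expRN_taylor_le x : `|1 - expR (- x) - x| <= x ^+ 2 * expR `|x|.
Proof.
have dF (z : R) : is_derive z 1 (fun z : R => 1 - expR (- z) - z) (expR (- z) - 1).
  by have ? := is_derive_expRN z; apply: is_derive_eq; ring.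
have [c] := MVT_R 0 x dF.
rewrite !subr0 oppr0 expR0 subrr subr0 => cx ->.
rewrite normrM -normrN opprB -(real_normK (num_real x)) expr2 -mulrA mulrC.
rewrite ler_wpM2l//; apply: le_trans (one_sub_expRN_le c) _.
by rewrite ler_pM ?expR_ge0// ler_expR.
Qed.

(** From [y <= expR y]. A power of [|x|] is thus paid for by an exponential with a rate as small as
    desired. *)
Lemma norm_le_mul_expR (K : R) x : 0 < K -> `|x| <= K * expR (`|x| / K).
Proof.
move=> K0; rewrite -ler_pdivrMl// mulrC.
by apply: le_trans (expR_ge1Dx _); rewrite lerDr.
Qed.

Lemma series_exp_coeff_le x n : 0 <= x -> series (exp_coeff x) n <= expR x.
Proof.
move=> x0; apply: nondecreasing_cvgn_le; last exact: is_cvg_series_exp_coeff.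
apply/nondecreasing_seqP => k; rewrite !seriesEnat /= big_nat_recr//= lerDl.
exact: exp_coeff_ge0.
Qed.

Lemma series_norm_cos_coeff_le x n : \sum_(0 <= k < n) `|cos_coeff x k| <= expR `|x|.
Proof.
apply: le_trans (series_exp_coeff_le n (normr_ge0 x)).
rewrite seriesEnat/=; apply: ler_sum => k _; rewrite /cos_coeff /exp_coeff/=.
rewrite !normrM normrX normfV normrX normrN normr1 expr1n mulr1.
rewrite (@ger0_norm _ k`!%:R)// -mulrA; apply: ler_piMl.
  by rewrite mulr_ge0// exprn_ge0.
by case: odd => /=; rewrite normr_nat.
Qed.

Lemma series_norm_sin_coeff_le x n : \sum_(0 <= k < n) `|sin_coeff x k| <= expR `|x|.
Proof.
apply: le_trans (series_exp_coeff_le n (normr_ge0 x)).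
rewrite seriesEnat/=; apply: ler_sum => k _; rewrite /sin_coeff /exp_coeff/=.
rewrite !normrM normrX normfV normrX normrN normr1 expr1n mulr1.
rewrite (@ger0_norm _ k`!%:R)// -mulrA; apply: ler_piMl.
  by rewrite mulr_ge0// exprn_ge0.
by case: odd => /=; rewrite normr_nat.
Qed.

End exponential_estimates.

Section laplace_uniqueness.
Variable R : realType.
Variables m1 m2 : {finite_measure set R -> \bar R}.

(** Integrability is bundled with equality so that the class is a vector space closed under
    dominated limits. The argument consists in enlarging this class. *)
Definition agree (h : R -> R) :=
  [/\ L1 m1 h, L1 m2 h & \int[m1]_x h x = \int[m2]_x h x].

Lemma agreeD (g h : R -> R) : agree g -> agree h -> agree (fun x => g x + h x).
Proof.
by move=> [g1 g2 eg] [h1 h2 eh]; split; [exact: L1D|exact: L1D|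
  rewrite !RintegralD// eg eh].
Qed.

Lemma agreeZ (k : R) (h : R -> R) : agree h -> agree (fun x => k * h x).
Proof.
by move=> [h1 h2 eh]; split; [exact: L1Z|exact: L1Z|rewrite !RintegralZl// eh].
Qed.

Lemma agree_sum (h : nat -> R -> R) (n : nat) : (forall k, agree (h k)) ->
  agree (fun x => \sum_(0 <= k < n) h k x).
Proof.
move=> hh; split.
- by apply: L1_sum => k; have [] := hh k.
- by apply: L1_sum => k; have [] := hh k.
- rewrite !Rintegral_sum; last 2 first.
  + by move=> k; have [] := hh k.
  + by move=> k; have [] := hh k.
  by apply: eq_bigr => k _; have [] := hh k.
Qed.

Lemma agree_dct (h_ : nat -> R -> R) (h g : R -> R) : (forall n, agree (h_ n)) ->
  L1 m1 g -> L1 m2 g -> (forall n x, `|h_ n x| <= g x) ->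
  (forall x, h_ n x @[n --> \oo] --> h x) -> agree h.
Proof.
move=> hh g1 g2 hg hlim.
have mh n : measurable_fun setT (h_ n) by have [/L1_measurable] := hh n.
have [i1 l1] := Rintegral_dct mh g1 hg hlim.
have [i2 l2] := Rintegral_dct mh g2 hg hlim.
split => //.
rewrite -(cvg_lim (@norm_hausdorff _ _) l1) -(cvg_lim (@norm_hausdorff _ _) l2).
by congr (limn _); apply/funext => n; have [] := hh n.
Qed.

Hypothesis laplace_agree : forall s : R, 0 < s -> agree (fun x => expR (- (s * x))).

(** A common dominating function: [expR (|x| / 2 - x)] is one of the two exponentials according to
    the sign of [x], and both have a positive rate, so both are integrable. *)
Let dom (C x : R) := C * (expR (- (2^-1 * x)) + expR (- (3 / 2 * x))).

Let dom_agree C : agree (dom C).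
Proof. by apply/agreeZ/agreeD; apply: laplace_agree; rewrite ?divr_gt0 ?invr_gt0. Qed.

Let dom_bound (x : R) : expR (`|x| / 2 - x) <= dom 1 x.
Proof.
rewrite /dom mul1r; have [x0|x0] := leP 0 x.
  by rewrite ger0_norm// (_ : _ - x = - (2^-1 * x)) ?lerDl ?expR_ge0//; field.
by rewrite ltr0_norm// (_ : _ - x = - (3 / 2 * x)) ?lerDr ?expR_ge0//; field.
Qed.

(** Multiplying by [(1 - expR (- h x)) / h] is a finite difference in [s]: it subtracts the same
    function at [s + h]. *)
Let agree_difference (n : nat) (h s : R) : 0 < h -> 0 < s ->
  agree (fun x => ((1 - expR (- (h * x))) / h) ^+ n * expR (- (s * x))).
Proof.
move=> h0; elim: n s => [|n ih] s s0.
  rewrite (_ : (fun x => _) = (fun x => expR (- (s * x)))); first exact: laplace_agree.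
  by apply/funext => x; rewrite expr0 mul1r.
have sh : 0 < s + h by rewrite addr_gt0.
have := agreeD (agreeZ h^-1 (ih s s0)) (agreeZ (- h^-1) (ih (s + h) sh)).
congr agree; apply/funext => x.
have -> : expR (- ((s + h) * x)) = expR (- (s * x)) * expR (- (h * x)).
  by rewrite -expRD; congr expR; ring.
by rewrite exprSr; ring.
Qed.

(** With [K = 4 (n + 1)], each factor [|x|] costs [expR (|x| / K)], so [n] of them cost at most
    [expR (|x| / 4)]. A difference quotient with [h <= 1 / K] costs [expR (2 |x| / K)], hence
    [expR (|x| / 2)] altogether. Both totals stay within [dom]. *)
Let pow_bound (n : nat) : exists2 C : R, 0 <= C &
  forall x : R, `|x| ^+ n * expR (`|x| / 4 - x) <= dom C x /\
  forall h, 0 < h -> h * (4 * n.+1)%:R <= 1 ->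
    `|((1 - expR (- (h * x))) / h) ^+ n * expR (- x)| <= dom C x.
Proof.
pose K : R := (4 * n.+1)%:R; have K0 : 0 < K by rewrite ltr0n.
have Kn0 : K != 0 by rewrite gt_eqF.
exists (K ^+ n); first by rewrite exprn_ge0// ltW.
have domE C x : dom C x = C * dom 1 x by rewrite /dom mul1r.
have nK : n%:R / K <= 4^-1 :> R.
  rewrite ler_pdivrMr// /K natrM mulKf// ler_nat; exact: leqnSn.
move=> x; split.
  rewrite domE.
  apply: le_trans (ler_wpM2l (exprn_ge0 n (ltW K0)) (dom_bound x)).
  have : `|x| ^+ n <= (K * expR (`|x| / K)) ^+ n.
    by rewrite lerXn2r ?nnegrE// ?mulr_ge0 ?expR_ge0 ?(ltW K0)//; exact: norm_le_mul_expR.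
  move=> /(ler_wpM2r (expR_ge0 (`|x| / 4 - x))) /le_trans; apply.
  rewrite exprMn -mulrA ler_wpM2l ?exprn_ge0 ?(ltW K0)//.
  rewrite -expRM_natl -expRD ler_expR.
  rewrite (_ : n%:R * (`|x| / K) = `|x| * (n%:R / K)); last by ring.
  have := ler_wpM2l (normr_ge0 x) nK; set r := n%:R / K; lra.
move=> h h0 hK; rewrite domE.
apply: le_trans (ler_wpM2l (exprn_ge0 n (ltW K0)) (dom_bound x)).
rewrite normrM normrX (ger0_norm (expR_ge0 _)).
have hle : `|(1 - expR (- (h * x))) / h| <= K * expR (2 * `|x| / K).
  rewrite normrM normfV (gtr0_norm h0) ler_pdivrMr//.
  apply: le_trans (one_sub_expRN_le _) _; rewrite normrM (gtr0_norm h0).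
  apply: (@le_trans _ _ (h * (`|x| * expR (h * `|x|)))); first by rewrite mulrA.
  rewrite (mulrC _ h) ler_pM2l//.
  have h1 := norm_le_mul_expR x K0.
  have h2 : expR (h * `|x|) <= expR (`|x| / K).
    by rewrite ler_expR mulrC ler_wpM2l// -[leRHS]mul1r ler_pdivlMr.
  apply: le_trans (ler_pM _ _ h1 h2) _; rewrite ?expR_ge0//.
  rewrite -(mulrA K) ler_pM2l// -expRD ler_expR (_ : 2 * _ / _ = `|x| / K + `|x| / K)//.
  by rewrite -mulrA mulr2n mulrDl mul1r.
have : `|(1 - expR (- (h * x))) / h| ^+ n <= (K * expR (2 * `|x| / K)) ^+ n.
  by rewrite lerXn2r ?nnegrE// ?mulr_ge0 ?expR_ge0 ?(ltW K0).
move=> /(ler_wpM2r (expR_ge0 (- x))) /le_trans; apply.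
rewrite exprMn -(mulrA (K ^+ n)) ler_wpM2l ?exprn_ge0 ?(ltW K0)//.
rewrite -expRM_natl -expRD ler_expR.
rewrite (_ : n%:R * (2 * `|x| / K) = 2 * (`|x| * (n%:R / K))); last by ring.
have := ler_wpM2l (normr_ge0 x) nK; set r := n%:R / K; lra.
Qed.

Let agree_moment (n : nat) : agree (fun x => x ^+ n * expR (- x)).
Proof.
have [C C0 hC] := pow_bound n; have [d1 d2 _] := dom_agree C.
(* Steps that tend to [0] and satisfy from the start the restriction on [h] in [pow_bound]. *)
pose h k : R := ((4 * n.+1)%:R * k.+1%:R)^-1.
have h0 k : 0 < h k by rewrite invr_gt0 mulr_gt0// ltr0n.
apply: (@agree_dct (fun k x => ((1 - expR (- (h k * x))) / h k) ^+ n * expR (- x)) _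
  _ _ d1 d2).
- by move=> k; have := agree_difference n (h0 k) ltr01; congr agree;
    apply/funext => x; rewrite mul1r.
- move=> k x; apply: (hC x).2 => //.
  rewrite /h invfM mulrAC mulVf ?pnatr_eq0// mul1r invf_le1// ler1n//.
move=> x; apply: cvgM; last exact: cvg_cst.
have hlim : h k @[k --> \oo] --> (0 : R).
  rewrite -(mulr0 (4 * n.+1)%:R^-1).
  under eq_fun do rewrite /h invfM.
  by apply: cvgM; [exact: cvg_cst|exact: cvg_harmonic].
have base : (1 - expR (- (h k * x))) / h k @[k --> \oo] --> x.
  have h1 k : h k <= 1.
    by rewrite /h invf_le1 ?mulr_gt0 ?ltr0n// -natrM ler1n muln_gt0.
  have hl2 : h k * (x ^+ 2 * expR `|x|) @[k --> \oo] --> (0 : R).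
    by rewrite -(mul0r (x ^+ 2 * expR `|x|)); apply: cvgM => //; exact: cvg_cst.
  apply/cvgrPdist_le => e e0; near=> k.
  have hk := h0 k; have hk0 : h k != 0 by rewrite gt_eqF.
  rewrite (_ : x - _ = - (1 - expR (- (h k * x)) - h k * x) / h k); last by field.
  rewrite normrM normrN normfV (gtr0_norm hk) ler_pdivrMr//.
  apply: le_trans (expRN_taylor_le _) _; rewrite exprMn expr2.
  rewrite -!mulrA mulrC ler_pM2r//.
  rewrite normrM (gtr0_norm hk).
  apply: (@le_trans _ _ (h k * (x ^+ 2 * expR `|x|))).
    rewrite ler_pM2l// mulrA -expr2 ler_wpM2l ?sqr_ge0// ler_expR.
    by apply: ler_piMl.
  near: k; have hnear := (cvgrPdist_le _ _).1 hl2 e e0.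
  near=> j; have : `|0 - h j * (x ^+ 2 * expR `|x|)| <= e by near: j; exact: hnear.
  by rewrite sub0r normrN; exact: le_trans (ler_norm _).
elim: (n) => [|p ih]; first by under eq_fun do rewrite expr0; exact: cvg_cst.
by rewrite exprS; under eq_fun do rewrite exprS; exact: cvgM.
Unshelve. all: by end_near. Qed.

(** All powers are carried along, because expanding around [t] multiplies by powers of [x]. *)
Let walk (t : R) := forall n : nat, agree (fun x => x ^+ n * expR (- x) * cos (t * x)) /\
   agree (fun x => x ^+ n * expR (- x) * sin (t * x)).

(** The addition formula and the power series of [cos (d x)] and [sin (d x)] give limits of sums
    that agree by hypothesis. Their partial sums are at most [expR |d x| <= expR (|x| / 4)], which
    [pow_bound] can absorb; this fixes the step length. *)
Let walk_step (t d : R) : `|d| <= 4^-1 -> walk t -> walk (t + d).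
Proof.
move=> dle wt n.
have [C C0 hC] := pow_bound n; have [d1 d2 _] := dom_agree (2 * C).
have dom2 x : 2 * dom C x = dom (2 * C) x by rewrite /dom mulrA.
have bnd x a b : `|a| <= expR `|d * x| -> `|b| <= expR `|d * x| -> forall p q : R,
    `|p| <= 1 -> `|q| <= 1 ->
    `|x ^+ n * expR (- x) * (p * a + q * b)| <= dom (2 * C) x.
  move=> ha hb p q hp hq; rewrite -dom2.
  apply: (@le_trans _ _ (2 * (`|x| ^+ n * expR (`|x| / 4 - x)))); last first.
    by rewrite ler_pM2l//; have [] := hC x.
  have hd : expR `|d * x| <= expR (`|x| / 4).
    by rewrite ler_expR normrM mulrC ler_wpM2l.
  have hpq : `|p * a + q * b| <= 2 * expR (`|x| / 4).
    rewrite mulr2n mulrDl mul1r; apply: le_trans (ler_normD _ _) _.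
    rewrite !normrM; apply: lerD; rewrite -[leRHS]mul1r; apply: ler_pM => //;
      by apply: le_trans hd.
  rewrite normrM normrM normrX (ger0_norm (expR_ge0 _)) expRD.
  rewrite (_ : 2 * _ = `|x| ^+ n * expR (- x) * (2 * expR (`|x| / 4))); last by ring.
  by rewrite ler_wpM2l// mulr_ge0 ?expR_ge0 ?exprn_ge0.
pose ck k : R := (~~ odd k)%:R * (-1) ^+ k./2 * (k`!%:R)^-1 * d ^+ k.
pose sk k : R := (odd k)%:R * (-1) ^+ k.-1./2 * (k`!%:R)^-1 * d ^+ k.
have ckE x k : cos_coeff (d * x) k = ck k * x ^+ k.
  by rewrite cos_coeffE exprMn mulrA.
have skE x k : sin_coeff (d * x) k = sk k * x ^+ k.
  by rewrite sin_coeffE exprMn mulrA.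
have lc x : \sum_(0 <= k < N) cos_coeff (d * x) k @[N --> \oo] --> cos (d * x).
  have := @is_cvg_series_cos_coeff R (d * x).
  by move=> /cvg_ex[l hl]; rewrite cos.unlock (cvg_lim (@norm_hausdorff _ _) hl).
have ls x : \sum_(0 <= k < N) sin_coeff (d * x) k @[N --> \oo] --> sin (d * x).
  have := @is_cvg_series_sin_coeff R (d * x).
  by move=> /cvg_ex[l hl]; rewrite sin.unlock (cvg_lim (@norm_hausdorff _ _) hl).
have bc x N : `|\sum_(0 <= k < N) cos_coeff (d * x) k| <= expR `|d * x|.
  exact: le_trans (ler_norm_sum _ _ _) (series_norm_cos_coeff_le _ _).
have bs x N : `|\sum_(0 <= k < N) sin_coeff (d * x) k| <= expR `|d * x|.
  exact: le_trans (ler_norm_sum _ _ _) (series_norm_sin_coeff_le _ _).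
split.
- rewrite (_ : (fun x => _) = (fun x => x ^+ n * expR (- x) *
      (cos (t * x) * cos (d * x) + (- sin (t * x)) * sin (d * x)))); last first.
    by apply/funext => x; rewrite mulrDl cosD mulNr.
  apply: (@agree_dct (fun N x => x ^+ n * expR (- x) *
      (cos (t * x) * (\sum_(0 <= k < N) cos_coeff (d * x) k) +
      (- sin (t * x)) * (\sum_(0 <= k < N) sin_coeff (d * x) k))) _ _ _ d1 d2).
  + move=> N.
    rewrite (_ : (fun x => _) = (fun x => \sum_(0 <= k < N)
      (ck k * (x ^+ (n + k) * expR (- x) * cos (t * x)) +
       - sk k * (x ^+ (n + k) * expR (- x) * sin (t * x))))).
      by apply: agree_sum => k; apply: agreeD; apply: agreeZ; have [] := wt (n + k)%N.
    apply/funext => x; rewrite mulrDr !mulrA !mulr_sumr -big_split/=.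
    by apply: eq_bigr => k _; rewrite ckE skE exprD; ring.
  + by move=> N x; apply: bnd => //; rewrite ?normrN ?cos_norm_le1 ?sin_norm_le1.
  + move=> x; apply: cvgM; first exact: cvg_cst.
    by apply: cvgD; apply: cvgM => //; exact: cvg_cst.
- rewrite (_ : (fun x => _) = (fun x => x ^+ n * expR (- x) *
      (sin (t * x) * cos (d * x) + cos (t * x) * sin (d * x)))); last first.
    by apply/funext => x; rewrite mulrDl sinD.
  apply: (@agree_dct (fun N x => x ^+ n * expR (- x) *
      (sin (t * x) * (\sum_(0 <= k < N) cos_coeff (d * x) k) +
      cos (t * x) * (\sum_(0 <= k < N) sin_coeff (d * x) k))) _ _ _ d1 d2).
  + move=> N.
    rewrite (_ : (fun x => _) = (fun x => \sum_(0 <= k < N)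
      (ck k * (x ^+ (n + k) * expR (- x) * sin (t * x)) +
       sk k * (x ^+ (n + k) * expR (- x) * cos (t * x))))).
      by apply: agree_sum => k; apply: agreeD; apply: agreeZ; have [] := wt (n + k)%N.
    apply/funext => x; rewrite mulrDr !mulrA !mulr_sumr -big_split/=.
    by apply: eq_bigr => k _; rewrite ckE skE exprD; ring.
  + by move=> N x; apply: bnd => //; rewrite ?normrN ?cos_norm_le1 ?sin_norm_le1.
  + move=> x; apply: cvgM; first exact: cvg_cst.
    by apply: cvgD; apply: cvgM => //; exact: cvg_cst.
Qed.

Let walk_all (t : R) : walk t.
Proof.
pose N := Num.bound (4 * `|t|).
have N0 : (0 : R) < N%:R.
  by apply: le_lt_trans (archi_boundP _); rewrite ?mulr_ge0.
have step k : walk (k%:R * (t / N%:R)).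
  elim: k => [n|k ih].
    split.
      by have := agree_moment n; congr agree; apply/funext => x; rewrite !mul0r cos0 mulr1.
    have := agreeZ 0 (agree_moment n); congr agree; apply/funext => x.
    by rewrite !mul0r sin0 mulr0.
  rewrite -natr1 mulrDl mul1r; apply: walk_step => //.
  rewrite normrM normfV (gtr0_norm N0) ler_pdivrMr//.
  have : 4 * `|t| < N%:R by apply: archi_boundP; rewrite mulr_ge0.
  lra.
by have := step N; rewrite mulrCA divff ?mulr1// gt_eqF.
Qed.

(* Differentiating in [s] (by finite differences) gives equal moments
   [x ^+ n * expR (- x)]; power series in steps of length [1 / 4] then give equal
   Fourier transforms of the measures tilted by [expR (- x)]. *)
Theorem measure_unique_laplace A : measurable A -> m1 A = m2 A.
Proof.
have w0 x : 0 <= expR (- x) :> R by exact: expR_ge0.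
have := laplace_agree ltr01; rewrite (_ : (fun x => _) = (fun x => expR (- x))); last first.
  by apply/funext => x; rewrite mul1r.
move=> [w1 w2 _].
have [n1 [_ n1E]] := ex_image_measure w0 w1 (@measurable_id _ R setT).
have [n2 [_ n2E]] := ex_image_measure w0 w2 (@measurable_id _ R setT).
have tr (h : R -> R) : measurable_fun setT h -> (forall x, `|h x| <= 1) ->
    \int[n1]_x h x = \int[m1]_x (h x * expR (- x)) /\
    \int[n2]_x h x = \int[m2]_x (h x * expR (- x)).
  move=> mh h1; split.
    by have [_ /(_ (L1M_bounded w1 mh h1))[]] := n1E h mh.
  by have [_ /(_ (L1M_bounded w2 mh h1))[]] := n2E h mh.
have n12 : forall A, measurable A -> n1 A = n2 A.
  apply: measure_unique_fourier => t; have [[_ _ c] [_ _ s]] := walk_all t 0.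
    have mc : measurable_fun setT (fun x : R => cos (t * x)) by meas.
    rewrite /costr; have := c.
    under eq_Rintegral do rewrite expr0 mul1r mulrC.
    under [in X in _ = X -> _]eq_Rintegral do rewrite expr0 mul1r mulrC.
    by rewrite -(tr _ mc (fun x => cos_norm_le1 _)).1 -(tr _ mc (fun x => cos_norm_le1 _)).2.
  have ms : measurable_fun setT (fun x : R => sin (t * x)) by meas.
  rewrite /sintr; have := s.
  under eq_Rintegral do rewrite expr0 mul1r mulrC.
  under [in X in _ = X -> _]eq_Rintegral do rewrite expr0 mul1r mulrC.
  by rewrite -(tr _ ms (fun x => sin_norm_le1 _)).1 -(tr _ ms (fun x => sin_norm_le1 _)).2.
apply: finite_measure_unique => k a b k0 _.
have k0' := ltW k0; have mt := measurable_trapezoid a b k0'.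
(* Multiplying the test function by [expR x] undoes the tilt. *)
have mg : measurable_fun setT (fun x => trapezoid k a b x * expR x) by meas.
have tE : (fun x => trapezoid k a b x * expR x * expR (- x)) = trapezoid k a b.
  by apply/funext => x; rewrite -mulrA -expRD subrr expR0 mulr1.
have lt (m : {finite_measure set R -> \bar R}) : L1 m (trapezoid k a b).
  by apply: (@L1_bounded _ _ _ _ 1) => // x; rewrite ger0_norm ?trapezoid_ge0 ?trapezoid_le1.
have [_] := n1E _ mg; rewrite tE => /(_ (lt m1)) [_ <-].
have [_] := n2E _ mg; rewrite tE => /(_ (lt m2)) [_ <-].
by rewrite /Rintegral; congr fine; apply: eq_measure_integral => B mB _; exact: n12.
Qed.

End laplace_uniqueness.

(** * The convolution equation *)

Section twice_differentiable.
Variable R : realType.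
Implicit Types f g : R -> R.

(** The regularity that two integrations by parts require, with the derivatives named. *)
Definition C2 f := exists f1 f2 : R -> R,
  [/\ forall z : R, is_derive z 1 f (f1 z), forall z : R, is_derive z 1 f1 (f2 z)
    & continuous f2].

Lemma C2_derivative f : C2 f -> exists f1 f2 : R -> R,
  [/\ forall z : R, is_derive z 1 f (f1 z), forall z : R, is_derive z 1 f1 (f2 z),
      continuous f, continuous f1 & continuous f2].
Proof.
move=> [f1 [f2 [d1 d2 c2]]]; exists f1, f2; split => //.
  exact: is_derive_continuous d1.
exact: is_derive_continuous d2.
Qed.

Lemma C2_continuous f : C2 f -> continuous f.
Proof. by move=> /C2_derivative[f1 [f2 []]]. Qed.

Lemma C2_cst (c : R) : C2 (fun=> c).
Proof.
exists (fun=> 0), (fun=> 0); split => [z|z|z].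
- exact: is_derive_cst.
- exact: is_derive_cst.
- exact: cvg_cst.
Qed.

Lemma C2_id : C2 id.
Proof.
exists (fun=> 1), (fun=> 0); split => [z|z|z].
- exact: is_derive_id.
- exact: is_derive_cst.
- exact: cvg_cst.
Qed.

Lemma C2D f g : C2 f -> C2 g -> C2 (fun x => f x + g x).
Proof.
move=> [f1 [f2 [d1 d2 c2]]] [g1 [g2 [e1 e2 c2']]].
exists (fun x => f1 x + g1 x), (fun x => f2 x + g2 x); split => [z|z|z].
- by have ? := d1 z; have ? := e1 z; apply: is_deriveD.
- by have ? := d2 z; have ? := e2 z; apply: is_deriveD.
- by apply: cvgD; [exact: c2|exact: c2'].
Qed.

Lemma C2M f g : C2 f -> C2 g -> C2 (fun x => f x * g x).
Proof.
move=> /C2_derivative[f1 [f2 [d1 d2 c0 c1 c2]]].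
move=> /C2_derivative[g1 [g2 [e1 e2 b0 b1 b2]]].
exists (fun x => f1 x * g x + f x * g1 x).
exists (fun x => f2 x * g x + f1 x * g1 x + (f1 x * g1 x + f x * g2 x)).
split => [z|z|z].
- have ? := d1 z; have ? := e1 z; apply: is_derive_eq.
  by rewrite /GRing.scale/=; ring.
- have ? := d1 z; have ? := e1 z; have ? := d2 z; have ? := e2 z.
  by apply: is_derive_eq; rewrite /GRing.scale/=; ring.
- by apply: cvgD; apply: cvgD; apply: cvgM;
    [exact: c2|exact: b0|exact: c1|exact: b1|exact: c1|exact: b1|exact: c0|exact: b2].
Qed.

Lemma C2V f : C2 f -> (forall x, f x != 0) -> C2 (fun x => (f x)^-1).
Proof.
move=> /C2_derivative[f1 [f2 [d1 d2 c0 c1 c2]]] fn0.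
have cV : continuous (fun x => (f x)^-1) by move=> x; apply: cvgV => //; exact: c0.
have dV (z : R) : is_derive z 1 (fun x => (f x)^-1) (- f1 z * ((f z)^-1 * (f z)^-1)).
  have ? := d1 z; have h := is_deriveV (fn0 z) (d1 z).
  by apply: is_derive_eq h _; rewrite /GRing.scale/=; field.
exists (fun x => - f1 x * ((f x)^-1 * (f x)^-1)).
exists (fun z => - f2 z * ((f z)^-1 * (f z)^-1) +
  - f1 z * (2 * ((- f1 z * ((f z)^-1 * (f z)^-1)) * (f z)^-1))).
split => [z|z|z].
- exact: dV.
- have ? := d2 z; have ? := dV z; apply: is_derive_eq.
  by rewrite /GRing.scale/=; ring.
- have hf1 : - f1 x @[x --> z] --> - f1 z by apply: cvgN; exact: c1.
  apply: cvgD; apply: cvgM.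
  + by apply: cvgN; exact: c2.
  + by apply: cvgM; exact: cV.
  + exact: hf1.
  + apply: cvgM; first exact: cvg_cst.
    by apply: cvgM; [apply: cvgM => //; apply: cvgM|]; exact: cV.
Qed.

Lemma C2_cos (l : R) : C2 (fun x => cos (l * x)).
Proof.
exists (fun x => - l * sin (l * x)), (fun x => - l * (l * cos (l * x))).
have dc (z : R) : is_derive z 1 (fun x => cos (l * x)) (- l * sin (l * z)).
  by apply: is_derive_eq; rewrite /GRing.scale/=; ring.
split => [z|z|]; first exact: dc.
  by apply: is_derive_eq; rewrite /GRing.scale/=; ring.
move=> z; apply: cvgM; first exact: cvg_cst.
by apply: cvgM; [exact: cvg_cst|exact: (is_derive_continuous dc)].
Qed.

Lemma C2_sin (l : R) : C2 (fun x => sin (l * x)).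
Proof.
exists (fun x => l * cos (l * x)), (fun x => - l * (l * sin (l * x))).
have ds (z : R) : is_derive z 1 (fun x => sin (l * x)) (l * cos (l * z)).
  by apply: is_derive_eq; rewrite /GRing.scale/=; ring.
split => [z|z|]; first exact: ds.
  by apply: is_derive_eq; rewrite /GRing.scale/=; ring.
move=> z; apply: cvgM; first exact: cvg_cst.
by apply: cvgM; [exact: cvg_cst|exact: (is_derive_continuous ds)].
Qed.

Lemma C2_sum (I : Type) (s : seq I) (h : I -> R -> R) :
  (forall i, C2 (h i)) -> C2 (fun x => \sum_(i <- s) h i x).
Proof.
move=> hC; elim: s => [|i s ih].
  rewrite (_ : (fun x => _) = (fun=> 0)); first exact: C2_cst.
  by apply/funext => x; rewrite big_nil.
rewrite (_ : (fun x => _) = (fun x => h i x + \sum_(j <- s) h j x)).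
  exact: C2D.
by apply/funext => x; rewrite big_cons.
Qed.

End twice_differentiable.

(** * Quadratic decay of oscillatory integrals *)

Section oscillatory_decay.
Variable R : realType.
Local Notation I01 F := (\int[@lebesgue_measure R]_(t in `[0, 1]) F t).

Lemma Rintegral01_le (f u : R -> R) : continuous f -> continuous u ->
  (forall t, `|u t| <= 1) -> `|I01 (fun t => f t * u t)| <= I01 (fun t => `|f t|).
Proof.
move=> cf cu u1.
have i (h : R -> R) : continuous h ->
    (@lebesgue_measure R).-integrable `[0, 1]%classic (EFin \o h).
  move=> ch; apply: continuous_compact_integrable; first exact: segment_compact.
  exact: continuous_subspaceT.
have cn : continuous (fun t => `|f t|).
  by move=> t; apply: cvg_norm; exact: cf.
have cfu : continuous (fun t => f t * u t).
  by move=> t; apply: cvgM; [exact: cf|exact: cu].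
apply: (le_trans (le_normr_Rintegral _ (i _ cfu))) => //.
apply: le_Rintegral => //.
- by apply: i => t; apply: cvg_norm; exact: cfu.
- exact: i.
- by move=> t _; rewrite normrM -[leRHS]mulr1 ler_wpM2l.
Qed.

Let ccos (y : R) : continuous (fun t => cos (y * t)).
Proof. exact: C2_continuous (C2_cos y). Qed.

Let csin (y : R) : continuous (fun t => sin (y * t)).
Proof. exact: C2_continuous (C2_sin y). Qed.

Let dcos (y z : R) : is_derive z 1 (fun x => cos (y * x)) (- y * sin (y * z)).
Proof. by apply: is_derive_eq; rewrite /GRing.scale/=; ring. Qed.

Let dsin (y z : R) : is_derive z 1 (fun x => sin (y * x)) (y * cos (y * z)).
Proof. by apply: is_derive_eq; rewrite /GRing.scale/=; ring. Qed.

Let I01Z (k : R) (h : R -> R) : continuous h ->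
  I01 (fun t => k * h t) = k * I01 h.
Proof.
move=> ch; apply: RintegralZl => //.
apply: continuous_compact_integrable; first exact: segment_compact.
exact: continuous_subspaceT.
Qed.

(** Two integrations by parts. The first boundary term vanishes at [1] because [q 1 = 0] and at [0]
    because it carries a sine; the second one is merely bounded. *)
Lemma decay_cos_integral (q : R -> R) : C2 q -> q 1 = 0 ->
  exists C, forall y, `|y ^+ 2 * I01 (fun t => q t * cos (y * t))| <= C.
Proof.
move=> /C2_derivative[q1 [q2 [d1 d2 c0 c1 c2]]] q1_0.
exists (`|q1 1| + `|q1 0| + I01 (fun t => `|q2 t|)) => y.
have cM (f g : R -> R) : continuous f -> continuous g -> continuous (fun t => f t * g t).
  by move=> cf cg t; apply: cvgM; [exact: cf|exact: cg].
have cZ (k : R) (f : R -> R) : continuous f -> continuous (fun t => k * f t).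
  by move=> cf; apply: cM => // t; exact: cvg_cst.
have := Rintegral_by_parts ltr01 d1 c1 (dsin y) (cZ y _ (@ccos y)).
rewrite q1_0 mul0r mulr0 sin0 mulr0 subr0 sub0r => e1.
have := Rintegral_by_parts ltr01 d2 c2 (dcos y) (cZ (- y) _ (@csin y)).
rewrite mulr1 mulr0 cos0 mulr1 => e2.
have f1 : y * I01 (fun t => q t * cos (y * t)) = - I01 (fun t => q1 t * sin (y * t)).
  rewrite -I01Z; last exact: cM.
  by rewrite -e1; apply: eq_Rintegral => t _; ring.
have f2 : - y * I01 (fun t => q1 t * sin (y * t)) =
    q1 1 * cos y - q1 0 - I01 (fun t => q2 t * cos (y * t)).
  rewrite -I01Z; last exact: cM.
  by rewrite -e2; apply: eq_Rintegral => t _; ring.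
rewrite expr2 -mulrA f1 mulrN -mulNr f2.
apply: le_trans (ler_normB _ _) _; apply: lerD; last first.
  by apply: Rintegral01_le => // t; exact: cos_norm_le1.
apply: le_trans (ler_normB _ _) _; apply: lerD => //.
by rewrite normrM -[leRHS]mulr1 ler_wpM2l// cos_norm_le1.
Qed.

(** Here the first boundary term carries a cosine, which does not vanish at [0]; the condition
    [q 0 = 0] removes it. *)
Lemma decay_sin_integral (q : R -> R) : C2 q -> q 0 = 0 -> q 1 = 0 ->
  exists C, forall y, `|y ^+ 2 * I01 (fun t => q t * sin (y * t))| <= C.
Proof.
move=> /C2_derivative[q1 [q2 [d1 d2 c0 c1 c2]]] q0_0 q1_0.
exists (`|q1 1| + I01 (fun t => `|q2 t|)) => y.
have cM (f g : R -> R) : continuous f -> continuous g -> continuous (fun t => f t * g t).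
  by move=> cf cg t; apply: cvgM; [exact: cf|exact: cg].
have cZ (k : R) (f : R -> R) : continuous f -> continuous (fun t => k * f t).
  by move=> cf; apply: cM => // t; exact: cvg_cst.
have := Rintegral_by_parts ltr01 d1 c1 (dcos y) (cZ (- y) _ (@csin y)).
rewrite q1_0 q0_0 !mul0r subr0 sub0r => e1.
have := Rintegral_by_parts ltr01 d2 c2 (dsin y) (cZ y _ (@ccos y)).
rewrite mulr1 mulr0 sin0 mulr0 subr0 => e2.
have f1 : - y * I01 (fun t => q t * sin (y * t)) = - I01 (fun t => q1 t * cos (y * t)).
  rewrite -I01Z; last exact: cM.
  by rewrite -e1; apply: eq_Rintegral => t _; ring.
have f2 : y * I01 (fun t => q1 t * cos (y * t)) =
    q1 1 * sin y - I01 (fun t => q2 t * sin (y * t)).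
  rewrite -I01Z; last exact: cM.
  by rewrite -e2; apply: eq_Rintegral => t _; ring.
have f1' : y * I01 (fun t => q t * sin (y * t)) = I01 (fun t => q1 t * cos (y * t)).
  by apply: oppr_inj; rewrite -mulNr f1.
rewrite expr2 -mulrA f1' f2.
apply: le_trans (ler_normB _ _) _; apply: lerD; last first.
  by apply: Rintegral01_le => // t; exact: sin_norm_le1.
by rewrite normrM -[leRHS]mulr1 ler_wpM2l// sin_norm_le1.
Qed.

End oscillatory_decay.

(** * Inverting a convolution with finitely many atoms *)

Section convolution_equation.
Variables (R : realType) (q : nat) (a : 'I_q -> R).

(** Real and imaginary parts of the symbol [P t = sum_j a_j exp(i l_j t)]. The shifts [l] remain an
    argument because the uniqueness proof rescales them. *)
Let P_re (l : 'I_q -> R) (t : R) := \sum_(j < q) a j * cos (l j * t).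
Let P_im (l : 'I_q -> R) (t : R) := \sum_(j < q) a j * sin (l j * t).

(* [kappa] is the Fourier transform of [(1 - |t|) / P t]; it is integrable
   because [1 / P] is smooth, and [sum_j a_j kappa (x - l_j)] is the Fejer kernel. *)
Lemma ex_convolution_inverse (l : 'I_q -> R) :
  (forall t, P_re l t ^+ 2 + P_im l t ^+ 2 != 0) ->
  exists2 kappa : R -> R, L1 (@leb R) kappa &
    forall x, \sum_(j < q) a j * kappa (x - l j) = fejer x.
Proof.
move=> Pn0.
have C2U : C2 (P_re l) by apply: C2_sum => j; exact: (C2M (C2_cst _) (C2_cos _)).
have C2Vv : C2 (P_im l) by apply: C2_sum => j; exact: (C2M (C2_cst _) (C2_sin _)).
have C2N : C2 (fun t => (P_re l t ^+ 2 + P_im l t ^+ 2)^-1).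
  by apply: C2V => //; apply: C2D; [exact: (C2M C2U C2U)|exact: (C2M C2Vv C2Vv)].
(* [p + i r] is the inverse of the conjugate of [P], so [phi x t] below is the real part of
   [exp(i x t)] divided by that conjugate. Shifting [x] by [- l_j] and summing with weights [a_j]
   multiplies by the conjugate of [P] and cancels the denominator. *)
pose p t := P_re l t * (P_re l t ^+ 2 + P_im l t ^+ 2)^-1.
pose r t := P_im l t * (P_re l t ^+ 2 + P_im l t ^+ 2)^-1.
have C2p : C2 p by exact: C2M.
have C2r : C2 r by exact: C2M.
have [tau [tauE fejerE]] := ex_fejer_measure R.
pose phi x t := p t * cos (x * t) - r t * sin (x * t).
have C2phi x : C2 (phi x).
  have := C2D (C2M C2p (C2_cos x)) (C2M (C2_cst (-1)) (C2M C2r (C2_sin x))).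
  by congr C2; apply/funext => t; rewrite /phi; ring.
have iphi x : L1 tau (phi x) by have [] := tauE _ (C2_continuous (C2phi x)).
pose kappa x := \int[tau]_t phi x t.
have kappa_inv x : \sum_(j < q) a j * kappa (x - l j) = fejer x.
  rewrite /kappa fejerE.
  under eq_bigr => j _ do rewrite -RintegralZl//.
  rewrite -Rintegral_sum; last by move=> j; exact: L1Z.
  apply: eq_Rintegral => t _.
  transitivity (p t * (cos (x * t) * P_re l t + sin (x * t) * P_im l t) -
     r t * (sin (x * t) * P_re l t - cos (x * t) * P_im l t)).
    transitivity (\sum_(j < q) (p t * (cos (x * t) * (a j * cos (l j * t)) +
        sin (x * t) * (a j * sin (l j * t))) -
        r t * (sin (x * t) * (a j * cos (l j * t)) -
        cos (x * t) * (a j * sin (l j * t))))).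
      by apply: eq_bigr => j _; rewrite /phi mulrBl cosB sinB; ring.
    by rewrite sumrB -!mulr_sumr big_split/= sumrB -!mulr_sumr.
  by rewrite /p /r; have := Pn0 t => ?; field.
have bnd_cont : continuous (fun t => `|p t| + `|r t|).
  by move=> t; apply: cvgD; apply: cvg_norm; [exact: (C2_continuous C2p)|
    exact: (C2_continuous C2r)].
have [ibnd _] := tauE _ bnd_cont.
have phi_bnd x t : `|phi x t| <= `|p t| + `|r t|.
  apply: le_trans (ler_normB _ _) _; rewrite !normrM; apply: lerD;
    rewrite -[leRHS]mulr1 ler_wpM2l//; [exact: cos_norm_le1|exact: sin_norm_le1].
have ckappa : continuous kappa.
  move=> x; apply/(@cvg_nbhsP _ R^o) => u ux.
  have [] // := @Rintegral_dct _ _ _ tau (fun n t => phi (u n) t) (phi x)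
    (fun t => `|p t| + `|r t|).
  - by move=> n; exact: L1_measurable (iphi _).
  - move=> t; apply: cvgB; (apply: cvgM; first exact: cvg_cst).
      apply: (cvg_comp (fun n => u n * t) cos _ (@continuous_cos R (x * t))).
      by apply: cvgM => //; exact: cvg_cst.
    apply: (cvg_comp (fun n => u n * t) sin _ (@continuous_sin R (x * t))).
    by apply: cvgM => //; exact: cvg_cst.
have [C0 hC0] : exists C0, forall x, `|kappa x| <= C0.
  exists (\int[tau]_t (`|p t| + `|r t|)) => x.
  by apply: le_norm_Rintegral => //; exact: L1_measurable (iphi _).
have [C1 hC1] : exists C1, forall x, `|x ^+ 2 * kappa x| <= C1.
  (* The weight vanishes at [1], and [r] vanishes at [0] because [P_im] does; these are the boundary
     conditions of the two decay lemmas. *)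
  pose wt (t : R) := 2 * (1 - t).
  have C2w : C2 wt.
    have := C2M (C2_cst 2) (C2D (C2_cst 1) (C2M (C2_cst (-1)) (@C2_id R))).
    by congr C2; apply/funext => t; rewrite /wt; ring.
  have P_im0 : P_im l 0 = 0.
    by rewrite /P_im big1// => j _; rewrite mulr0 sin0 mulr0.
  have wp1 : wt 1 * p 1 = 0 by rewrite /wt subrr mulr0 mul0r.
  have wr1 : wt 1 * r 1 = 0 by rewrite /wt subrr mulr0 mul0r.
  have wr0 : wt 0 * r 0 = 0 by rewrite /r P_im0 mul0r mulr0.
  have [D1 hD1] := decay_cos_integral (C2M C2w C2p) wp1.
  have [D2 hD2] := decay_sin_integral (C2M C2w C2r) wr0 wr1.
  exists (D1 + D2) => x.
  have -> : kappa x = \int[@lebesgue_measure R]_(t in `[0, 1]) (wt t * p t * cos (x * t))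
      - \int[@lebesgue_measure R]_(t in `[0, 1]) (wt t * r t * sin (x * t)).
    have i01 (h : R -> R) : continuous h ->
      (@lebesgue_measure R).-integrable `[0, 1]%classic (EFin \o h).
      move=> ch; apply: continuous_compact_integrable; first exact: segment_compact.
      exact: continuous_subspaceT.
    rewrite -RintegralB//; last 2 first.
    + by apply: i01; exact: (C2_continuous (C2M (C2M C2w C2p) (C2_cos x))).
    + by apply: i01; exact: (C2_continuous (C2M (C2M C2w C2r) (C2_sin x))).
    rewrite /kappa (tauE _ (C2_continuous (C2phi x))).2.
    by apply: eq_Rintegral => t _; rewrite /phi /wt; ring.
  rewrite mulrBr; apply: le_trans (ler_normB _ _) _.
  by apply: lerD; [exact: hD1|exact: hD2].
(* Boundedness and quadratic decay together dominate [kappa] by a multiple of [1 / (1 + x ^ 2)]. *)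
exists kappa => //.
apply: (L1_dom _ (L1Z (C0 + C1) (@L1_leb_cauchy R))) => [|x].
  exact: continuous_measurable_fun.
have x2 : 0 < 1 + x ^+ 2 by rewrite ltr_pwDl// sqr_ge0.
rewrite ler_pdivlMr// mulrDr mulr1 lerD//.
by have := hC1 x; rewrite normrM (ger0_norm (sqr_ge0 _)) mulrC.
Qed.

(* Integrating the equation against [kappa] shows that every Fejer mean of [g]
   vanishes. *)
Theorem convolution_equation_unique (l : 'I_q -> R) (g : R -> R) (M : R) :
  (forall t, P_re l t ^+ 2 + P_im l t ^+ 2 != 0) ->
  continuous g -> (forall x, `|g x| <= M) ->
  (forall x, \sum_(j < q) a j * g (x + l j) = 0) ->
  forall x, g x = 0.
Proof.
move=> Pn0 cg gM gE.
have mg : measurable_fun setT g by exact: continuous_measurable_fun.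
have smoothing0 (A y : R) : 0 < A -> smoothing A g y = 0.
  move=> A0; have An0 : A != 0 by rewrite gt_eqF.
  (* In the variable [u] of the smoothing at scale [A], a translation of [g] by [l j] is a
     translation by [A * l j]; so the inverse kernel is taken for the rescaled shifts. *)
  pose l' j := A * l j.
  have [t|kappa ik hk] := @ex_convolution_inverse l'.
    have -> : P_re l' t = P_re l (A * t).
      by apply: eq_bigr => j _; rewrite /l'; congr (_ * cos _); ring.
    have -> : P_im l' t = P_im l (A * t).
      by apply: eq_bigr => j _; rewrite /l'; congr (_ * sin _); ring.
    exact: Pn0.
  have mgA : measurable_fun setT (fun u : R => g (y + u / A)).
    by apply: (measurableT_comp mg); meas.
  have ij j : L1 (@leb R) (fun u => kappa (u - l' j) * g (y + u / A)).
    rewrite (_ : (fun u => _) = (fun u => g (y + u / A) * kappa (1 * u + - l' j))).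
      apply: (@L1M_bounded _ _ _ _ M) => //.
      exact: (@L1_leb_affine _ 1 (- l' j) ltr01).
    by apply/funext => u; rewrite mul1r mulrC.
  rewrite /smoothing.
  transitivity (\int[@leb R]_u \sum_(j < q) (a j * (kappa (u - l' j) * g (y + u / A)))).
    apply: eq_Rintegral => u _; rewrite -hk mulr_suml.
    by apply: eq_bigr => j _; rewrite mulrA.
  rewrite Rintegral_sum; last by move=> j; exact: L1Z.
  have ij' j : L1 (@leb R) (fun v => kappa v * g (y + v / A + l j)).
    have := @L1_leb_affine _ 1 (l' j) ltr01 _ (ij j).
    congr (integrable _ _ (EFin \o _)); apply/funext => v.
    by rewrite mul1r addrK; congr (_ * g _); rewrite /l'; field.
  transitivity (\sum_(j < q) \int[@leb R]_v (a j * (kappa v * g (y + v / A + l j)))).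
    apply: eq_bigr => j _; rewrite !RintegralZl//; congr (_ * _).
    rewrite (Rintegral_leb_affine (l' j) ltr01 (ij j)) mul1r.
    apply: eq_Rintegral => v _; rewrite mul1r addrK; congr (_ * g _).
    by rewrite /l'; field.
  rewrite -Rintegral_sum; last by move=> j; exact: L1Z.
  transitivity (\int[@leb R]_v (0 : R)); last by rewrite /Rintegral integral0.
  apply: eq_Rintegral => v _.
  transitivity (kappa v * \sum_(j < q) a j * g (y + v / A + l j)).
    by rewrite mulr_sumr; apply: eq_bigr => j _; ring.
  by rewrite gE mulr0.
move=> x.
have gu (u : R) : g (x + u / n.+1%:R) @[n --> \oo] --> g x.
  apply: continuous_cvg; first exact: cg.
  rewrite -[X in _ --> X]addr0 -(mulr0 u); apply: cvgD; first exact: cvg_cst.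
  by apply: cvgM; [exact: cvg_cst|exact: cvg_harmonic].
have lim := smoothing_pointwise mg gM gu.
have : fejer_mass R * g x = 0.
  rewrite (_ : (fun n => _) = (fun=> 0)) in lim; last first.
    by apply/funext => n; exact: smoothing0.
  rewrite -(cvg_lim (@norm_hausdorff _ _) lim).
  by rewrite lim_cst//; exact: norm_hausdorff.
by move/eqP; rewrite mulf_eq0 gt_eqF ?fejer_mass_gt0//= => /eqP.
Qed.

End convolution_equation.

(** * Laws and independent sums *)

Section laws.
Variable R : realType.

(** The bilateral transform may be infinite, hence the extended values. *)
Definition laplace (m : set R -> \bar R) (s : R) : \bar R :=
  (\int[m]_x (expR (- (s * x)))%:E)%E.

Lemma ex_law d (T : measurableType d) (P : {finite_measure set T -> \bar R})
    (f : T -> R) : measurable_fun setT f ->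
  exists mu : {finite_measure set R -> \bar R},
    (forall A, measurable A -> mu A = P (f @^-1` A)) /\
    forall h : R -> R, measurable_fun setT h ->
    ((forall y, 0 <= h y) -> (\int[mu]_y (h y)%:E = \int[P]_x (h (f x))%:E)%E) /\
    (L1 P (fun x => h (f x)) -> L1 mu h /\ \int[mu]_y h y = \int[P]_x h (f x)).
Proof.
move=> mf.
have i1 : L1 P (fun=> 1) by exact: finite_measure_integrable_cst.
have [mu [muA muh]] := ex_image_measure (fun=> ler01) i1 mf.
exists mu; split => [A mA|h mh].
  rewrite muA// integral_cst ?mul1e//.
  by rewrite -[X in measurable X]setTI; exact: mf.
have [h1 h2] := muh h mh; split => [h0|hi].
  by rewrite h1//; apply: eq_integral => x _; rewrite mulr1.
have e : (fun x => h (f x) * 1) = (fun x => h (f x)) by apply/funext => x; rewrite mulr1.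
by rewrite e in h2; exact: h2.
Qed.

Section same_law.
Context d1 d2 (T1 : measurableType d1) (T2 : measurableType d2).
Variables (P1 : {finite_measure set T1 -> \bar R}).
Variables (P2 : {finite_measure set T2 -> \bar R}).
Variables (f1 : T1 -> R) (f2 : T2 -> R).
Hypotheses (mf1 : measurable_fun setT f1) (mf2 : measurable_fun setT f2).

Lemma same_law_fourier :
  (forall t, \int[P1]_x cos (t * f1 x) = \int[P2]_x cos (t * f2 x)) ->
  (forall t, \int[P1]_x sin (t * f1 x) = \int[P2]_x sin (t * f2 x)) ->
  same_law (pushforward P1 f1) (pushforward P2 f2).
Proof.
move=> hc hs A mA; have [m1 [m1A m1h]] := ex_law P1 mf1.
have [m2 [m2A m2h]] := ex_law P2 mf2.
rewrite /pushforward -m1A// -m2A//; move: mA; apply: measure_unique_fourier => t.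
- have mc : measurable_fun setT (fun x : R => cos (t * x)) by meas.
  have [_ /(_ (L1_cos P1 mf1 t))[_ e1]] := m1h _ mc.
  have [_ /(_ (L1_cos P2 mf2 t))[_ e2]] := m2h _ mc.
  by rewrite -[LHS]/(\int[m1]_x cos (t * x)) -[RHS]/(\int[m2]_x cos (t * x)) e1 e2.
- have ms : measurable_fun setT (fun x : R => sin (t * x)) by meas.
  have [_ /(_ (L1_sin P1 mf1 t))[_ e1]] := m1h _ ms.
  have [_ /(_ (L1_sin P2 mf2 t))[_ e2]] := m2h _ ms.
  by rewrite -[LHS]/(\int[m1]_x sin (t * x)) -[RHS]/(\int[m2]_x sin (t * x)) e1 e2.
Qed.

Lemma same_law_laplace :
  (forall s : R, (0 < s)%R -> \int[P1]_x (expR (- (s * f1 x)))%:E < +oo)%E ->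
  (forall s : R, (0 < s)%R -> \int[P1]_x (expR (- (s * f1 x)))%:E =
                      \int[P2]_x (expR (- (s * f2 x)))%:E)%E ->
  same_law (pushforward P1 f1) (pushforward P2 f2).
Proof.
move=> hfin hl A mA; have [m1 [m1A m1h]] := ex_law P1 mf1.
have [m2 [m2A m2h]] := ex_law P2 mf2.
rewrite /pushforward -m1A// -m2A//; move: mA; apply: measure_unique_laplace => s s0.
have me : measurable_fun setT (fun x : R => expR (- (s * x))) by meas.
have e0 (y : R) : 0 <= expR (- (s * y)) by exact: expR_ge0.
have i1 : L1 P1 (fun x => expR (- (s * f1 x))).
  by apply: L1_ge0 => //; [meas|exact: hfin].
have i2 : L1 P2 (fun x => expR (- (s * f2 x))).
  by apply: L1_ge0 => //; [meas|rewrite -hl//; exact: hfin].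
have [_ /(_ i1)[j1 e1]] := m1h _ me.
have [_ /(_ i2)[j2 e2]] := m2h _ me.
by split => //; rewrite e1 e2; congr fine; exact: hl.
Qed.

Hypothesis f12 : same_law (pushforward P1 f1) (pushforward P2 f2).

Lemma same_law_ge0_integral (h : R -> R) : measurable_fun setT h ->
  (forall y, 0 <= h y) ->
  (\int[P1]_x (h (f1 x))%:E = \int[P2]_x (h (f2 x))%:E)%E.
Proof.
move=> mh h0; have [m1 [m1A m1h]] := ex_law P1 mf1.
have [m2 [m2A m2h]] := ex_law P2 mf2.
have [/(_ h0) <- _] := m1h h mh; have [/(_ h0) <- _] := m2h h mh.
apply: eq_measure_integral => A mA _; transitivity (P1 (f1 @^-1` A)).
  by rewrite -m1A.
by have := f12 mA; rewrite /pushforward => ->; rewrite -m2A.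
Qed.

Lemma same_law_Rintegral (h : R -> R) : measurable_fun setT h ->
  L1 P1 (fun x => h (f1 x)) -> L1 P2 (fun x => h (f2 x)) ->
  \int[P1]_x h (f1 x) = \int[P2]_x h (f2 x).
Proof.
move=> mh i1 i2; have [m1 [m1A m1h]] := ex_law P1 mf1.
have [m2 [m2A m2h]] := ex_law P2 mf2.
have [_ /(_ i1)[_ <-]] := m1h h mh; have [_ /(_ i2)[_ <-]] := m2h h mh.
congr fine; apply: eq_measure_integral => A mA _; transitivity (P1 (f1 @^-1` A)).
  by rewrite -m1A.
by have := f12 mA; rewrite /pushforward => ->; rewrite -m2A.
Qed.

End same_law.

Section products.
Variables m1 m2 : {finite_measure set R -> \bar R}.

(** By Tonelli, hence valid with infinite values; finiteness of the factors can then be deduced from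
    that of the product. *)
Lemma laplace_prod (s a b : R) :
  (\int[m1 \x m2]_z (expR (- (s * (a * z.1 + b * z.2))))%:E =
   laplace m1 (s * a) * laplace m2 (s * b))%E.
Proof.
have me : measurable_fun setT (fun z : R * R => expR (- (s * (a * z.1 + b * z.2)))) by meas.
rewrite (fubini_tonelli1 (fun z => (expR (- (s * (a * z.1 + b * z.2))))%:E))/=; last 2 first.
- exact/measurable_EFinP.
- by move=> z; rewrite lee_fin expR_ge0.
rewrite /fubini_F /= /laplace.
under eq_integral => x _.
  under eq_integral => y _.
    rewrite (_ : - (s * (a * x + b * y)) = - (s * a * x) + - (s * b * y)); last by ring.
    rewrite expRD EFinM; over.
  rewrite ge0_integralZl//; last by apply/measurable_EFinP; meas.
  over.
rewrite ge0_integralZr//; last by apply: integral_ge0 => y _; rewrite lee_fin expR_ge0.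
by apply/measurable_EFinP; meas.
Qed.

Let Rintegral_prod_mul (u v : R -> R) :
  (forall x, `|u x| <= 1) -> measurable_fun setT u ->
  (forall x, `|v x| <= 1) -> measurable_fun setT v ->
  L1 (m1 \x m2)%E (fun z => u z.1 * v z.2) /\
  \int[(m1 \x m2)%E]_z (u z.1 * v z.2) = \int[m1]_x u x * \int[m2]_y v y.
Proof.
move=> u1 mu v1 mv.
have iu : L1 m1 u by exact: L1_bounded u1.
have iv : L1 m2 v by exact: L1_bounded v1.
pose F (z : R * R) := u z.1 * v z.2.
have mF : measurable_fun setT F.
  by apply: measurable_funM; [apply: (measurableT_comp mu)|apply: (measurableT_comp mv)]; meas.
have dF x y : `|F (x, y)| <= cst 1 x * cst 1 y.
  by rewrite normrM; apply: ler_pM.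
have i1 : L1 m1 (cst 1) by exact: finite_measure_integrable_cst.
have i2 : L1 m2 (cst 1) by exact: finite_measure_integrable_cst.
split; first exact: (L1_prod mF i1 i2 dF).
rewrite (Rintegral_prod mF i1 i2 dF) -RintegralZr//; apply: eq_Rintegral => x _.
by rewrite /F /= RintegralZl.
Qed.

Lemma cos_prod (t a b : R) :
  \int[(m1 \x m2)%E]_z cos (t * (a * z.1 + b * z.2)) =
  costr m1 (t * a) * costr m2 (t * b) - sintr m1 (t * a) * sintr m2 (t * b).
Proof.
transitivity (\int[(m1 \x m2)%E]_z (cos (t * a * z.1) * cos (t * b * z.2) -
    sin (t * a * z.1) * sin (t * b * z.2))).
  by apply: eq_Rintegral => z _; rewrite -cosD; congr cos; ring.
have [i1 e1] := @Rintegral_prod_mul (fun x => cos (t * a * x)) (fun x => cos (t * b * x))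
  (fun x => cos_norm_le1 _) ltac:(meas) (fun x => cos_norm_le1 _) ltac:(meas).
have [i2 e2] := @Rintegral_prod_mul (fun x => sin (t * a * x)) (fun x => sin (t * b * x))
  (fun x => sin_norm_le1 _) ltac:(meas) (fun x => sin_norm_le1 _) ltac:(meas).
by rewrite RintegralB// e1 e2.
Qed.

Lemma sin_prod (t a b : R) :
  \int[(m1 \x m2)%E]_z sin (t * (a * z.1 + b * z.2)) =
  sintr m1 (t * a) * costr m2 (t * b) + costr m1 (t * a) * sintr m2 (t * b).
Proof.
transitivity (\int[(m1 \x m2)%E]_z (sin (t * a * z.1) * cos (t * b * z.2) +
    cos (t * a * z.1) * sin (t * b * z.2))).
  by apply: eq_Rintegral => z _; rewrite -sinD; congr sin; ring.
have [i1 e1] := @Rintegral_prod_mul (fun x => sin (t * a * x)) (fun x => cos (t * b * x))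
  (fun x => sin_norm_le1 _) ltac:(meas) (fun x => cos_norm_le1 _) ltac:(meas).
have [i2 e2] := @Rintegral_prod_mul (fun x => cos (t * a * x)) (fun x => sin (t * b * x))
  (fun x => cos_norm_le1 _) ltac:(meas) (fun x => sin_norm_le1 _) ltac:(meas).
by rewrite RintegralD// e1 e2.
Qed.

Lemma ex_convolution : exists m : {finite_measure set R -> \bar R},
  [/\ forall t, costr m t = costr m1 t * costr m2 t - sintr m1 t * sintr m2 t,
      forall t, sintr m t = sintr m1 t * costr m2 t + costr m1 t * sintr m2 t
    & forall s, laplace m s = (laplace m1 s * laplace m2 s)%E].
Proof.
pose f (z : R * R) := 1 * z.1 + 1 * z.2.
have mf : measurable_fun setT f by meas.
have i1 : L1 (m1 \x m2)%E (fun=> 1).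
  apply: (@L1_prod _ _ _ _ _ m1 m2 (fun=> 1) (cst 1) (cst 1)) => //.
  - exact: finite_measure_integrable_cst.
  - exact: finite_measure_integrable_cst.
  - by move=> x y /=; rewrite normr1 mulr1.
have [m [_ mh]] := ex_image_measure (fun=> ler01) i1 mf.
have ib (h : R -> R) : measurable_fun setT h -> (forall x, `|h x| <= 1) ->
    \int[m]_x h x = \int[(m1 \x m2)%E]_z h (f z).
  move=> mh' h1; have [_] := mh h mh'.
  have e : (fun z => h (f z) * 1) = (fun z => h (f z)) by apply/funext => z; rewrite mulr1.
  rewrite e => H; apply: (H _).2; apply: (L1_dom _ i1) => //.
  exact: measurableT_comp.
exists m; split => [t|t|s].
- rewrite {1}/costr -[LHS]/(\int[m]_x cos (t * x)) ib; [|by meas|].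
    by rewrite /f cos_prod !mulr1.
  by move=> x; exact: cos_norm_le1.
- rewrite {1}/sintr -[LHS]/(\int[m]_x sin (t * x)) ib; [|by meas|].
    by rewrite /f sin_prod !mulr1.
  by move=> x; exact: sin_norm_le1.
- have me : measurable_fun setT (fun x : R => expR (- (s * x))) by meas.
  have [h1 _] := mh _ me; rewrite {1}/laplace h1; last by move=> x; exact: expR_ge0.
  rewrite -[RHS](_ : laplace m1 (s * 1) * laplace m2 (s * 1) = _)%E; last by rewrite !mulr1.
  by rewrite -laplace_prod; apply: eq_integral => z _; rewrite mulr1.
Qed.

End products.

End laws.

(** * Transforms of sums of independent variables *)

Section independent_sums.
Context (R : realType) d (T : measurableType d) (P : probability T R) (q : nat).
Variables (psi : 'I_q -> R) (Z : 'I_q -> {RV P >-> R}).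
Hypothesis indepZ : independent_RVs Z.

Definition partial_sum (k : nat) : {RV P >-> R} :=
  \sum_(j < q | (j < k)%N) psi j *: Z j.

Lemma partial_sum0 (w : T) : partial_sum 0 w = 0.
Proof. by rewrite /partial_sum big_pred0. Qed.

Lemma partial_sum_all : partial_sum q = \sum_(j < q) psi j *: Z j.
Proof. by apply: eq_bigl => j; rewrite ltn_ord. Qed.

(** The factor [1] gives the sum the shape [a * z.1 + b * z.2] of the product formulas. *)
Lemma partial_sumS (k : 'I_q) (w : T) :
  partial_sum k.+1 w = 1 * partial_sum k w + psi k * Z k w.
Proof.
rewrite /partial_sum (bigD1 k)//= addrC mul1r.
rewrite -[RHS]/((\sum_(j < q | (j < k)%N) psi j *: Z j + psi k *: Z k : {RV P >-> R}) w).
rewrite (eq_bigl (fun j : 'I_q => (j < k)%N))// => j.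
by rewrite ltnS [(j < k)%N]ltn_neqAle andbC.
Qed.

Let cyl (A : 'I_q -> set R) : set T := [set w | forall j : 'I_q, A j (Z j w)].

Let measurable_cyl A : (forall j, measurable (A j)) -> measurable (cyl A).
Proof.
move=> mA; rewrite (_ : cyl A = \bigcap_(j in [set: 'I_q]) (Z j @^-1` A j)).
  apply: fin_bigcap_measurable => // j _; rewrite -[X in measurable X]setTI.
  exact: measurable_funPT.
by apply/seteqP; split => w; [move=> h j _; exact: h|move=> h j; exact: h].
Qed.

Let pair (k : 'I_q) (w : T) : R * R := (partial_sum k w, Z k w).

Let mpair k : measurable_fun setT (pair k).
Proof. by apply: measurable_fun_pair; exact: measurable_funPT. Qed.

Let preim_measurable (X : {RV P >-> R}) (B : set R) : measurable B ->
  measurable (X @^-1` B).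
Proof. by move=> mB; rewrite -[X in measurable X]setTI; exact: measurable_funPT. Qed.

Let preim_pair_measurable k (G : set (R * R)) : measurable G ->
  measurable (pair k @^-1` G).
Proof. by move=> mG; rewrite -[X in measurable X]setTI; exact: mpair. Qed.

(** Joint independence of the partial sum from all the later variables, not just the next one, is
    what makes the induction go through; the coordinates already summed carry the full space. *)
Let independent_partial_sum (k : nat) : (k <= q)%N ->
  forall (B : set R) (A : 'I_q -> set R), measurable B ->
  (forall j, measurable (A j)) -> (forall j : 'I_q, (j < k)%N -> A j = setT) ->
  P (partial_sum k @^-1` B `&` cyl A) =
  (P (partial_sum k @^-1` B) * \prod_(j < q) P (Z j @^-1` A j))%E.
Proof.
elim: k => [|k ih] kq B A mB mA AT.
  have [B0|B0] := pselect (B 0).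
    have -> : partial_sum 0 @^-1` B = setT.
      by apply/seteqP; split => w //= _; rewrite partial_sum0.
    by rewrite setTI probability_setT mul1e; exact: indepZ.
  have -> : partial_sum 0 @^-1` B = set0.
    by apply/seteqP; split => w //=; rewrite partial_sum0.
  by rewrite set0I measure0 mul0e.
pose o : 'I_q := Ordinal kq.
(* On a rectangle the event has again the inductive form: [C] is placed at coordinate [k], where [D]
   is the full space. *)
have claim (D : 'I_q -> set R) (X C : set R) : (forall j, measurable (D j)) ->
    (forall j : 'I_q, (j < k.+1)%N -> D j = setT) -> measurable X -> measurable C ->
    P (pair o @^-1` (X `*` C) `&` cyl D) =
    ((\prod_(j < q) P (Z j @^-1` D j)) * P (partial_sum k @^-1` X) *
     P (Z o @^-1` C))%E.
  move=> mD DT mX mC; pose A' j := if j == o then C else D j.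
  have -> : pair o @^-1` (X `*` C) `&` cyl D = partial_sum k @^-1` X `&` cyl A'.
    apply/seteqP; split => w; rewrite /pair /cyl /A' /=.
      by move=> [[Xw Cw] Aw]; split => // j; case: eqP => [->|].
    move=> [Xw Aw]; split.
      by split => //; have := Aw o; rewrite eqxx.
    move=> j; have := Aw j; case: eqP => // -> _.
    by rewrite DT.
  rewrite ih//; last 3 first.
  - exact: ltnW.
  - by move=> j; rewrite /A'; case: eqP.
  - move=> j jk; rewrite /A'; case: eqP => [jo|_].
      by move: jk; rewrite jo ltnn.
    by apply: DT; exact: ltnW.
  rewrite (bigD1 o)//= [in RHS](bigD1 o)//= /A' eqxx.
  have -> : P (Z o @^-1` D o) = 1%E by rewrite DT// preimage_setT probability_setT.
  rewrite (eq_bigr (fun j => P (Z j @^-1` D j))); last by move=> j /negbTE ->.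
  by rewrite mul1e -[RHS]muleA [RHS]muleC -muleA.
have claim0 (X C : set R) : measurable X -> measurable C ->
    P (pair o @^-1` (X `*` C)) = (P (partial_sum k @^-1` X) * P (Z o @^-1` C))%E.
  move=> mX mC; have := @claim (fun=> setT) X C (fun=> measurableT) (fun _ _ => erefl) mX mC.
  rewrite big1 ?mul1e; last by move=> j _; rewrite preimage_setT probability_setT.
  by move=> <-; congr (P _); apply/seteqP; split => w; [|case].
pose r := fine (\prod_(j < q) P (Z j @^-1` A j))%E.
have prod_ge0 : (0 <= \prod_(j < q) P (Z j @^-1` A j))%E by apply: prode_ge0.
have prod_fin : (\prod_(j < q) P (Z j @^-1` A j))%E \is a fin_num.
  by apply: prode_fin_num => j _; apply: fin_num_measure; exact: preim_measurable.
have r0 : 0 <= r by exact: fine_ge0.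
have rE : r%:E = (\prod_(j < q) P (Z j @^-1` A j))%E by rewrite fineK.
have i1 : L1 P (\1_(cyl A)) by exact/integrable_indic/measurable_cyl.
have i2 : L1 P (cst r) by exact: finite_measure_integrable_cst.
have ind0 x : 0 <= \1_(cyl A) x :> R by [].
(* [mu1] is the law of the pair restricted to the cylinder, [mu2] the law of the pair multiplied by
   the product of the marginal probabilities. Both agree on rectangles with one product measure,
   hence everywhere, in particular on the preimage of [B] under the sum. *)
have [mu1 [mu1E _]] := ex_image_measure ind0 i1 (mpair o).
have [mu2 [mu2E _]] := ex_image_measure (fun=> r0) i2 (mpair o).
have {}mu1E G : measurable G -> mu1 G = P (pair o @^-1` G `&` cyl A).
  move=> mG; rewrite mu1E// integral_indic//; first by rewrite setIC.
  - exact: preim_pair_measurable.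
  - exact: measurable_cyl.
have {}mu2E G : measurable G -> mu2 G = (r%:E * P (pair o @^-1` G))%E.
  by move=> mG; rewrite mu2E// integral_cst//; exact: preim_pair_measurable.
have eq12 G : measurable G -> mu1 G = mu2 G.
  move=> mG; pose rk : {nonneg R} := NngNum r0.
  transitivity ((mscale rk (distribution P (partial_sum k)) \x
    distribution P (Z o))%E G).
    apply/esym/product_measure_unique => // X C mX mC.
    have e := mu1E _ (measurableX mX mC); rewrite claim// in e.
    by apply: (eq_trans e); rewrite -rE.
  apply: product_measure_unique => // X C mX mC.
  have e := mu2E _ (measurableX mX mC); rewrite claim0// muleA in e.
  exact: (eq_trans e).
pose G : set (R * R) := (fun z => 1 * z.1 + psi o * z.2) @^-1` B.
have mG : measurable G.
  have mf : measurable_fun setT (fun z : R * R => 1 * z.1 + psi o * z.2) by meas.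
  by rewrite /G -[X in measurable X]setTI; exact: mf.
have preE : partial_sum k.+1 @^-1` B = pair o @^-1` G.
  by apply/seteqP; split => w; rewrite /= /G /= (partial_sumS o).
by rewrite preE -mu1E// eq12// mu2E// muleC rE.
Qed.

(** The previous lemma with a single nontrivial coordinate shows that the pair
    [(partial_sum k, Z k)] has a product law. The nonnegative clause serves Laplace transforms, the
    bounded one Fourier transforms. *)
Lemma partial_sum_law (k : 'I_q) (h : R -> R) : measurable_fun setT h ->
  ((forall y, 0 <= h y) -> (\int[P]_w (h (partial_sum k.+1 w))%:E =
    \int[distribution P (partial_sum k) \x distribution P (Z k)]_z
      (h (1 * z.1 + psi k * z.2))%:E)%E) /\
  ((forall y, `|h y| <= 1) -> \int[P]_w h (partial_sum k.+1 w) =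
    \int[(distribution P (partial_sum k) \x distribution P (Z k))%E]_z
      h (1 * z.1 + psi k * z.2)).
Proof.
move=> mh; pose hh (z : R * R) := h (1 * z.1 + psi k * z.2).
have mhh : measurable_fun setT hh by apply: (measurableT_comp mh); meas.
have i1 : L1 P (fun=> 1) by exact: finite_measure_integrable_cst.
have [mu [muE muh]] := ex_image_measure (fun=> ler01) i1 (mpair k).
have {}muE G : measurable G -> mu G = P (pair k @^-1` G).
  by move=> mG; rewrite muE// integral_cst ?mul1e//; exact: preim_pair_measurable.
have muprod G : measurable G ->
    (distribution P (partial_sum k) \x distribution P (Z k))%E G = mu G.
  apply: product_measure_unique => X C mX mC.
  apply: (eq_trans (muE _ (measurableX mX mC))).
  pose A j := if j == k then C else setT.
  have := independent_partial_sum (ltnW (ltn_ord k)) mX (A := A).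
  have -> : (\prod_(j < q) P (Z j @^-1` A j))%E = P (Z k @^-1` C).
    rewrite (bigD1 k)//= /A eqxx big1 ?mule1// => j /negbTE ->.
    by rewrite preimage_setT probability_setT.
  move=> <-.
  - congr (P _); apply/seteqP; split => w; rewrite /pair /cyl /A /=.
      by move=> [Xw Cw]; split => // j; case: eqP => [->|].
    by move=> [Xw Aw]; split => //; have := Aw k; rewrite eqxx.
  - by move=> j; rewrite /A; case: eqP.
  - by move=> j jk; rewrite /A; case: eqP => // e; rewrite e ltnn in jk.
have [m1 m2] := muh hh mhh; split => h0.
  transitivity (\int[mu]_z (hh z)%:E)%E.
    rewrite m1; last by move=> z; exact: h0.
    by apply: eq_integral => w _; rewrite mulr1 /hh /pair /= partial_sumS.
  by apply: eq_measure_integral => G mG _; exact/esym/muprod.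
have ih : L1 P (fun w => hh (pair k w) * 1).
  apply: (L1_dom _ i1) => [|w]; last by rewrite mulr1; exact: h0.
  by apply: measurable_funM => //; exact: (measurableT_comp mhh (mpair k)).
have [_ m2'] := m2 ih.
transitivity (\int[mu]_z (hh z)).
  by rewrite m2'; apply: eq_Rintegral => w _; rewrite mulr1 /hh /pair /= partial_sumS.
by congr fine; apply: eq_measure_integral => G mG _; exact/esym/muprod.
Qed.

Lemma laplace_partial_sum (s : R) (k : nat) : (k <= q)%N ->
  (\int[P]_w (expR (- (s * partial_sum k w)))%:E =
   \prod_(j < q | (j < k)%N) laplace (distribution P (Z j)) (s * psi j))%E.
Proof.
elim: k => [_|k ih kq].
  rewrite big_pred0// -[RHS](@probability_setT _ _ _ P) -[RHS]mul1e -integral_cst//.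
  by apply: eq_integral => w _; rewrite partial_sum0 mulr0 oppr0 expR0.
pose o : 'I_q := Ordinal kq.
have me : measurable_fun setT (fun x : R => expR (- (s * x))) by meas.
have [h _] := partial_sum_law o me; have {}h := h (fun y => expR_ge0 _).
rewrite [LHS]h laplace_prod mulr1 (bigD1 o)//= muleC; congr (_ * _)%E.
rewrite (eq_bigl (fun j : 'I_q => (j < k)%N)); last first.
  by move=> j; rewrite ltnS [(j < k)%N]ltn_neqAle andbC.
rewrite -ih; last exact: ltnW.
rewrite /laplace ge0_integral_distribution//.
exact/measurable_EFinP.
Qed.

Hypothesis symZ : forall j t, sintr (distribution P (Z j)) t = 0.

Lemma fourier_partial_sum (t : R) (k : nat) : (k <= q)%N ->
  \int[P]_w cos (t * partial_sum k w) =
    \prod_(j < q | (j < k)%N) costr (distribution P (Z j)) (t * psi j) /\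
  \int[P]_w sin (t * partial_sum k w) = 0.
Proof.
elim: k => [_|k ih kq].
  rewrite big_pred0//; split.
    transitivity (\int[P]_w (1 : R)); last first.
      have e : \int[P]_w (1 : R) = 1 * fine (P setT) by exact: Rintegral_cst.
      by rewrite e probability_setT mulr1.
    by apply: eq_Rintegral => w _; rewrite partial_sum0 mulr0 cos0.
  transitivity (\int[P]_w (0 : R)); last by rewrite /Rintegral integral0.
  by apply: eq_Rintegral => w _; rewrite partial_sum0 mulr0 sin0.
pose o : 'I_q := Ordinal kq.
have mc : measurable_fun setT (fun x : R => cos (t * x)) by meas.
have ms : measurable_fun setT (fun x : R => sin (t * x)) by meas.
have [_ h] := partial_sum_law o mc; have {}h := h (fun y => cos_norm_le1 _).
have [_ g] := partial_sum_law o ms; have {}g := g (fun y => sin_norm_le1 _).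
have [ihc ihs] := ih (ltnW kq).
have dc : costr (distribution P (partial_sum k)) t = \int[P]_w cos (t * partial_sum k w).
  congr fine; rewrite integral_distribution//.
  - exact/measurable_EFinP.
  - exact: L1_cos.
have ds : sintr (distribution P (partial_sum k)) t = \int[P]_w sin (t * partial_sum k w).
  congr fine; rewrite integral_distribution//.
  - exact/measurable_EFinP.
  - exact: L1_sin.
split.
  rewrite [LHS]h cos_prod mulr1 dc ds ihc ihs mul0r subr0 [in RHS](bigD1 o)//= mulrC.
  congr (_ * _); apply: eq_bigl => j.
  by rewrite ltnS [(j < k)%N]ltn_neqAle andbC.
by rewrite [LHS]g sin_prod mulr1 ds ihs symZ mul0r mulr0 addr0.
Qed.

End independent_sums.

(** * Infinitely divisible laws *)

(* [(C + i S) n = (1 + (x + i y) / n) ^+ n] is close to [exp (x + i y)]. *)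
Section power_estimate.
Variable R : realType.
Variables (C S : nat -> R) (n : nat) (x y M : R).
Let u := x / n.+1%:R.
Let v := y / n.+1%:R.
Hypotheses (C0 : C 0%N = 1) (S0 : S 0%N = 0).
Hypothesis CS : forall k, C k.+1 = C k * (1 + u) - S k * v.
Hypothesis SS : forall k, S k.+1 = S k * (1 + u) + C k * v.
Hypotheses (x_le0 : x <= 0) (xM : `|x| <= M) (yM : `|y| <= M).

Let c k := expR (k%:R * u) * cos (k%:R * v).
Let s k := expR (k%:R * u) * sin (k%:R * v).
(** Error of one factor. The summand [expR M] comes from [1 + u - expR u], and [3 = 1 + 2] from
    [expR u (1 - cos v)] and [v - expR u sin v]. *)
Let D := (M / n.+1%:R) ^+ 2 * (expR M + 3).

Let M0 : 0 <= M. Proof. exact: le_trans xM. Qed.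
Let u_le0 : u <= 0. Proof. by rewrite mulr_le0_ge0// invr_ge0. Qed.
Let uM : `|u| <= M / n.+1%:R.
Proof. by rewrite normrM (@ger0_norm _ (_^-1)) ?invr_ge0// ler_wpM2r ?invr_ge0. Qed.
Let vM : `|v| <= M / n.+1%:R.
Proof. by rewrite normrM (@ger0_norm _ (_^-1)) ?invr_ge0// ler_wpM2r ?invr_ge0. Qed.

Let step_error : `|1 + u - expR u * cos v| + `|v - expR u * sin v| <= D.
Proof.
have hu2 : u ^+ 2 <= (M / n.+1%:R) ^+ 2.
  by apply: sqr_ler_norm; rewrite [leRHS]ger0_norm// divr_ge0.
have hv2 : v ^+ 2 <= (M / n.+1%:R) ^+ 2.
  by apply: sqr_ler_norm; rewrite [leRHS]ger0_norm// divr_ge0.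
have huv : `|v| * `|u| <= (M / n.+1%:R) ^+ 2 by rewrite expr2 ler_pM.
have eu1 : expR u <= 1 by rewrite expR_le1.
have eu0 := expR_ge0 u.
have h1 : `|1 + u - expR u| <= (M / n.+1%:R) ^+ 2 * expR M.
  have := expRN_taylor_le (- u); rewrite opprK sqrrN normrN => h.
  rewrite (_ : 1 + u - expR u = 1 - expR u + u); last by ring.
  apply: le_trans h _; apply: ler_pM; rewrite ?sqr_ge0 ?expR_ge0// ler_expR.
  apply: le_trans uM _; rewrite ler_pdivrMr//.
  by rewrite -[leLHS]mulr1 ler_wpM2l// ler1n.
have h2 : `|expR u - expR u * cos v| <= (M / n.+1%:R) ^+ 2.
  rewrite -[X in X - _]mulr1 -mulrBr normrM ger0_norm// [X in _ * X]ger0_norm ?one_sub_cos_ge0//.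
  apply: (@le_trans _ _ (1 - cos v)); first by rewrite ler_piMl ?one_sub_cos_ge0.
  apply: le_trans (one_sub_cos_le v) _; apply: le_trans hv2.
  by rewrite ler_pdivrMr// ler_peMr ?sqr_ge0// ler1n.
have h3 : `|v - expR u * sin v| <= (M / n.+1%:R) ^+ 2 * 2.
  rewrite (_ : v - _ = - (sin v - v) + sin v * (1 - expR u)); last by ring.
  rewrite (_ : (M / n.+1%:R) ^+ 2 * 2 = (M / n.+1%:R) ^+ 2 + (M / n.+1%:R) ^+ 2); last by ring.
  apply: le_trans (ler_normD _ _) _; rewrite normrN; apply: lerD.
    by apply: le_trans (sin_sub_le v) _.
  rewrite normrM; apply: le_trans huv; apply: ler_pM => //; first exact: sin_norm_le.
  rewrite ger0_norm ?subr_ge0// ler0_norm//.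
  by have := expR_ge1Dx u; lra.
have := ler_normD (1 + u - expR u) (expR u - expR u * cos v).
rewrite (_ : _ + (expR u - _) = 1 + u - expR u * cos v); last by ring.
rewrite /D mulrDr; move: h1 h2 h3.
set t1 := `|_|; set t2 := `|_|; set t3 := `|_|; set t4 := `|_|.
set m2 := (_ ^+ 2); set e2 := _ * expR M; lra.
Qed.

Let ck k : `|c k| <= 1.
Proof.
rewrite normrM -[leRHS]mulr1; apply: ler_pM => //; last exact: cos_norm_le1.
by rewrite ger0_norm ?expR_ge0// expR_le1 mulr_ge0_le0.
Qed.

Let sk k : `|s k| <= 1.
Proof.
rewrite normrM -[leRHS]mulr1; apply: ler_pM => //; last exact: sin_norm_le1.
by rewrite ger0_norm ?expR_ge0// expR_le1 mulr_ge0_le0.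
Qed.

(** The error [e_k] satisfies [e_(k+1) <= (1 + 2 M / (n + 1)) e_k + 2 D]: the step expands the sum
    of absolute values by at most that factor, and [|c k|], [|s k|] are at most [1] because
    [u <= 0]. *)
Let error k : `|C k - c k| + `|S k - s k| <=
  k%:R * (2 * D) * (1 + 2 * (M / n.+1%:R)) ^+ k.
Proof.
have Mn0 : 0 <= M / n.+1%:R by rewrite divr_ge0.
have D0 : 0 <= D by rewrite mulr_ge0 ?sqr_ge0// addr_ge0// expR_ge0.
elim: k => [|k ih].
  by rewrite C0 S0 /c /s !mul0r expR0 cos0 sin0 mul1r subrr mul1r subrr normr0 addr0.
pose e1 := 1 + u - expR u * cos v; pose e2 := v - expR u * sin v.
have -> : C k.+1 - c k.+1 = (C k - c k) * (1 + u) - (S k - s k) * v + (c k * e1 - s k * e2).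
  rewrite CS /c /s -natr1 !mulrDl !mul1r expRD cosD /e1 /e2; ring.
have -> : S k.+1 - s k.+1 = (S k - s k) * (1 + u) + (C k - c k) * v + (s k * e1 + c k * e2).
  rewrite SS /c /s -natr1 !mulrDl !mul1r expRD sinD /e1 /e2; ring.
have hu : `|1 + u| <= 1 + M / n.+1%:R by rewrite (le_trans (ler_normD _ _))// normr1 lerD2l.
have b1 : `|(C k - c k) * (1 + u) - (S k - s k) * v| + `|(S k - s k) * (1 + u) + (C k - c k) * v|
    <= (`|C k - c k| + `|S k - s k|) * (1 + 2 * (M / n.+1%:R)).
  have := ler_normB ((C k - c k) * (1 + u)) ((S k - s k) * v).
  have := ler_normD ((S k - s k) * (1 + u)) ((C k - c k) * v).
  rewrite !(normrM (C k - c k)) !(normrM (S k - s k)).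
  have := ler_wpM2l (normr_ge0 (C k - c k)) hu; have := ler_wpM2l (normr_ge0 (S k - s k)) hu.
  have := ler_wpM2l (normr_ge0 (C k - c k)) vM; have := ler_wpM2l (normr_ge0 (S k - s k)) vM.
  set m := M / _; set p1 := `|C k - c k|; set p2 := `|S k - s k|.
  rewrite !mulrDr !mulrDl; lra.
have b2 : `|c k * e1 - s k * e2| + `|s k * e1 + c k * e2| <= 2 * D.
  have h := step_error; rewrite -/e1 -/e2 in h.
  have := ler_normB (c k * e1) (s k * e2); have := ler_normD (s k * e1) (c k * e2).
  rewrite !(normrM (c k)) !(normrM (s k)).
  have := ler_wpM2r (normr_ge0 e1) (ck k); have := ler_wpM2r (normr_ge0 e2) (sk k).
  have := ler_wpM2r (normr_ge0 e1) (sk k); have := ler_wpM2r (normr_ge0 e2) (ck k).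
  lra.
have q1 : 1 <= 1 + 2 * (M / n.+1%:R) by rewrite lerDl mulr_ge0.
have qk : 1 <= (1 + 2 * (M / n.+1%:R)) ^+ k.+1 by rewrite exprn_ege1.
apply: (@le_trans _ _ ((`|C k - c k| + `|S k - s k|) * (1 + 2 * (M / n.+1%:R)) + 2 * D)).
  apply: le_trans (lerD (ler_normD _ _) (ler_normD _ _)) _.
  by rewrite addrACA; exact: lerD.
have := ler_wpM2r (le_trans ler01 q1) ih.
set p := 1 + 2 * _ in q1 qk *.
have -> : k%:R * (2 * D) * p ^+ k * p = k%:R * (2 * D) * p ^+ k.+1 by rewrite exprSr -!mulrA.
have -> : k.+1%:R * (2 * D) * p ^+ k.+1 = k%:R * (2 * D) * p ^+ k.+1 + 2 * D * p ^+ k.+1.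
  by rewrite -natr1; ring.
move=> h; apply: lerD => //.
by rewrite -[leLHS]mulr1 ler_wpM2l// mulr_ge0.
Qed.

Lemma power_estimate :
  `|C n.+1 - expR x * cos y| + `|S n.+1 - expR x * sin y| <=
  2 * M ^+ 2 * (expR M + 3) * expR (2 * M) / n.+1%:R.
Proof.
have := error n.+1.
rewrite /c /s (_ : n.+1%:R * u = x); last by rewrite /u mulrC divfK.
rewrite (_ : n.+1%:R * v = y); last by rewrite /v mulrC divfK.
move=> /le_trans; apply.
have D0 : 0 <= D by rewrite mulr_ge0 ?sqr_ge0// addr_ge0// expR_ge0.
(* [(1 + 2 M / (n + 1)) ^ (n + 1) <= expR (2 M)]; the square in [D] then leaves one factor
   [1 / (n + 1)]. *)
apply: (@le_trans _ _ (n.+1%:R * (2 * D) * expR (2 * M))).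
  rewrite ler_wpM2l ?mulr_ge0//.
  have -> : expR (2 * M) = expR (2 * (M / n.+1%:R)) ^+ n.+1.
    by rewrite -expRM_natl; congr expR; field; rewrite addrC natr1 pnatr_eq0.
  rewrite lerXn2r ?nnegrE ?expR_ge0 ?expR_ge1Dx//.
  by rewrite addr_ge0// mulr_ge0// divr_ge0.
rewrite le_eqVlt; apply/orP; left; apply/eqP; rewrite /D.
by field; rewrite addrC natr1 pnatr_eq0.
Qed.

End power_estimate.

Lemma cvg_sub0 (R : realType) (f g : nat -> R) (l : R) :
  f n - g n @[n --> \oo] --> (0 : R) -> g n @[n --> \oo] --> l ->
  f n @[n --> \oo] --> l.
Proof.
move=> h1 h2; have e : (fun n => f n - g n) + g = f by apply/funext => n; rewrite !fctE subrK.
by have := cvgD h1 h2; rewrite add0r e; apply.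
Qed.

(** * Compound Poisson approximation *)

Section compound_poisson.
Variable R : realType.
Implicit Types m nu : {finite_measure set R -> \bar R}.

Lemma ex_sum_measure (c1 c2 : R) m1 m2 : 0 <= c1 -> 0 <= c2 ->
  exists m, forall h : R -> R, L1 m1 h -> L1 m2 h ->
    L1 m h /\ \int[m]_x h x = c1 * \int[m1]_x h x + c2 * \int[m2]_x h x.
Proof.
move=> c10 c20.
have w0 (c : R) (x : R) : 0 <= c -> 0 <= (fun=> c) x by [].
have i1 (m : {finite_measure set R -> \bar R}) (c : R) : L1 m (fun=> c).
  exact: finite_measure_integrable_cst.
have [n1 [_ n1h]] := ex_image_measure (fun x => w0 c1 x c10) (i1 m1 c1) (@measurable_id _ R setT).
have [n2 [_ n2h]] := ex_image_measure (fun x => w0 c2 x c20) (i1 m2 c2) (@measurable_id _ R setT).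
have add_int (h : R -> R) : L1 n1 h -> L1 n2 h -> L1 (measure_add n1 n2) h /\
   \int[measure_add n1 n2]_x h x = \int[n1]_x h x + \int[n2]_x h x.
  move=> h1 h2; have mh := L1_measurable h1; split.
    apply/integrableP; split; first exact/measurable_EFinP.
    rewrite ge0_integral_measure_add//; last by apply/measurable_EFinP; meas.
    by apply: lte_add_pinfty; apply: L1_lty; exact: L1_norm.
  apply: EFin_inj; rewrite EFinD !L1K//.
    by rewrite integral_measure_add//; exact/measurable_EFinP.
  apply/integrableP; split; first exact/measurable_EFinP.
  rewrite ge0_integral_measure_add//; last by apply/measurable_EFinP; meas.
  by apply: lte_add_pinfty; apply: L1_lty; exact: L1_norm.
have [ia _] := add_int (fun=> 1) (i1 n1 1) (i1 n2 1).
(* The sum measure is passed through the identity map with weight [1], which returns it as a finite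
   measure. *)
have [m [_ mh]] := ex_image_measure (fun=> ler01) ia (@measurable_id _ R setT).
exists m => h h1 h2; have meh := L1_measurable h1.
have hc (c : R) : (fun x => h x * c) = (fun x => c * h x).
  by apply/funext => x; rewrite mulrC.
have [_] := n1h h meh; rewrite hc => /(_ (L1Z c1 h1))[k1 e1].
have [_] := n2h h meh; rewrite hc => /(_ (L1Z c2 h2))[k2 e2].
have [ka ea] := add_int h k1 k2.
have [_] := mh h meh.
rewrite (_ : (fun x => h x * 1) = h); last by apply/funext => x; rewrite mulr1.
move=> /(_ ka)[-> ->]; split => //.
by rewrite ea e1 e2 !RintegralZl.
Qed.

Lemma Rintegral_dirac (a : R) (h : R -> R) : measurable_fun setT h ->
  L1 (\d_a) h /\ \int[\d_a]_x h x = h a.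
Proof.
move=> mh; split.
  apply/integrableP; split; first exact/measurable_EFinP.
  rewrite integral_dirac//; last by apply: measurableT_comp => //; exact/measurable_EFinP.
  by rewrite diracT mul1e ltry.
by rewrite /Rintegral integral_dirac ?diracT ?mul1e//; exact/measurable_EFinP.
Qed.

Lemma laplace_dirac0 (l : R) : laplace (\d_(0 : R)) l = 1%E.
Proof.
rewrite /laplace integral_dirac ?diracT ?mul1e ?mulr0 ?oppr0 ?expR0//.
by apply/measurable_EFinP; meas.
Qed.

Lemma ex_convolution_power m (n : nat) : exists rho : nat -> {finite_measure set R -> \bar R},
  forall t, [/\ costr (rho 0%N) t = 1, sintr (rho 0%N) t = 0,
    forall k, costr (rho k.+1) t = costr (rho k) t * costr m t - sintr (rho k) t * sintr m t,
    forall k, sintr (rho k.+1) t = sintr (rho k) t * costr m t + costr (rho k) t * sintr m t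
  & forall k, laplace (rho k) t = (laplace m t ^+ k)%E].
Proof.
have ex (m0 : {finite_measure set R -> \bar R}) := ex_convolution m0 m.
have [f hf] := choice ex.
pose rho := fix rho k : {finite_measure set R -> \bar R} :=
  if k is k'.+1 then f (rho k') else \d_(0 : R).
exists rho => t; split.
- have mc : measurable_fun setT (fun x : R => cos (t * x)) by meas.
  by have [_ e] := Rintegral_dirac 0 mc; rewrite -[LHS]/(\int[\d_(0 : R)]_x cos (t * x))
    e mulr0 cos0.
- have ms : measurable_fun setT (fun x : R => sin (t * x)) by meas.
  by have [_ e] := Rintegral_dirac 0 ms; rewrite -[LHS]/(\int[\d_(0 : R)]_x sin (t * x))
    e mulr0 sin0.
- by move=> k; have [+ _ _] := hf (rho k); apply.
- by move=> k; have [_ + _] := hf (rho k); apply.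
- elim => [|k ih]; first by rewrite expe0 laplace_dirac0.
  by have [_ _ /(_ t) e] := hf (rho k); rewrite [LHS]e ih expeS muleC.
Qed.

(** The measure [(1 - |nu| / (N + 1)) delta_0 + nu / (N + 1)], with [|nu|] the mass of [nu]: a rare
    jump. The bound on the mass keeps the first coefficient nonnegative. *)
Lemma ex_poisson_step nu (N : nat) : fine (nu setT) <= N.+1%:R ->
  exists m, forall h : R -> R, measurable_fun setT h -> L1 nu h ->
    L1 m h /\ \int[m]_x h x = h 0 + \int[nu]_x (h x - h 0) / N.+1%:R.
Proof.
move=> nuN; have N0 : (0 : R) < N.+1%:R by rewrite ltr0n.
have c1 : 0 <= 1 - fine (nu setT) / N.+1%:R by rewrite subr_ge0 ler_pdivrMr// mul1r.
have c2 : 0 <= N.+1%:R^-1 :> R by rewrite invr_ge0.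
have [m mh] := @ex_sum_measure _ _ (\d_(0 : R)) nu c1 c2.
exists m => h meh hi; have [d1 d2] := Rintegral_dirac 0 meh.
have [? ->] := mh h d1 hi; split => //.
rewrite d2 RintegralB//; last exact: finite_measure_integrable_cst.
by rewrite Rintegral_cst//; field; rewrite addrC natr1 pnatr_eq0.
Qed.

(** [rho n] is a high convolution power of a rare jump governed by [nu_ n]; its transform is a power
    of [1 + z / N], compared with [exp z]. For Laplace transforms the inequality
    [(1 + z / N) ^ N <= exp z] gives a bound valid for each [n], not only in the limit. *)
Lemma ex_poisson_limit (nu_ : nat -> {finite_measure set R -> \bar R}) (A B : R -> R) :
  (forall t, \int[nu_ n]_x (cos (t * x) - 1) @[n --> \oo] --> A t) ->
  (forall t, \int[nu_ n]_x sin (t * x) @[n --> \oo] --> B t) ->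
  exists rho : nat -> {finite_measure set R -> \bar R},
  [/\ forall t, costr (rho n) t @[n --> \oo] --> expR (A t) * cos (B t),
      forall t, sintr (rho n) t @[n --> \oo] --> expR (A t) * sin (B t)
    & forall n l, L1 (nu_ n) (fun x => expR (- (l * x))) ->
        (laplace (rho n) l <= (expR (\int[nu_ n]_x (expR (- (l * x)) - 1)))%:E)%E].
Proof.
move=> hA hB.
(* At least [n], so that the approximation error tends to [0], and at least the mass of [nu_ n], so
   that the jump measure exists. *)
pose N n := maxn n (Num.bound (fine (nu_ n setT))).
have nuN n : fine (nu_ n setT) <= (N n).+1%:R.
  have nu0 : 0 <= fine (nu_ n setT) by exact: fine_ge0.
  apply: le_trans (ltW (archi_boundP nu0)) _; rewrite ler_nat.
  by rewrite leqW// leq_maxr.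
have [pi hpi] := choice (fun n => ex_poisson_step (nuN n)).
have [rho hrho] := choice (fun n => ex_convolution_power (pi n) 0).
exists (fun n => rho n (N n).+1).
pose X n t := \int[nu_ n]_x (cos (t * x) - 1).
pose Y n t := \int[nu_ n]_x sin (t * x).
have cpi n t : costr (pi n) t = 1 + X n t / (N n).+1%:R.
  have mc : measurable_fun setT (fun x : R => cos (t * x)) by meas.
  have [_ e] := hpi n _ mc (@L1_cos _ _ _ (nu_ n) id (@measurable_id _ _ _) t).
  rewrite -[LHS]/(\int[pi n]_x cos (t * x)) e mulr0 cos0; congr (_ + _ / _).
have spi n t : sintr (pi n) t = Y n t / (N n).+1%:R.
  have ms : measurable_fun setT (fun x : R => sin (t * x)) by meas.
  have [_ e] := hpi n _ ms (@L1_sin _ _ _ (nu_ n) id (@measurable_id _ _ _) t).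
  rewrite -[LHS]/(\int[pi n]_x sin (t * x)) e mulr0 sin0 add0r; congr (_ / _).
  by apply: eq_Rintegral => x _; rewrite subr0.
have X0 n t : X n t <= 0.
  rewrite /X -oppr_ge0 -[X in 0 <= X]mulN1r -RintegralZl//; last first.
    apply: L1B; first exact: (@L1_cos _ _ _ (nu_ n) id (@measurable_id _ _ _) t).
    exact: finite_measure_integrable_cst.
  by apply: Rintegral_ge0 => x _; have := one_sub_cos_ge0 (t * x); lra.
have main t : (costr (rho n (N n).+1) t - expR (X n t) * cos (Y n t) @[n --> \oo] --> (0 : R))
  /\ (sintr (rho n (N n).+1) t - expR (X n t) * sin (Y n t) @[n --> \oo] --> (0 : R)).
  have [M M0 XM] : exists2 M : R, 0 < M & forall n, `|X n t| <= M.
    have : cvgn (fun n => X n t) by apply/cvg_ex; eexists; exact: hA.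
    by move=> /cvg_seq_bounded/pinfty_ex_gt0[M ? hM]; exists M => // n; exact: hM.
  have [M' M'0 YM] : exists2 M : R, 0 < M & forall n, `|Y n t| <= M.
    have : cvgn (fun n => Y n t) by apply/cvg_ex; eexists; exact: hB.
    by move=> /cvg_seq_bounded/pinfty_ex_gt0[M'' ? hM]; exists M'' => // n; exact: hM.
  pose Q := M + M'.
  pose K := 2 * Q ^+ 2 * (expR Q + 3) * expR (2 * Q).
  have K0 : 0 <= K.
    apply: mulr_ge0; last exact: expR_ge0.
    by apply: mulr_ge0; [rewrite mulr_ge0// sqr_ge0|rewrite addr_ge0// expR_ge0].
  have est n : `|costr (rho n (N n).+1) t - expR (X n t) * cos (Y n t)| +
      `|sintr (rho n (N n).+1) t - expR (X n t) * sin (Y n t)| <= K / n.+1%:R.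
    have [r1 r2 r3 r4 _] := hrho n t.
    apply: (@le_trans _ _ (K / (N n).+1%:R)); last first.
      rewrite ler_wpM2l// lef_pV2 ?posrE// ler_nat ltnS; exact: leq_maxl.
    apply: (@power_estimate _ (fun k => costr (rho n k) t) (fun k => sintr (rho n k) t)).
    - exact: r1.
    - exact: r2.
    - by move=> k; rewrite r3 cpi spi.
    - by move=> k; rewrite r4 cpi spi.
    - exact: X0.
    - by apply: le_trans (XM n) _; rewrite lerDl ltW.
    - by apply: le_trans (YM n) _; rewrite lerDr ltW.
  have K_lim : K / n.+1%:R @[n --> \oo] --> (0 : R).
    by rewrite -(mulr0 K); apply: cvgM; [exact: cvg_cst|exact: cvg_harmonic].
  split; apply/norm_cvg0P.
    apply: (@squeeze_cvgr _ _ _ _ (cst 0) (fun n => K / n.+1%:R)) => //; last exact: cvg_cst.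
    by apply: nearW => n; rewrite normr_ge0/= (le_trans _ (est n))// lerDl.
  apply: (@squeeze_cvgr _ _ _ _ (cst 0) (fun n => K / n.+1%:R)) => //; last exact: cvg_cst.
  by apply: nearW => n; rewrite normr_ge0/= (le_trans _ (est n))// lerDr.
have expX t : expR (X n t) @[n --> \oo] --> expR (A t).
  exact: (cvg_comp (fun n => X n t) expR (hA t) (@continuous_expR R (A t))).
split.
- move=> t; have [h _] := main t.
  have h2 : expR (X n t) * cos (Y n t) @[n --> \oo] --> expR (A t) * cos (B t).
    apply: cvgM => //.
    exact: (cvg_comp (fun n => Y n t) cos (hB t) (@continuous_cos R (B t))).
  exact: cvg_sub0 h h2.
- move=> t; have [_ h] := main t.
  have h2 : expR (X n t) * sin (Y n t) @[n --> \oo] --> expR (A t) * sin (B t).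
    apply: cvgM => //.
    exact: (cvg_comp (fun n => Y n t) sin (hB t) (@continuous_sin R (B t))).
  exact: cvg_sub0 h h2.
- move=> n l hl; have [_ _ _ _ ->] := hrho n l.
  have me : measurable_fun setT (fun x : R => expR (- (l * x))) by meas.
  have [ie e] := hpi n _ me hl.
  rewrite mulr0 oppr0 expR0 in e; rewrite /laplace -L1K// e.
  have z1 : 0 <= \int[pi n]_x expR (- (l * x)).
    by apply: Rintegral_ge0 => x _; exact: expR_ge0.
  rewrite e in z1; move: z1; set z := \int[nu_ n]_x _ => z1.
  have -> : (((1 + z / (N n).+1%:R)%:E) ^+ (N n).+1)%E = ((1 + z / (N n).+1%:R) ^+ (N n).+1)%:E.
    by rewrite EFin_expe.
  rewrite lee_fin.
  have -> : expR z = expR (z / (N n).+1%:R) ^+ (N n).+1.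
    by rewrite -expRM_natl; congr expR; rewrite mulrC divfK.
  by rewrite lerXn2r ?nnegrE ?expR_ge0 ?expR_ge1Dx.
Qed.

End compound_poisson.

Lemma L1_ae d (T : measurableType d) (R : realType) (nu : {measure set T -> \bar R})
    (f g : T -> R) (N : set T) : measurable_fun setT f -> measurable N ->
  nu N = 0%E -> L1 nu g -> (forall x, ~ N x -> f x = g x) ->
  L1 nu f /\ \int[nu]_x f x = \int[nu]_x g x.
Proof.
move=> mf mN N0 gi fg.
have ae : ae_eq nu setT (EFin \o f) (EFin \o g).
  exists N; split=> // x /= /not_implyP[_ nfg]; apply: contrapT => nN.
  by apply: nfg; rewrite fg.
have mfE : measurable_fun setT (EFin \o f) by exact/measurable_EFinP.
have mgE : measurable_fun setT (EFin \o g) by exact: measurable_int gi.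
have ae' : ae_eq nu setT (fun x => `|(f x)%:E|)%E (fun x => `|(g x)%:E|)%E.
  exists N; split=> // x /= /not_implyP[_ nfg]; apply: contrapT => nN.
  by apply: nfg; rewrite fg.
split; last by rewrite /Rintegral; congr fine; apply: ae_eq_integral.
apply/integrableP; split => //.
rewrite (ae_eq_integral (fun x => `|(g x)%:E|)%E)//; [|exact: measurableT_comp..].
by have /integrableP[] := gi.
Qed.

(** * Levy-Khintchine exponents as limits of finite jump measures *)

Section levy_approximation.
Variables (R : realType) (nu : {measure set R -> \bar R}) (b s : R).
Let m x : R := Num.min 1 (x ^+ 2).
Hypotheses (s_ge0 : 0 <= s) (mi : L1 nu m).

Let m_ge0 x : 0 <= m x. Proof. by rewrite le_min ler01 sqr_ge0. Qed.
Let mm : measurable_fun setT m.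
Proof. by apply: measurable_minr; [exact: measurable_cst|meas]. Qed.

(** A cut-off near [0]: it is integrable against [nu], vanishes at [0], and equals [1] for large [n]
    at every other point. *)
Let w n x : R := Num.min 1 (n%:R * m x).
Let w_ge0 n x : 0 <= w n x. Proof. by rewrite le_min ler01 mulr_ge0. Qed.
Let w_le1 n x : w n x <= 1. Proof. by rewrite ge_min lexx. Qed.
Let mw n : measurable_fun setT (w n).
Proof. by apply: measurable_minr; [exact: measurable_cst|meas]. Qed.
Let wi n : L1 nu (w n).
Proof.
apply: (@L1_dom _ _ _ _ _ (fun x => n%:R * m x)) => //; first exact: L1Z.
by move=> x; rewrite ger0_norm// ge_min lexx orbT.
Qed.

Let w_cvg (f : R -> R) x : f 0 = 0 -> f x * w n x @[n --> \oo] --> f x.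
Proof.
move=> f0; have [->|x0] := eqVneq x 0.
  by rewrite f0 (_ : (fun n => _) = fun=> 0); [exact: cvg_cst|apply/funext => n; rewrite mul0r].
have m0 : 0 < m x by rewrite lt_min ltr01 exprn_even_gt0.
apply: cvg_near_cst.
near=> n; rewrite (_ : w n x = 1) ?mulr1//.
apply/min_idPl; rewrite -ler_pdivrMr// mul1r ltW//.
near: n; exact: nbhs_infty_gtr.
Unshelve. all: by end_near. Qed.

Let w_dct (f : R -> R) (C : R) : measurable_fun setT f -> f 0 = 0 ->
  (forall x, `|f x| <= C * m x) ->
  L1 nu f /\ \int[nu]_x (f x * w n x) @[n --> \oo] --> \int[nu]_x f x.
Proof.
move=> mf f0 fC; apply: (@Rintegral_dct _ _ _ _ _ _ (fun x => C * m x)).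
- by move=> n; exact: measurable_funM.
- exact: L1Z.
- move=> n x; rewrite normrM; apply: le_trans (fC x).
  by rewrite ler_piMr// ger0_norm.
- by move=> x; exact: w_cvg.
Qed.

Let trunc x : R := x * \1_(`[-1, 1]) x.
Let mtrunc : measurable_fun setT trunc.
Proof. by apply: measurable_funM; [exact: measurable_id|exact: measurable_indic]. Qed.

Lemma levy_truncE x : (x ^+ 2 <= 1 /\ trunc x = x /\ m x = x ^+ 2) \/
               (1 < x ^+ 2 /\ 1 < `|x| /\ trunc x = 0 /\ m x = 1).
Proof.
have [x1|x1] := leP (x ^+ 2) 1; [left|right]; split=> //.
  split; last exact/min_idPr.
  rewrite /trunc indicE mem_set ?mulr1//= in_itv/= -ler_norml.
  by rewrite -(@ler_pXn2r _ 2) ?nnegrE// expr1n real_normK ?num_real//.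
have x1' : 1 < `|x| by rewrite -(@ltr_pXn2r _ 2) ?nnegrE// expr1n real_normK ?num_real//.
split=> //; split; last by apply/min_idPl/ltW.
by rewrite /trunc indicE memNset ?mulr0//= in_itv/= -ler_norml leNgt x1'.
Qed.

Lemma levy_cos_bound t x : `|cos (t * x) - 1| <= (2 + t ^+ 2) * m x.
Proof.
rewrite distrC ger0_norm ?one_sub_cos_ge0//.
have t2 := sqr_ge0 t.
have [[x1 [_ ->]]|[x1 [_ [_ ->]]]] := levy_truncE x.
  apply: le_trans (one_sub_cos_le _) _; rewrite exprMn.
  by have := sqr_ge0 x; have := mulr_ge0 t2 (sqr_ge0 x); nra.
by have := cos_geN1 (t * x); rewrite mulr1; lra.
Qed.

Lemma levy_sin_bound t x : `|sin (t * x) - t * trunc x| <= (1 + t ^+ 2) * m x.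
Proof.
have t2 := sqr_ge0 t.
have [[x1 [-> ->]]|[x1 [_ [-> ->]]]] := levy_truncE x.
  apply: le_trans (sin_sub_le _) _; rewrite exprMn.
  by rewrite ler_wpM2r ?sqr_ge0// lerDr.
rewrite mulr0 subr0 mulr1; apply: le_trans (sin_norm_le1 _) _; lra.
Qed.

Let truncw n : L1 nu (fun x => trunc x * w n x).
Proof.
apply: (L1M_bounded (k := 1)) => // x.
have [[x1 [-> _]]|[_ [_ [-> _]]]] := levy_truncE x; last by rewrite normr0.
by rewrite -(@ler_pXn2r _ 2) ?nnegrE// expr1n real_normK ?num_real//.
Qed.

(** The drift left once the compensator of the cut-off Levy measure has been subtracted; it may
    diverge with [n]. *)
Let d n := b - \int[nu]_x (trunc x * w n x).
(** An atom of mass [M n] at [d n / M n] contributes [t * d n] to the sine integral up to an error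
    of order [d n ^ 2 / M n], and the same order to the cosine integral. This choice forces that
    quantity below [1 / (n + 1)] however large [d n] is. *)
Let M n := n.+1%:R * (1 + d n ^+ 2).

Let dM n : 0 < M n. Proof. by rewrite mulr_gt0// ltr_wpDr ?sqr_ge0. Qed.

Let dM2 n : d n ^+ 2 / M n <= n.+1%:R^-1.
Proof.
rewrite ler_pdivrMr// /M mulrA mulVf// mul1r; lra.
Qed.

(* The Levy measure is cut off near [0] by [w n]; two atoms at [+- 1 / n]
   replace the Gaussian part, and one atom of large mass [M n] near [0] the drift. *)
Let ex_approx n : exists nu_n : {finite_measure set R -> \bar R},
  forall h : R -> R, measurable_fun setT h -> L1 nu (fun x => h x * w n x) ->
  L1 nu_n h /\ \int[nu_n]_x h x = \int[nu]_x (h x * w n x) +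
    s * n.+1%:R ^+ 2 / 2 * (h (n.+1%:R^-1) + h (- n.+1%:R^-1)) + M n * h (d n / M n).
Proof.
have [m1 [_ m1h]] := ex_image_measure (w_ge0 n) (wi n) (@measurable_id _ R setT).
have c1 : 0 <= s * n.+1%:R ^+ 2 / 2 by rewrite divr_ge0// mulr_ge0// sqr_ge0.
have [m2 m2h] := ex_sum_measure (\d_(n.+1%:R^-1 : R)) (\d_(- n.+1%:R^-1 : R)) c1 c1.
have [m3 m3h] := ex_sum_measure m2 (\d_(d n / M n)) ler01 (ltW (dM n)).
have [m4 m4h] := ex_sum_measure m1 m3 ler01 ler01.
exists m4 => h mh hi.
have [_ /(_ hi)[h1 e1]] := m1h h mh.
have [l1 k1] := Rintegral_dirac n.+1%:R^-1 mh.
have [l2 k2] := Rintegral_dirac (- n.+1%:R^-1) mh.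
have [l3 k3] := Rintegral_dirac (d n / M n) mh.
have [h2 e2] := m2h h l1 l2; have [h3 e3] := m3h h h2 l3.
have [h4 ->] := m4h h h1 h3; split => //.
by rewrite e1 e3 e2 k1 k2 k3; ring.
Qed.

Let sin_scaled_cvg (y : R) : n.+1%:R * sin (y / n.+1%:R) @[n --> \oo] --> y.
Proof.
apply: (@cvg_sub0 _ _ (fun=> y)); last exact: cvg_cst.
apply/norm_cvg0P; apply: (@squeeze_cvgr _ _ _ _ (cst 0) (fun n => y ^+ 2 / n.+1%:R)).
- apply: nearW => n; rewrite normr_ge0/=.
  rewrite (_ : _ - y = n.+1%:R * (sin (y / n.+1%:R) - y / n.+1%:R)); last first.
    by field; rewrite addrC natr1 pnatr_eq0.
  rewrite normrM ger0_norm//.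
  apply: le_trans (ler_wpM2l _ (sin_sub_le _)) _ => //.
  by rewrite le_eqVlt; apply/orP; left; apply/eqP; field; rewrite addrC natr1 pnatr_eq0.
- exact: cvg_cst.
- by rewrite -(mulr0 (y ^+ 2)); apply: cvgM; [exact: cvg_cst|exact: cvg_harmonic].
Qed.

(** A second difference of the cosine at [0], put in the form of a square by
    [1 - cos x = 2 sin (x / 2) ^ 2]. *)
Let gauss_cvg (t : R) : s * n.+1%:R ^+ 2 / 2 *
  ((cos (t * n.+1%:R^-1) - 1) + (cos (t * (- n.+1%:R^-1)) - 1)) @[n --> \oo] --> - (s * t ^+ 2 / 2).
Proof.
rewrite (_ : (fun n => _) = fun n => - (2 * s) * (n.+1%:R * sin (t / 2 / n.+1%:R)) ^+ 2); last first.
  apply/funext => n; rewrite mulrN cosN.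
  have := one_sub_cosE (t * n.+1%:R^-1).
  rewrite (_ : t * n.+1%:R^-1 / 2 = t / 2 / n.+1%:R); last by rewrite mulrAC.
  move=> e; rewrite exprMn; set c := cos _ in e *; set k := sin _ in e *.
  by rewrite (_ : c = 1 - 2 * k ^+ 2); [field|rewrite -e; ring].
rewrite (_ : - (s * t ^+ 2 / 2) = - (2 * s) * (t / 2) ^+ 2); last by field.
apply: cvgM; first exact: cvg_cst.
by rewrite expr2; under eq_fun do rewrite expr2; apply: cvgM; exact: sin_scaled_cvg.
Qed.

(** The third clause is the purpose: when [nu] lives on [(0, +oo)], [expR (- l x) - 1 + l * trunc x]
    is at most [C * m x] there, so the Laplace transforms of the approximations are bounded
    uniformly in [n]. *)
Lemma ex_levy_limit : exists rho : nat -> {finite_measure set R -> \bar R},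
  [/\ forall t, costr (rho n) t @[n --> \oo] -->
        expR (- (s * t ^+ 2 / 2) + \int[nu]_x (cos (t * x) - 1)) *
        cos (b * t + \int[nu]_x (sin (t * x) - t * trunc x)),
      forall t, sintr (rho n) t @[n --> \oo] -->
        expR (- (s * t ^+ 2 / 2) + \int[nu]_x (cos (t * x) - 1)) *
        sin (b * t + \int[nu]_x (sin (t * x) - t * trunc x))
    & forall l, 0 < l -> nu (~` `]0, +oo[) = 0%E ->
        exists K, forall n, (laplace (rho n) l <= K%:E)%E].
Proof.
have [nu_ hnu] := choice ex_approx.
have mc t : measurable_fun setT (fun x : R => cos (t * x)) by meas.
have ms t : measurable_fun setT (fun x : R => sin (t * x)) by meas.
pose A t := - (s * t ^+ 2 / 2) + \int[nu]_x (cos (t * x) - 1).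
pose B t := b * t + \int[nu]_x (sin (t * x) - t * trunc x).
have [||rho [rc rs rl]] := @ex_poisson_limit _ nu_ A B.
- move=> t.
  have mc1 : measurable_fun setT (fun x : R => cos (t * x) - 1) by meas.
  have c0 : cos (t * 0) - 1 = 0 by rewrite mulr0 cos0 subrr.
  have [_ lim] := w_dct mc1 c0 (levy_cos_bound t).
  have e n : \int[nu_ n]_x (cos (t * x) - 1) = \int[nu]_x ((cos (t * x) - 1) * w n x) +
    s * n.+1%:R ^+ 2 / 2 * ((cos (t * n.+1%:R^-1) - 1) + (cos (t * (- n.+1%:R^-1)) - 1)) +
    M n * (cos (t * (d n / M n)) - 1).
    have [|_ ->//] := hnu n (fun x => cos (t * x) - 1) mc1.
    apply: (L1M_bounded (k := 2)) => // x.
    rewrite distrC ger0_norm ?one_sub_cos_ge0//.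
    by have := cos_geN1 (t * x); lra.
  rewrite (funext e).
  rewrite /A -[X in _ --> X]addr0 (addrC (- _)).
  apply: cvgD; first by apply: cvgD => //; exact: gauss_cvg.
  apply/norm_cvg0P; apply: (@squeeze_cvgr _ _ _ _ (cst 0) (fun n => t ^+ 2 / n.+1%:R)).
  + apply: nearW => n; rewrite normr_ge0/= normrM (gtr0_norm (dM n)).
    rewrite distrC ger0_norm ?one_sub_cos_ge0//.

    apply: le_trans (ler_wpM2l (ltW (dM n)) (one_sub_cos_le _)) _.
    rewrite (_ : M n * _ = t ^+ 2 * (d n ^+ 2 / M n) / 2); last first.
      by field; rewrite gt_eqF.
    rewrite ler_pdivrMr//; have := ler_wpM2l (sqr_ge0 t) (dM2 n).
    have : 0 <= t ^+ 2 / n.+1%:R by rewrite divr_ge0// sqr_ge0.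
    set p := t ^+ 2 * (_ / _); set q := t ^+ 2 / _; lra.
  + exact: cvg_cst.
  + by rewrite -(mulr0 (t ^+ 2)); apply: cvgM; [exact: cvg_cst|exact: cvg_harmonic].
- move=> t.
  have ms1 : measurable_fun setT (fun x : R => sin (t * x) - t * trunc x) by meas.
  have c0 : sin (t * 0) - t * trunc 0 = 0 by rewrite /trunc !mulr0 mul0r sin0 mulr0 subrr.
  have [_ lim] := w_dct ms1 c0 (levy_sin_bound t).
  have sw n : L1 nu (fun x => sin (t * x) * w n x).
    by apply: (L1M_bounded (k := 1)) => // x; exact: sin_norm_le1.
  have e n : \int[nu_ n]_x sin (t * x) = b * t + \int[nu]_x ((sin (t * x) - t * trunc x) * w n x) +
      (M n * sin (t * (d n / M n)) - t * d n).
    have [_ ->] := hnu n (fun x => sin (t * x)) (ms t) (sw n).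
    rewrite (_ : (fun x => (sin (t * x) - t * trunc x) * w n x) =
                 (fun x => sin (t * x) * w n x - t * (trunc x * w n x))); last first.
      by apply/funext => x; ring.
    rewrite RintegralB//; last exact: L1Z.
    rewrite (RintegralZl _ measurableT (truncw n)).
    by rewrite mulrN sinN /d; ring.
  rewrite (funext e).
  rewrite /B -[X in _ --> X]addr0.
  apply: cvgD; first by apply: cvgD => //; exact: cvg_cst.
  apply/norm_cvg0P; apply: (@squeeze_cvgr _ _ _ _ (cst 0) (fun n => t ^+ 2 / n.+1%:R)).
  + apply: nearW => n; rewrite normr_ge0/=.
    rewrite (_ : _ - t * d n = M n * (sin (t * (d n / M n)) - t * (d n / M n))); last first.
      by field; rewrite gt_eqF.
    rewrite normrM (gtr0_norm (dM n)).
    apply: le_trans (ler_wpM2l (ltW (dM n)) (sin_sub_le _)) _.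
    rewrite (_ : M n * _ = t ^+ 2 * (d n ^+ 2 / M n)); last first.
      by field; rewrite gt_eqF.
    by apply: ler_wpM2l (dM2 n); exact: sqr_ge0.
  + exact: cvg_cst.
  + by rewrite -(mulr0 (t ^+ 2)); apply: cvgM; [exact: cvg_cst|exact: cvg_harmonic].
exists rho; split=> // l l0 supp.
have [I0 |] := pselect (0 <= \int[nu]_x m x); last first.
  by case; apply: Rintegral_ge0 => x _; exact: m_ge0.
pose C := l ^+ 2 * expR l.
have C0 : 0 <= C by rewrite mulr_ge0 ?sqr_ge0// expR_ge0.
pose h x := expR (- (l * x)).
have mh : measurable_fun setT h by rewrite /h; meas.
have mh1 : measurable_fun setT (fun x => h x - 1) by meas.
have taylor (y : R) : `|y| <= 1 -> h y - 1 + l * y <= C * y ^+ 2.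
  move=> y1; have := expRN_taylor_le (l * y).
  rewrite -/(h y) distrC => /(le_trans (ler_norm _)) hy.
  have : (l * y) ^+ 2 * expR `|l * y| <= C * y ^+ 2.
    rewrite exprMn /C mulrAC; apply: ler_wpM2r; first exact: sqr_ge0.
    apply: ler_wpM2l; first exact: sqr_ge0.
    by rewrite ler_expR normrM (gtr0_norm l0) ler_piMr// ltW.
  by move: hy; set q := _ * expR _; set z := h y; lra.
(* [h] is unbounded on the negative half-line but at most [1] on the support of [nu];
   [Num.min 1 (h x)] is a bounded substitute that coincides with it there. *)
have hw n : L1 nu (fun x => h x * w n x).
  have i1 : L1 nu (fun x => Num.min 1 (h x) * w n x).
    apply: (L1M_bounded (k := 1)) => //.
      by apply: measurable_minr; [exact: measurable_cst|].
    by move=> x; rewrite ger0_norm ?ge_min ?lexx// le_min ler01 expR_ge0.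
  have e x : ~ (~` `]0, +oo[) x -> h x * w n x = Num.min 1 (h x) * w n x.
    move=> /contrapT/=; rewrite in_itv/= andbT => x0; congr (_ * _); apply/esym/min_idPr.
    by rewrite expR_le1 oppr_le0 mulr_ge0// ltW.
  by have [] := L1_ae (measurable_funM mh (mw n)) (measurableC (measurable_itv _)) supp i1 e.
exists (expR (C * \int[nu]_x m x + s * C + C - l * b)) => n.
have [hi _] := hnu n h mh (hw n).
apply: le_trans (rl n l hi) _; rewrite lee_fin ler_expR.
have hw1 : L1 nu (fun x => (h x - 1) * w n x).
  rewrite (_ : (_ \o _) = (EFin \o (fun x => h x * w n x - w n x))).
    exact: L1B.
  by apply/funext => x /=; congr EFin; ring.
have [_ ->] := hnu n (fun x => h x - 1) mh1 hw1.
(* Since [d n] may diverge, the jump part and the drift part are not bounded separately; the terms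
   [l * d n] of [part1] and [part3] cancel in the sum. *)
have part1 : \int[nu]_x ((h x - 1) * w n x) - l * d n <= C * \int[nu]_x m x - l * b.
  have -> : \int[nu]_x ((h x - 1) * w n x) - l * d n =
      \int[nu]_x ((h x - 1 + l * trunc x) * w n x) - l * b.
    rewrite (_ : (fun x => (h x - 1 + l * trunc x) * w n x) =
      (fun x => (h x - 1) * w n x + l * (trunc x * w n x))); last by apply/funext => x; ring.
    rewrite RintegralD//; last exact: L1Z.
    by rewrite (RintegralZl _ measurableT (truncw n)) /d; ring.
  rewrite lerD2r -RintegralZl//.
  pose f x := (h x - 1 + l * trunc x) * w n x.
  have fi : L1 nu f.
    rewrite (_ : (_ \o f) = (EFin \o (fun x => (h x - 1) * w n x + l * (trunc x * w n x)))).
      by apply: L1D => //; exact: L1Z.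
    by apply/funext => x /=; congr EFin; rewrite /f; ring.
  (* The minimum equals [f] on the support of [nu] and is below [C * m] everywhere, so a pointwise
     comparison on the whole line becomes possible. *)
  have gi : L1 nu (fun x => Num.min (C * m x) (f x)).
    apply: (@L1_dom _ _ _ _ _ (fun x => `|f x| + C * m x)).
    - apply: measurable_minr; [by meas|exact: L1_measurable fi].
    - by apply: L1D; [exact: L1_norm|exact: L1Z].
    - move=> x; have Cm := mulr_ge0 C0 (m_ge0 x).
      have [_|_] := leP (C * m x) (f x); last by rewrite lerDl.
      by rewrite [leLHS]ger0_norm// lerDr.
  have e x : ~ (~` `]0, +oo[) x -> f x = Num.min (C * m x) (f x).
    move=> /contrapT/=; rewrite in_itv/= andbT => x0; apply/esym/min_idPr.
    have Cm := mulr_ge0 C0 (m_ge0 x).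
    have [f0|f0] := leP (h x - 1 + l * trunc x) 0.
      by apply: le_trans Cm; rewrite mulr_le0_ge0.
    apply: (@le_trans _ _ (h x - 1 + l * trunc x)); first by rewrite ler_piMr// ltW.
    have [[x1 [-> ->]]|[x1 [_ [-> ->]]]] := levy_truncE x.
      apply: taylor; rewrite -(@ler_pXn2r _ 2) ?nnegrE// expr1n real_normK ?num_real//.
    rewrite mulr0 addr0 mulr1; apply: le_trans C0; rewrite subr_le0 expR_le1 oppr_le0.
    by rewrite mulr_ge0// ltW.
  have [_ ->] := L1_ae (L1_measurable fi) (measurableC (measurable_itv _)) supp gi e.
  apply: le_Rintegral => //; first exact: L1Z.
  by move=> x _; rewrite ge_min lexx.
have n0 : (0 : R) < n.+1%:R by [].
have part2 : s * n.+1%:R ^+ 2 / 2 * ((h n.+1%:R^-1 - 1) + (h (- n.+1%:R^-1) - 1)) <= s * C.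
  have e1 : `|n.+1%:R^-1 : R| <= 1 by rewrite ger0_norm ?invr_ge0// invf_le1// ler1n.
  have := taylor _ e1; have := taylor (- n.+1%:R^-1); rewrite normrN => /(_ e1).
  rewrite mulrN sqrrN => h1 h2.
  have h3 : (h n.+1%:R^-1 - 1) + (h (- n.+1%:R^-1) - 1) <= 2 * (C * n.+1%:R^-1 ^+ 2).
    rewrite mulr2n mulrDl mul1r; apply: le_trans (lerD h2 h1).
    by rewrite le_eqVlt; apply/orP; left; apply/eqP; ring.
  have h4 : 0 <= s * n.+1%:R ^+ 2 / 2 by rewrite divr_ge0// mulr_ge0// sqr_ge0.
  apply: le_trans (ler_wpM2l h4 h3) _.
  by rewrite le_eqVlt; apply/orP; left; apply/eqP; field; rewrite addrC natr1 pnatr_eq0.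
have part3 : M n * (h (d n / M n) - 1) <= C - l * d n.
  have dn1 : `|d n / M n| <= 1.
    rewrite normrM normfV (gtr0_norm (dM n)) ler_pdivrMr// mul1r.
    have h1 : `|d n| <= 1 + d n ^+ 2.
      by rewrite -[d n ^+ 2]real_normK ?num_real//; have := sqr_ge0 (`|d n| - 1); nra.
    by apply: le_trans h1 _; rewrite /M ler_peMl ?ler1n// addr_ge0 ?sqr_ge0.
  have := ler_wpM2l (ltW (dM n)) (taylor _ dn1).
  have -> : M n * (h (d n / M n) - 1 + l * (d n / M n)) = M n * (h (d n / M n) - 1) + l * d n.
    by field; rewrite gt_eqF.
  have -> : M n * (C * (d n / M n) ^+ 2) = C * (d n ^+ 2 / M n) by field; rewrite gt_eqF.
  have : C * (d n ^+ 2 / M n) <= C.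
    rewrite ler_piMr//; apply: le_trans (dM2 n) _.
    by rewrite invf_le1// ler1n.
  set z1 := C * _; set z2 := M n * _; lra.
move: part1 part2 part3.
set z1 := \int[nu]_x _; set z2 := _ / 2 * _; set z3 := M n * _; set z4 := C * _; lra.
Qed.

End levy_approximation.

(** * Exponential moments of laws with Levy measure on the positive half-line *)

Section characteristic_functions.
Variable R : realType.
Implicit Types mu : probability R R.

Lemma charfunE mu t : charfun mu t = (costr mu t +i* sintr mu t)%C.
Proof.
rewrite /charfun /Cintegral; congr (_ +i* _)%C;
  by apply: eq_Rintegral => x _; rewrite /= expR0 mul1r.
Qed.

Lemma levy_khintchine_exponentE (b s : R) (nu : {measure set R -> \bar R}) t :
  levy_khintchine_exponent b s nu t =
  ((- (s * t ^+ 2 / 2) + \int[nu]_x (cos (t * x) - 1)) +i*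
   (b * t + \int[nu]_x (sin (t * x) - t * (x * \1_(`[-1, 1]) x))))%C.
Proof.
rewrite /levy_khintchine_exponent /Cintegral.
set f := fun x : R => (cexp (0 +i* (t * x)) - 1 - (0 +i* (t * x * \1_(`[-1, 1]) x)))%C.
rewrite -[LHS]/((- (s * t ^+ 2 / 2) + \int[nu]_x complex.Re (f x)) +i*
  (b * t + \int[nu]_x complex.Im (f x)))%C.
congr Complex; congr (_ + _); apply: eq_Rintegral => x _ /=.
- by rewrite expR0 mul1r oppr0 addr0.
- by rewrite expR0 mul1r oppr0 addr0 mulrA.
Qed.

Lemma levy_charfun mu (b s : R) (nu : {measure set R -> \bar R}) t :
  charfun mu t = cexp (levy_khintchine_exponent b s nu t) ->
  costr mu t = expR (- (s * t ^+ 2 / 2) + \int[nu]_x (cos (t * x) - 1)) *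
    cos (b * t + \int[nu]_x (sin (t * x) - t * (x * \1_(`[-1, 1]) x))) /\
  sintr mu t = expR (- (s * t ^+ 2 / 2) + \int[nu]_x (cos (t * x) - 1)) *
    sin (b * t + \int[nu]_x (sin (t * x) - t * (x * \1_(`[-1, 1]) x))).
Proof. by rewrite charfunE levy_khintchine_exponentE => -[-> ->]. Qed.

Lemma levy_integrable_min (nu : {measure set R -> \bar R}) : levy_integrable nu ->
  L1 nu (fun x => Num.min 1 (x ^+ 2)).
Proof.
move=> [_ h]; apply: L1_ge0 => //.
  by apply: measurable_minr; [exact: measurable_cst|meas].
by move=> x; rewrite le_min ler01 sqr_ge0.
Qed.

(** Cut-offs increasing to [1], zero to the left of [- k], all with Lipschitz constant [1]. *)
Let cut (k : nat) (x : R) := trapezoid 1 (- k%:R) k%:R x.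

Let cut_mono x : {homo cut^~ x : k l / (k <= l)%N >-> k <= l}.
Proof.
move=> k l kl; have kl' : k%:R <= l%:R :> R by rewrite ler_nat.
rewrite /cut /trapezoid ge_max le_max lexx/= le_max; apply/orP; right.
by rewrite !le_min !ge_min lexx/= !mul1r; apply/andP; split; apply/orP; right;
  apply/orP; [left|right]; lra.
Qed.

Let cut_eventually (x : R) : \forall k \near \oo, cut k x = 1.
Proof.
near=> k; apply: trapezoid_eq1 => //.
- rewrite invr1; have : 1 - x <= k%:R by near: k; exact: nbhs_infty_ger.
  by lra.
- by near: k; exact: nbhs_infty_ger.
Unshelve. all: by end_near. Qed.

Let expR_lipschitz (l K x y : R) : 0 <= l -> - K <= x -> - K <= y ->
  `|expR (- (l * x)) - expR (- (l * y))| <= l * expR (l * K) * `|x - y|.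
Proof.
move=> l0.
wlog xy : x y / x <= y => [hwlog|xK yK].
  have [xy|/ltW yx] := leP x y; first exact: hwlog.
  by move=> xK yK; rewrite distrC (distrC x); exact: hwlog.
have exy : expR (- (l * y)) <= expR (- (l * x)) by rewrite ler_expR lerN2 ler_wpM2l.
rewrite ger0_norm ?subr_ge0// distrC (ger0_norm (_ : 0 <= y - x)) ?subr_ge0//.
have -> : expR (- (l * y)) = expR (- (l * x)) * expR (- (l * (y - x))).
  by rewrite -expRD; congr expR; ring.
rewrite -[X in X - _]mulr1 -mulrBr.
have h : expR (- (l * x)) <= expR (l * K) by rewrite ler_expR -mulrN ler_wpM2l//; lra.
have h2 : 1 - expR (- (l * (y - x))) <= l * (y - x).
  by have := expR_ge1Dx (- (l * (y - x))); set z := expR _; lra.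
have h3 : 0 <= l * (y - x) by rewrite mulr_ge0// subr_ge0.
rewrite (_ : l * expR (l * K) * (y - x) = expR (l * K) * (l * (y - x))); last by ring.
apply: le_trans (_ : expR (- (l * x)) * (l * (y - x)) <= _).
  by rewrite ler_wpM2l ?expR_ge0.
by rewrite ler_wpM2r.
Qed.

(** A Fatou argument: the exponential is not an admissible test function, but its product with
    [cut k] is; the bound passes to the limit for each [k], then monotone convergence removes the
    cut-off. *)
Lemma laplace_bound_limit (rho : nat -> {finite_measure set R -> \bar R})
    (mu : {finite_measure set R -> \bar R}) (l K : R) : 0 < l ->
  (forall t, costr (rho n) t @[n --> \oo] --> costr mu t) ->
  (forall t, sintr (rho n) t @[n --> \oo] --> sintr mu t) ->
  (forall n, (laplace (rho n) l <= K%:E)%E) ->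
  (laplace mu l <= K%:E)%E.
Proof.
move=> l0 hc hs hK.
pose e (x : R) := expR (- (l * x)).
have me : measurable_fun setT e by rewrite /e; meas.
have e0 x : 0 <= e x by exact: expR_ge0.
have mcut k : measurable_fun setT (cut k) by exact: measurable_trapezoid.
pose g k x := cut k x * e x.
have mg k : measurable_fun setT (g k) by exact: measurable_funM.
have g0 k x : 0 <= g k x by rewrite mulr_ge0// trapezoid_ge0.
have ge k x : g k x <= e x by rewrite ler_piMl// trapezoid_le1.
(* On the support of [cut k] nothing changes, while the second factor becomes globally bounded and
   Lipschitz. *)
have gE k x : g k x = cut k x * e (Num.max (- k%:R) x).
  rewrite /g; have [kx|xk] := boolP (- k%:R <= x).
    by rewrite (max_idPr _).
  rewrite /cut trapezoid_eq0 ?mul0r// in_itv/= negb_and.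
  by rewrite xk.
pose B (k : nat) := expR (l * k%:R).
have eB k x : `|e (Num.max (- k%:R) x)| <= B k.
  rewrite ger0_norm// ler_expR -mulrN ler_wpM2l ?(ltW l0)//.
  by rewrite lerNl le_max lexx.
have gB k x : `|g k x| <= B k.
  rewrite gE normrM -[B k]mul1r ler_pM//.
  by rewrite ger0_norm ?trapezoid_ge0// trapezoid_le1.
have glip k x y : `|g k x - g k y| <= (B k + l * B k) * `|x - y|.
  rewrite !gE; set u := Num.max _ x; set v := Num.max _ y.
  rewrite (_ : _ - _ = (cut k x - cut k y) * e u + cut k y * (e u - e v)); last by ring.
  apply: le_trans (ler_normD _ _) _; rewrite [leRHS]mulrDl; apply: lerD.
    rewrite normrM mulrC; apply: ler_pM => //; first exact: eB.
    by apply: le_trans (trapezoid_lipschitz _ _ _ _ ler01) _; rewrite mul1r.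
  rewrite normrM -[leRHS]mul1r; apply: ler_pM => //.
    by rewrite ger0_norm ?trapezoid_ge0// trapezoid_le1.
  apply: le_trans (_ : l * B k * `|u - v| <= _).
    by apply: expR_lipschitz; rewrite ?(ltW l0)// le_max lexx.
  apply: ler_wpM2l; first by rewrite mulr_ge0 ?expR_ge0// ltW.
  by apply: ler_norm_maxB => //; rewrite subrr normr0.
have gL k : L1 (@leb R) (g k).
  rewrite (_ : (_ \o g k) = EFin \o (fun x => e (Num.max (- k%:R) x) * cut k x)); last first.
    by apply/funext => x /=; rewrite gE mulrC.
  apply: (L1M_bounded (k := B k)); [exact: L1_trapezoid| |exact: eB].
  apply: measurableT_comp => //; apply: measurable_maxr; [exact: measurable_cst|meas].
have gK k : (\int[mu]_x (g k x)%:E <= K%:E)%E.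
  have BL : 0 <= B k + l * B k by rewrite addr_ge0 ?mulr_ge0 ?expR_ge0// ltW.
  have lim := levy_continuity hc hs (gL k) (gB k) BL (glip k).
  have gi : L1 mu (g k) by apply: L1_bounded (mg k) (gB k).
  rewrite -L1K// lee_fin -(cvg_lim (@norm_hausdorff _ _) lim).
  apply: limr_le; first by apply/cvg_ex; eexists; exact: lim.
  apply: nearW => n; have gn : L1 (rho n) (g k) by apply: L1_bounded (mg k) (gB k).
  rewrite -lee_fin L1K//; apply: le_trans (hK n); apply: ge0_le_integral => //.
  - by move=> x _; rewrite lee_fin.
  - exact/measurable_EFinP.
  - exact/measurable_EFinP.
  - by move=> x _; rewrite lee_fin.
have mono : (\int[mu]_x (g k x)%:E @[k --> \oo] --> \int[mu]_x (e x)%:E)%E.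
  rewrite (_ : (\int[mu]_x (e x)%:E)%E = (\int[mu]_x limn (fun k => (g k x)%:E))%E); last first.
    apply: eq_integral => x _; apply/esym/cvg_lim => //.
    apply: cvg_near_cst; near=> k; rewrite /g (_ : cut k x = 1) ?mul1r//.
    by near: k; exact: cut_eventually.
  apply: cvg_monotone_convergence => //.
  - by move=> k; exact/measurable_EFinP.
  - by move=> k x _; rewrite lee_fin.
  - by move=> x _ k k' kk; rewrite lee_fin ler_wpM2r//; exact: cut_mono.
rewrite /laplace -(cvg_lim _ mono)//; apply: lime_le; last exact: nearW.
by apply/cvg_ex; eexists; exact: mono.
Unshelve. all: by end_near. Qed.

(** The approximations of [ex_levy_limit] have uniformly bounded Laplace transforms and
    characteristic functions converging to that of [mu]. *)
Theorem right_skewed_laplace_lty mu (nu : {measure set R -> \bar R}) (l : R) :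
  is_levy_measure_of nu mu -> nu (~` `]0, +oo[) = 0%E -> 0 < l ->
  (laplace mu l < +oo)%E.
Proof.
move=> [hnu [b [s [s0 hmu]]]] supp l0.
have [rho [hc hs hK]] := ex_levy_limit b s0 (levy_integrable_min hnu).
have [K {}hK] := hK l l0 supp.
apply: (@le_lt_trans _ _ K%:E); last exact: ltry.
apply: (@laplace_bound_limit rho mu l K) => // t.
- by have [-> _] := levy_charfun (hmu t); exact: hc.
- by have [_ ->] := levy_charfun (hmu t); exact: hs.
Qed.

End characteristic_functions.

(** * Levy exponents under affine maps *)

Section affine_images.
Variable R : realType.
Implicit Types (mu : probability R R) (nu : {measure set R -> \bar R}).

Let m (x : R) : R := Num.min 1 (x ^+ 2).
Let trunc (x : R) : R := x * \1_(`[-1, 1]) x.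

Let mtrunc : measurable_fun setT trunc.
Proof. by apply: measurable_funM; [exact: measurable_id|exact: measurable_indic]. Qed.

Let m_ge0 x : 0 <= m x. Proof. by rewrite le_min ler01 sqr_ge0. Qed.

Let m_scale r x : m (r * x) <= (1 + r ^+ 2) * m x.
Proof.
have r2 := sqr_ge0 r; have x2 := sqr_ge0 x; rewrite /m exprMn.
have [x1|x1] := leP 1 (x ^+ 2).
  by rewrite mulr1 ge_min; apply/orP; left; rewrite lerDl.
by rewrite ge_min; apply/orP; right; rewrite ler_wpM2r// lerDr.
Qed.

(** The Levy measure of [r X + c] is the image of that of [X] under [x |-> r x]; since [r > 0] the
    dilation preserves the half-line. *)
Lemma ex_affine_levy_exponent nu (r c b s : R) : 0 < r -> 0 <= s ->
  levy_integrable nu -> exists nu' : {measure set R -> \bar R}, exists b' s' : R,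
  [/\ levy_integrable nu', 0 <= s',
      nu (~` `]0, +oo[) = 0%E -> nu' (~` `]0, +oo[) = 0%E
    & forall t : R, levy_khintchine_exponent b' s' nu' t =
        levy_khintchine_exponent b s nu (r * t) + (0 +i* (t * c))%C].
Proof.
move=> r0 s0 hnu; have mi := levy_integrable_min hnu.
pose phi (x : R) := r * x.
have mphi : measurable_fun setT phi by rewrite /phi; meas.
have [nu' nu'E] : exists nu' : {measure set R -> \bar R},
    (nu' : set R -> \bar R) = pushforward nu phi.
  by exists (measure_function_pushforward__canonical__measure_function_Measure nu mphi).
have mm : measurable_fun setT m by apply: measurable_minr; [exact: measurable_cst|meas].
have push (h : R -> R) : measurable_fun setT h -> L1 nu (fun x => h (r * x)) ->
    \int[nu']_x h x = \int[nu]_x h (r * x).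
  move=> mh hi; rewrite /Rintegral nu'E; congr fine.
  by rewrite integral_pushforward//; exact/measurable_EFinP.
have mri : L1 nu (fun x => m (r * x)).
  apply: (@L1_dom _ _ _ _ _ (fun x => (1 + r ^+ 2) * m x)).
  - by apply: measurableT_comp => //; exact: mphi.
  - exact: L1Z.
  - by move=> x; rewrite ger0_norm//; exact: m_scale.
have msin t : measurable_fun setT (fun x : R => sin (t * x) - t * trunc x) by meas.
have sini t : L1 nu (fun x => sin (t * x) - t * trunc x).
  by apply: (@L1_dom _ _ _ _ _ (fun x => (1 + t ^+ 2) * m x)) => //;
    [exact: L1Z|exact: levy_sin_bound].
have sinri t : L1 nu (fun x => sin (t * (r * x)) - t * trunc (r * x)).
  apply: (@L1_dom _ _ _ _ _ (fun x => (1 + t ^+ 2) * m (r * x))).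
  - by apply: (measurableT_comp (msin t)); exact: mphi.
  - exact: L1Z.
  - by move=> x; exact: levy_sin_bound.
have cosri t : L1 nu (fun x => cos (t * (r * x)) - 1).
  apply: (@L1_dom _ _ _ _ _ (fun x => (2 + t ^+ 2) * m (r * x))).
  - by meas.
  - exact: L1Z.
  - by move=> x; exact: levy_cos_bound.
(* The two truncations differ by a function that vanishes near [0]; it shifts
   the drift. *)
pose delta := \int[nu]_x (r * trunc x - trunc (r * x)).
(* Neither truncation need be integrable, but their difference is also the difference of two
   compensated sines, each of which is. *)
have di : L1 nu (fun x => r * trunc x - trunc (r * x)).
  rewrite (_ : (_ \o _) = EFin \o (fun x => (sin (1 * (r * x)) - 1 * trunc (r * x)) -
      (sin (r * x) - r * trunc x))); first exact: L1B.
  by apply/funext => x /=; rewrite !mul1r; congr EFin; ring.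
exists nu', (r * b - delta + c), (s * r ^+ 2); split.
- split.
    rewrite nu'E /pushforward (_ : phi @^-1` [set 0] = [set 0]); first by case: hnu.
    apply/seteqP; split=> x /=; rewrite /phi; last by move=> ->; rewrite mulr0.
    by move=> /eqP; rewrite mulf_eq0 gt_eqF//= => /eqP.
  rewrite nu'E ge0_integral_pushforward//.
  + by apply: (L1_lty mri).
  + exact/measurable_EFinP.
  + by move=> x _; rewrite lee_fin; exact: m_ge0.
- by rewrite mulr_ge0// sqr_ge0.
- move=> <-; rewrite nu'E /pushforward; congr (nu _).
  by apply/seteqP; split=> x /=; rewrite !in_itv/= !andbT /phi pmulr_rgt0.
- move=> t; rewrite !levy_khintchine_exponentE.
  have -> : \int[nu']_x (cos (t * x) - 1) = \int[nu]_x (cos (r * t * x) - 1).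
    rewrite push//; last by meas.
    by apply: eq_Rintegral => x _; rewrite mulrCA mulrA.
  have -> : \int[nu']_x (sin (t * x) - t * (x * \1_(`[-1, 1]) x)) =
      \int[nu]_x (sin (r * t * x) - r * t * (x * \1_(`[-1, 1]) x)) + t * delta.
    rewrite (push _ (msin t) (sinri t)).
    rewrite /delta -(RintegralZl _ measurableT di) 
      -(RintegralD measurableT (sini (r * t)) (L1Z t di)).
    by apply: eq_Rintegral => x _; rewrite (_ : t * (r * x) = r * t * x); [ring|by rewrite mulrCA mulrA].
  set A := \int[nu]_x _; set B := \int[nu]_x _.
  apply/eqP; rewrite eq_complex /=; apply/andP; split; apply/eqP; by field.
Qed.

Lemma is_levy_measure_affine mu mu' nu (r c : R) : 0 < r ->
  is_levy_measure_of nu mu -> nu (~` `]0, +oo[) = 0%E ->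
  (forall t, costr mu' t = costr mu (r * t) * cos (t * c) - sintr mu (r * t) * sin (t * c)) ->
  (forall t, sintr mu' t = sintr mu (r * t) * cos (t * c) + costr mu (r * t) * sin (t * c)) ->
  exists nu' : {measure set R -> \bar R},
    is_levy_measure_of nu' mu' /\ nu' (~` `]0, +oo[) = 0%E.
Proof.
move=> r0 [hnu [b [s [s0 hmu]]]] supp hc hs.
have [nu' [b' [s' [hnu' s'0 supp' e]]]] := ex_affine_levy_exponent c b r0 s0 hnu.
exists nu'; split; last exact: supp'.
split=> //; exists b', s'; split=> // t.
rewrite charfunE e hc hs; have := hmu (r * t); rewrite charfunE.
case: levy_khintchine_exponent => x y [-> ->] /=.
by rewrite addr0 cosD sinD; congr Complex; ring.
Qed.

End affine_images.

(** * Stable laws and their Laplace transforms *)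

Section functional_equation.
Variable R : realType.
Implicit Types (f G phi : R -> R) (x y : R).

(* Sequential continuity on [(0, +oo)]; the bounds suit dominated convergence. *)
Definition seq_continuous f := forall (a b x : R) (u : nat -> R), 0 < a ->
  (forall n, a <= u n <= b) -> u n @[n --> \oo] --> x -> f (u n) @[n --> \oo] --> f x.

Lemma powR_lnE x (p : R) : 0 < x -> x `^ p = expR (p * ln x).
Proof. by move=> x0; rewrite /powR gt_eqF. Qed.

Lemma powR_eqK x (p : R) : 0 < x -> p != 0 -> (x `^ p) `^ p^-1 = x.
Proof. by move=> x0 p0; rewrite -powRrM mulfV// powRr1// ltW. Qed.

Lemma seq_continuous_powR (p : R) : seq_continuous (fun x => x `^ p).
Proof.
move=> a b x u a0 uab ux.
have x0 : 0 < x.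
  apply: lt_le_trans a0 _; rewrite -(cvg_lim (@norm_hausdorff _ _) ux).
  apply: limr_ge; first by apply/cvg_ex; eexists; exact: ux.
  by apply: nearW => n; case/andP: (uab n).
rewrite powR_lnE//.
rewrite (_ : (fun n => _) = fun n => expR (p * ln (u n))); last first.
  by apply/funext => n; rewrite powR_lnE//; apply: lt_le_trans a0 _; case/andP: (uab n).
have h : ln (u n) @[n --> \oo] --> ln x.
  exact: (cvg_comp u (@ln R) ux (@continuous_ln R x x0)).
have h2 : p * ln (u n) @[n --> \oo] --> p * ln x by apply: cvgM => //; exact: cvg_cst.
exact: (cvg_comp (fun n => p * ln (u n)) expR h2 (@continuous_expR R _)).
Qed.

Lemma additive_linear f : (forall x y, 0 < x -> 0 < y -> f (x + y) = f x + f y) ->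
  seq_continuous f -> forall x, 0 < x -> f x = x * f 1.
Proof.
move=> fD fc.
have fn (n : nat) x : 0 < x -> f (n.+1%:R * x) = n.+1%:R * f x.
  move=> x0; elim: n => [|n ih]; first by rewrite !mul1r.
  by rewrite -(natr1 n.+1) mulrDl mul1r fD// ?mulr_gt0// ih mulrDl mul1r.
have fq (n k : nat) : f (k.+1%:R / n.+1%:R) = k.+1%:R / n.+1%:R * f 1.
  have n0 : n.+1%:R != 0 :> R by rewrite pnatr_eq0.
  rewrite fn ?invr_gt0// -mulrA; congr (_ * _).
  apply: (mulfI n0); rewrite -fn ?invr_gt0// mulfV//.
  by rewrite mulrA mulfV// mul1r.
move=> x x0.
(* The rationals [(k n + 1) / (n + 1)] approach [x] from above, within [[x, x + 1]], so the
   continuity hypothesis applies to them. *)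
pose k n := Num.truncn (n.+1%:R * x).
pose u n : R := (k n).+1%:R / n.+1%:R.
have n0 n : (0 : R) < n.+1%:R by [].
have ku n : x <= u n <= x + n.+1%:R^-1.
  have nx : 0 <= n.+1%:R * x by rewrite mulr_ge0// ltW.
  have /andP[k1 k2] := truncn_itv nx.
  rewrite /u ler_pdivlMr// mulrC (ltW k2)/= ler_pdivrMr// mulrDl mulVf ?gt_eqF//.
  by rewrite -natr1 lerD2r mulrC.
have ux : u n @[n --> \oo] --> x.
  apply: (@squeeze_cvgr _ _ _ _ (cst x) (fun n => x + n.+1%:R^-1)).
  - by apply: nearW => n; exact: ku.
  - exact: cvg_cst.
  - by rewrite -[X in _ --> X]addr0; apply: cvgD; [exact: cvg_cst|exact: cvg_harmonic].
have h1 : f (u n) @[n --> \oo] --> f x.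
  apply: (fc x (x + 1)) => // n; have /andP[-> /le_trans] := ku n; apply.
  by rewrite lerD2l invf_le1// ler1n.
have h2 : f (u n) @[n --> \oo] --> x * f 1.
  rewrite (_ : (fun n => _) = fun n => u n * f 1).
    by apply: cvgM => //; exact: cvg_cst.
  by apply/funext => n; exact: fq.
by rewrite -(cvg_lim (@norm_hausdorff _ _) h1) (cvg_lim (@norm_hausdorff _ _) h2).
Qed.

(* The defect of additivity of [G x = phi (x `^ p)], [p = alpha^-1], is
   homogeneous of degree [p]; removing a multiple of [x `^ p] from [G] makes it
   vanish on the diagonal at [1], hence everywhere since [2 `^ p != 2]. *)
Lemma stable_functional_equation phi (alpha : R) : 0 < alpha -> alpha != 1 ->
  (forall a b, 0 < a -> 0 < b -> exists D, forall s, 0 < s ->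
    phi (s * a) + phi (s * b) =
    phi (s * (a `^ alpha + b `^ alpha) `^ alpha^-1) - s * D) ->
  seq_continuous phi ->
  exists k beta, forall s, 0 < s -> phi s = k * s `^ alpha + beta * s.
Proof.
move=> alpha0 alpha1 hphi phic.
have an0 : alpha != 0 by rewrite gt_eqF.
pose p := alpha^-1.
have p0 : p != 0 by rewrite invr_eq0.
pose G x := phi (x `^ p).
pose Delta x y := G x + G y - G (x + y).
have DeltaZ r x y : 0 < r -> 0 < x -> 0 < y -> Delta (r * x) (r * y) = r `^ p * Delta x y.
  move=> r0 x0 y0.
  have [D hD] := hphi (x `^ p) (y `^ p) (powR_gt0 _ x0) (powR_gt0 _ y0).
  have e z : 0 < z -> (z `^ p) `^ alpha = z.
    by move=> z0; have := powR_eqK z0 p0; rewrite /p invrK.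
  have hD' s : 0 < s -> G (s * x) + G (s * y) = G (s * (x + y)) - s `^ p * D.
    move=> s0; have := hD (s `^ p) (powR_gt0 _ s0).
    by rewrite !e// -/p -!powRM ?(ltW s0) ?(ltW x0) ?(ltW y0) ?addr_ge0 ?ltW.
  have := hD' 1 ltr01; rewrite !mul1r powR1 mul1r => h1.
  rewrite /Delta -mulrDr hD'// h1; ring.
(* Here [alpha != 1] enters: [2 ^ p = 2] would give [p = 1]. *)
have p2 : 2 - 2 `^ p != 0 :> R.
  rewrite subr_eq0; apply/eqP => h; move/eqP: alpha1; apply.
  have := congr1 (fun z : R => ln z) h.
  rewrite /= ln_powR => h2; have l2 : ln 2 != 0 :> R by rewrite gt_eqF// ln_gt0// ltr1n.
  have : p = 1 by apply: (mulIf l2); rewrite mul1r -h2.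
  by move=> p1; rewrite -[alpha]invrK -/p p1 invr1.
pose beta := Delta 1 1 / (2 - 2 `^ p).
pose G0 x := G x - beta * x `^ p.
pose Delta0 x y := G0 x + G0 y - G0 (x + y).
have Delta0E x y : Delta0 x y = Delta x y - beta * (x `^ p + y `^ p - (x + y) `^ p).
  by rewrite /Delta0 /G0 /Delta; ring.
have Delta0Z r x y : 0 < r -> 0 < x -> 0 < y -> Delta0 (r * x) (r * y) = r `^ p * Delta0 x y.
  move=> r0 x0 y0; rewrite !Delta0E DeltaZ// -mulrDr.
  by rewrite !powRM ?addr_ge0 ?ltW//; ring.
have D11 : Delta0 1 1 = 0.
  rewrite Delta0E /beta powR1 (_ : 1 + 1 = 2 :> R)//.
  by rewrite divfK// subrr.
have G02 x : 0 < x -> G0 (2 * x) = 2 * G0 x.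
  move=> x0; have := Delta0Z x 1 1 x0 ltr01 ltr01; rewrite D11 mulr0 mulr1 /Delta0.
  rewrite (_ : x + x = 2 * x); last by ring.
  by move/eqP; rewrite subr_eq0 => /eqP <-; ring.
(* [G0] doubles exactly, so [Delta0 (2 x) (2 y)] is both [2 Delta0 x y] and [2 ^ p Delta0 x y]. *)
have Delta00 x y : 0 < x -> 0 < y -> Delta0 x y = 0.
  move=> x0 y0; have := Delta0Z 2 x y (ltr0n _ 2) x0 y0.
  rewrite {1}/Delta0 -mulrDr !G02 ?addr_gt0// -mulrDr -mulrBr -/(Delta0 x y).
  move/eqP; rewrite -subr_eq0 -mulrBl mulf_eq0 (negbTE p2)/= => /eqP//.
have G0D x y : 0 < x -> 0 < y -> G0 (x + y) = G0 x + G0 y.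
  by move=> x0 y0; apply/eqP; rewrite eq_sym -subr_eq0; apply/eqP/Delta00.
have G0c : seq_continuous G0.
  move=> a b x u a0 uab ux.
  have up := @seq_continuous_powR p a b x u a0 uab ux.
  apply: cvgB; last by apply: cvgM => //; exact: cvg_cst.
  apply: (phic (Num.min (a `^ p) (b `^ p)) (Num.max (a `^ p) (b `^ p))) => //.
    have b0 : 0 < b by have /andP[h1 h2] := uab 0%N; exact: lt_le_trans a0 (le_trans h1 h2).
    by rewrite lt_min !powR_gt0.
  move=> n; have /andP[au ub] := uab n.
  have u0 := lt_le_trans a0 au; have b0 := lt_le_trans u0 ub.
  rewrite !powR_lnE//; have l1 : ln a <= ln (u n) by rewrite ler_ln.
  have l2 : ln (u n) <= ln b by rewrite ler_ln.
  have pge : 0 <= p by rewrite invr_ge0 ltW.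
  rewrite ge_min le_max !ler_expR.
  by apply/andP; split; apply/orP; [left|right]; exact: ler_wpM2l.
exists (G0 1), beta => s s0.
have := additive_linear G0D G0c (powR_gt0 alpha s0).
by rewrite {1}/G0 /G /p powR_eqK// => /eqP; rewrite subr_eq => /eqP ->; rewrite mulrC.
Qed.

End functional_equation.

Lemma laplace_gt0 (R : realType) (mu : probability R R) (s : R) : (0 < laplace mu s)%E.
Proof.
have e0 (x : R) : 0 <= expR (- (s * x)) by exact: expR_ge0.
rewrite lt_neqAle integral_ge0 ?andbT; last by move=> x _; rewrite lee_fin.
apply/negP => /eqP/esym h.
have i1 : L1 mu (fun x => expR (- (s * x))).
  by apply: L1_ge0 => //; [meas|rewrite [X in (X < _)%E]h ltry].
have := Rintegral_eq0 i1 e0 (congr1 fine h).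
have Hsub : ae_eq mu setT (fun x => expR (- (s * x))) (cst 0) -> mu setT = 0%E.
  move=> [N [mN N0 hN]]; apply/eqP; rewrite eq_le measure_ge0 andbT -N0.
  apply: le_measure; rewrite ?inE// => x _; apply: hN => /= h'.
  by have := expR_gt0 (- (s * x)); rewrite h'// ltxx.
by move=> /Hsub; rewrite probability_setT => /eqP; rewrite onee_eq0.
Qed.

Section laplace_transform_of_a_law.
Variables (R : realType) (mu : probability R R).
Hypothesis mu_lty : forall s : R, 0 < s -> (laplace mu s < +oo)%E.

Definition log_laplace (s : R) : R := ln (fine (laplace mu s)).

Let me (s : R) : measurable_fun setT (fun x : R => expR (- (s * x))).
Proof. by meas. Qed.

Let Li (s : R) : 0 < s -> L1 mu (fun x => expR (- (s * x))).
Proof.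
by move=> s0; apply: L1_ge0 => //; exact: mu_lty.
Qed.

Let LE (s : R) : fine (laplace mu s) = \int[mu]_x expR (- (s * x)).
Proof. by []. Qed.

Let L_gt0 (s : R) : 0 < s -> 0 < fine (laplace mu s).
Proof. by move=> s0; rewrite fine_gt0// laplace_gt0 mu_lty. Qed.

Lemma laplace_log s : 0 < s -> laplace mu s = (expR (log_laplace s))%:E.
Proof.
move=> s0; rewrite /log_laplace lnK ?posrE; last exact: L_gt0.
by rewrite fineK// ge0_fin_numE ?mu_lty// integral_ge0// => x _; rewrite lee_fin expR_ge0.
Qed.

(** For [u] in [[a, b]], [expR (- u y)] is at most [expR (- a y)] or [expR (- b y)] according to the
    sign of [y]; their sum dominates. *)
Lemma seq_continuous_log_laplace : seq_continuous log_laplace.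
Proof.
move=> a b x u a0 uab ux.
have [x0 b0] : 0 < x /\ 0 < b.
  have cu : cvgn u by apply/cvg_ex; eexists; exact: ux.
  split; last by have /andP[h1 h2] := uab 0%N; exact: lt_le_trans a0 (le_trans h1 h2).
  apply: lt_le_trans a0 _; rewrite -(cvg_lim (@norm_hausdorff _ _) ux).
  by apply: limr_ge => //; apply: nearW => n; case/andP: (uab n).
pose dom (y : R) := expR (- (a * y)) + expR (- (b * y)).
have [||||_ lim] := @Rintegral_dct _ _ _ mu (fun n y => expR (- (u n * y)))
   (fun y => expR (- (x * y))) dom.
- by move=> n; exact: me.
- by apply: L1D; exact: Li.
- move=> n y; have /andP[au ub] := uab n.
  rewrite ger0_norm ?expR_ge0// /dom; have [y0|/ltW y0] := leP 0 y.
    apply: (@le_trans _ _ (expR (- (a * y)))); last by rewrite lerDl expR_ge0.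
    by rewrite ler_expR lerN2 ler_wpM2r.
  apply: (@le_trans _ _ (expR (- (b * y)))); last by rewrite lerDr expR_ge0.
  by rewrite ler_expR lerN2; apply: ler_wnM2r.
- move=> y; have h : - (u n * y) @[n --> \oo] --> - (x * y).
    by apply: cvgN; apply: cvgM => //; exact: cvg_cst.
  exact: (cvg_comp (fun n => - (u n * y)) expR h (@continuous_expR R _)).
exact: (cvg_comp _ (@ln R) lim (continuous_ln (L_gt0 x0))).
Qed.

(** Convexity of the logarithm of the Laplace transform together with its value [0] at [0], obtained
    from a pointwise inequality after normalising [expR (- s x)] to integral [1]. *)
Lemma log_laplace_scale (p s : R) : 0 < p -> p <= 1 -> 0 < s ->
  log_laplace (p * s) <= p * log_laplace s.
Proof.
move=> p0 p1 s0; have ps0 : 0 < p * s by rewrite mulr_gt0.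
set c := log_laplace s.
have e1 : fine (laplace mu s) = expR c by rewrite laplace_log.
rewrite -ler_expR /log_laplace lnK ?posrE ?L_gt0//.
(* Weighted mean of [1 + z <= expR z] at [z = - p y] and [z = (1 - p) y], with weights [1 - p] and
   [p]. *)
have bern (y : R) : expR (p * y) <= 1 - p + p * expR y.
  have h1 := expR_ge1Dx ((1 - p) * y); have h2 := expR_ge1Dx (- (p * y)).
  have e2 : expR ((1 - p) * y) = expR y * expR (- (p * y)).
    by rewrite -expRD; congr expR; ring.
  have h : 1 <= (1 - p + p * expR y) * expR (- (p * y)).
    rewrite mulrDl -mulrA -e2.
    have := ler_wpM2l (ltW p0) h1; have p1' : 0 <= 1 - p by rewrite subr_ge0.
    by have := ler_wpM2l p1' h2; set u := expR _; set v := expR _; lra.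
  have ee : expR (p * y) * expR (- (p * y)) = 1 by rewrite -expRD subrr expR0.
  rewrite -(ler_pM2r (expR_gt0 (- (p * y)))) ee.
  exact: h.
have ptw (x : R) : expR (- (p * s * x)) <=
    expR (p * c) * (1 - p + p * (expR (- c) * expR (- (s * x)))).
  have -> : expR (- (p * s * x)) = expR (p * c) * expR (p * (- c - s * x)).
    by rewrite -expRD; congr expR; ring.
  by rewrite ler_wpM2l ?expR_ge0// -expRD; exact: bern.
rewrite LE.
have i1 : L1 mu (fun=> 1 - p) by exact: finite_measure_integrable_cst.
have i2 : L1 mu (fun x => p * (expR (- c) * expR (- (s * x)))).
  by apply: L1Z; apply: L1Z; exact: Li.
apply: (@le_trans _ _ (\int[mu]_x (expR (p * c) * (1 - p + p * (expR (- c) * expR (- (s * x))))))).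
  apply: le_Rintegral => //; first exact: Li.
  by apply: L1Z; exact: L1D.
rewrite (RintegralZl _ measurableT (L1D i1 i2)) (RintegralD measurableT i1 i2).
rewrite (RintegralZl _ measurableT (L1Z _ (Li s0))) (RintegralZl _ measurableT (Li s0)).
rewrite Rintegral_cst// (_ : fine (mu setT) = 1) ?probability_setT// mulr1 -LE e1 -(expRD (- c)) addNr expR0.
by rewrite le_eqVlt; apply/orP; left; apply/eqP; ring.
Qed.

Lemma stable_log_laplace (alpha : R) : 0 < alpha -> alpha != 1 -> stable alpha mu ->
  exists k beta, forall s, 0 < s -> log_laplace s = k * s `^ alpha + beta * s.
Proof.
move=> alpha0 alpha1 [_ st]; apply: stable_functional_equation => //; last first.
  exact: seq_continuous_log_laplace.
move=> a b a0 b0; have [D hD] := st a b a0 b0; exists D => s s0.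
set c := (_ `^ alpha^-1) in hD *.
have c0 : 0 < c by rewrite powR_gt0// addr_gt0// powR_gt0.
have ms : measurable_fun setT (fun y : R * R => a * y.1 + b * y.2) by meas.
have mc : measurable_fun setT (fun y : R => c * y + D) by meas.
pose P : probability (R * R)%type R := (mu \x mu)%E.
have := @same_law_ge0_integral _ _ _ _ _ P mu _ _ ms mc hD _ (me s) (fun y => expR_ge0 _).
rewrite laplace_prod !laplace_log ?mulr_gt0//.
have -> : (\int[mu]_x (expR (- (s * (c * x + D))))%:E =
    (expR (- (s * D)) * expR (log_laplace (s * c)))%:E)%E.
  rewrite EFinM -(laplace_log (mulr_gt0 s0 c0)) -ge0_integralZl//.
  - by apply: eq_integral => x _; rewrite -EFinM -expRD; congr (expR _)%:E; ring.
  - exact/measurable_EFinP.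
rewrite -EFinM -(expRD (log_laplace _)) -(expRD (- _)) => h.
by rewrite (@expR_inj R _ _ (@EFin_inj R _ _ h)) addrC.
Qed.

End laplace_transform_of_a_law.

Lemma seq_continuousP (R : realType) (f : R -> R) (x : R) : seq_continuous f -> 0 < x ->
  {for x, continuous f}.
Proof.
move=> fc x0; apply/(@cvg_nbhsP _ R^o) => u ux.
have : \forall n \near \oo, x / 2 <= u n <= x * 2.
  near=> n; apply/andP; split; apply: ltW; near: n.
  - by apply: (cvgr_gt x ux); rewrite ltr_pdivrMr// ltr_pMr// ltr1n.
  - by apply: (cvgr_lt x ux); rewrite ltr_pMr// ltr1n.
move=> [N _ hN]; rewrite -(cvg_shiftn N).
apply: (fc (x / 2) (x * 2)); first by rewrite divr_gt0.
- by move=> n; apply: hN; rewrite /= leq_addl.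
- by rewrite (cvg_shiftn N).
Unshelve. all: by end_near. Qed.

(** * Growth bound and solution of the dilation equation *)

Section dilation_equation.
Variables (R : realType) (q : nat) (psi : 'I_q -> R) (alpha k : R) (phi : R -> R).
Hypotheses (psi0 : forall j, 0 < psi j) (q0 : (0 < q)%N).
Hypothesis alpha1 : alpha != 1.
Hypothesis phi_scale : forall p s, 0 < p -> p <= 1 -> 0 < s ->
  phi (p * s) <= p * phi s.
Hypothesis phi_sum : forall s, 0 < s -> \sum_(j < q) phi (psi j * s) = k * s `^ alpha.

Let i0 : 'I_q := Ordinal q0.
Let S := \sum_(j < q) psi j.
Let S0 : 0 < S.
Proof. by rewrite /S (bigD1 i0)//= ltr_wpDr// sumr_ge0// => j _; exact: ltW. Qed.
Let psiS j : psi j <= S.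
Proof. by rewrite /S (bigD1 j)//= lerDl sumr_ge0// => i _; exact: ltW. Qed.

Let ratio_mono s t : 0 < s -> s <= t -> phi s / s <= phi t / t.
Proof.
move=> s_gt0 st; have t_gt0 := lt_le_trans s_gt0 st.
rewrite ler_pdivrMr//; have := @phi_scale (s / t) t.
rewrite divr_gt0// ler_pdivrMr// mul1r divfK ?gt_eqF// => /(_ isT st t_gt0).
by rewrite mulrC mulrCA mulrC mulrAC.
Qed.

(** The power [s ^ (alpha - 1)] tends to [0] at [0] when [alpha > 1] and at infinity when
    [alpha < 1]. The threshold [r] solves [(|k| + 1) r ^ (alpha - 1) = eps]. *)
Let small_power (eps s0 : R) : 0 < eps -> 0 < s0 ->
  (1 < alpha -> exists2 s, 0 < s & s <= s0 /\ `|k| * s `^ (alpha - 1) < eps) /\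
  (alpha < 1 -> exists2 s, 0 < s & s0 <= s /\ `|k| * s `^ (alpha - 1) < eps).
Proof.
move=> e0 s00; have k1 : 0 < `|k| + 1 by rewrite ltr_wpDl.
pose r := (eps / (`|k| + 1)) `^ (alpha - 1)^-1.
have r0 : 0 < r by rewrite powR_gt0// divr_gt0.
have an : alpha - 1 != 0 by rewrite subr_eq0.
have rE : r `^ (alpha - 1) = eps / (`|k| + 1).
  by rewrite /r -powRrM mulVf// powRr1// ltW// divr_gt0.
have fin s : 0 < s -> s `^ (alpha - 1) <= r `^ (alpha - 1) -> `|k| * s `^ (alpha - 1) < eps.
  move=> sp; rewrite rE => h.
  apply: le_lt_trans (ler_wpM2l (normr_ge0 k) h) _.
  rewrite mulrA ltr_pdivrMr// mulrC ltr_pM2l// ltrDl//.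
split=> ha.
  exists (Num.min s0 r); first by rewrite lt_min s00.
  rewrite ge_min lexx; split=> //; apply: fin; first by rewrite lt_min s00.
  rewrite !powR_lnE ?lt_min ?s00// ler_expR; apply: ler_wpM2l; first by rewrite subr_ge0 ltW.
  by rewrite ler_ln ?posrE ?lt_min ?s00// ge_min lexx orbT.
exists (Num.max s0 r); first by rewrite lt_max s00.
rewrite le_max lexx; split=> //; apply: fin; first by rewrite lt_max s00.
rewrite !powR_lnE ?lt_max ?s00// ler_expR; apply: ler_wnM2l.
  by rewrite subr_le0 ltW.
by rewrite ler_ln ?posrE ?lt_max ?s00// le_max lexx orbT.
Qed.

Let sum_ratio s : 0 < s ->
  \sum_(j < q) psi j * (phi (psi j * s) / (psi j * s)) = k * s `^ (alpha - 1).
Proof.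
move=> s0; have -> : s `^ (alpha - 1) = s `^ alpha / s.
  rewrite !powR_lnE// mulrBl mul1r expRB lnK//.
rewrite mulrA -phi_sum// mulr_suml; apply: eq_bigr => j _.
by field; rewrite !gt_eqF.
Qed.

Let psimin : exists2 m, 0 < m & forall j, m <= psi j.
Proof.
exists (psi [arg min_(j < i0) psi j]%O); first exact: psi0.
by case: arg_minP => // i _ h j; exact: h.
Qed.

(* The ratio [phi s / s] is nondecreasing, and a weighted mean of its dilates is
   a multiple of [s `^ (alpha - 1)], which vanishes at [0] or at [+oo]; hence [phi]
   has constant sign. *)
Lemma dilation_bound : exists C, forall s, 0 < s -> `|phi s| <= C * s `^ alpha.
Proof.
suff key : (forall s, 0 < s -> 0 <= phi s) \/ (forall s, 0 < s -> phi s <= 0).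
  (* Once all terms of [phi_sum] have one sign, a single term is bounded by the total; evaluating at
     [s / psi i0] makes that term [phi s]. *)
  have split_sum s : 0 < s -> k / psi i0 `^ alpha * s `^ alpha =
      phi s + \sum_(j < q | j != i0) phi (psi j * (s / psi i0)).
    move=> s0; have := phi_sum (divr_gt0 s0 (psi0 i0)).
    rewrite (bigD1 i0)//= (mulrC (psi i0)) divfK ?gt_eqF// => ->.
    rewrite -{1}[s](divfK (lt0r_neq0 (psi0 i0))) powRM ?divr_ge0 ?(ltW s0) ?(ltW (psi0 _))//.
    by field; rewrite gt_eqF// powR_gt0.
  case: key => [pos|neg].
    exists (k / psi i0 `^ alpha) => s s0; rewrite ger0_norm ?pos// split_sum//.
    by rewrite lerDl sumr_ge0// => j _; rewrite pos// mulr_gt0// divr_gt0.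
  exists (- (k / psi i0 `^ alpha)) => s s0; rewrite ler0_norm ?neg// mulNr split_sum//.
  by rewrite lerN2 gerDl sumr_le0// => j _; rewrite neg// mulr_gt0// divr_gt0.
have [a1|a1] : 1 < alpha \/ alpha < 1.
  by move: alpha1; rewrite neq_lt => /orP[]; [right|left].
  (* For [alpha > 1], a negative value at [s] keeps the ratio at most [- eta] on [(0, s]], although
     its weighted mean tends to [0] at [0]. *)
  left => s s0; rewrite leNgt; apply/negP => ps.
  pose eta := - (phi s / s).
  have eta0 : 0 < eta by rewrite oppr_gt0 pmulr_llt0 ?invr_gt0.
  have [+ _] := @small_power (eta * S) (s / S) (mulr_gt0 eta0 S0) (divr_gt0 s0 S0).
  move=> /(_ a1)[u u0 [us]]; apply/negP; rewrite -leNgt.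
  apply: (@le_trans _ _ (- (k * u `^ (alpha - 1)))); last first.
    by rewrite -mulNr ler_wpM2r ?powR_ge0// -normrN ler_norm.
  rewrite -sum_ratio// lerNr -mulNr /eta opprK /S mulr_sumr; apply: ler_sum => j _.
  rewrite mulrC ler_wpM2r ?(ltW (psi0 j))//.
  apply: ratio_mono; first by rewrite mulr_gt0.
  by rewrite mulrC; apply: le_trans (ler_wpM2l (ltW u0) (psiS j)) _; rewrite -ler_pdivlMr.
(* For [alpha < 1], a positive value at [s] keeps the ratio at least [eta] beyond [s], although its
   weighted mean tends to [0] at infinity. *)
right => s s0; rewrite leNgt; apply/negP => ps.
have [m m0 hm] := psimin.
pose eta := phi s / s.
have eta0 : 0 < eta by rewrite divr_gt0.
have [_ +] := @small_power (eta * S) (s / m) (mulr_gt0 eta0 S0) (divr_gt0 s0 m0).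
move=> /(_ a1)[u u0 [us]]; apply/negP; rewrite -leNgt.
apply: (@le_trans _ _ (k * u `^ (alpha - 1))); last first.
  by rewrite ler_wpM2r ?powR_ge0// ler_norm.
rewrite -sum_ratio// /S mulr_sumr; apply: ler_sum => j _.
rewrite mulrC ler_wpM2l ?(ltW (psi0 j))//.
apply: ratio_mono => //.
rewrite ler_pdivrMr// in us; apply: le_trans us _.
by rewrite mulrC ler_wpM2r// ltW.
Qed.

Lemma dilation_solution : seq_continuous phi ->
  (forall t, (\sum_(j < q) psi j `^ alpha * cos (ln (psi j) * t)) ^+ 2 +
             (\sum_(j < q) psi j `^ alpha * sin (ln (psi j) * t)) ^+ 2 != 0) ->
  exists k', forall s, 0 < s -> phi s = k' * s `^ alpha.
Proof.
move=> phic nz.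
pose W := \sum_(j < q) psi j `^ alpha.
have W0 : 0 < W.
  rewrite /W (bigD1 i0)//= ltr_wpDr ?powR_gt0// sumr_ge0// => j _; exact: powR_ge0.
(* [k / W] is the constant solution of the inhomogeneous equation, so that [g] solves the
   homogeneous one. *)
pose g x := phi (expR x) * expR (- (alpha * x)) - k / W.
have [C hC] := dilation_bound.
have gE x : phi (expR x) * expR (- (alpha * x)) = phi (expR x) / expR x `^ alpha.
  by rewrite powR_lnE ?expR_gt0// expRK expRN.
have gc : continuous g.
  move=> x; apply: cvgB; last exact: cvg_cst.
  apply: cvgM; first by apply: continuous_comp; [exact: continuous_expR|apply: seq_continuousP => //; exact: expR_gt0].
  apply: (@continuous_comp _ _ _ (fun x : R => - (alpha * x)) expR).
    by apply: cvgN; apply: cvgM; [exact: cvg_cst|exact: cvg_id].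
  exact: continuous_expR.
have gM x : `|g x| <= `|C| + `|k / W|.
  apply: le_trans (ler_normB _ _) _; rewrite lerD2r gE normrM normfV.
  have e0 := powR_gt0 alpha (expR_gt0 x).
  rewrite (gtr0_norm e0) ler_pdivrMr//; apply: le_trans (hC _ (expR_gt0 x)) _.
  by rewrite ler_wpM2r ?(ltW e0)// ler_norm.
have geq x : \sum_(j < q) psi j `^ alpha * g (x + ln (psi j)) = 0.
  have e j : psi j `^ alpha * g (x + ln (psi j)) =
      phi (psi j * expR x) / expR x `^ alpha - psi j `^ alpha * (k / W).
    rewrite /g gE mulrBr; congr (_ - _).
    rewrite expRD lnK ?posrE// (mulrC (expR x)) powRM ?(ltW (psi0 j)) ?expR_ge0//.
    by field; rewrite !gt_eqF ?powR_gt0 ?expR_gt0.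
  under eq_bigr do rewrite e.
  rewrite sumrB -mulr_suml -mulr_suml phi_sum ?expR_gt0// -/W.
  by field; rewrite !gt_eqF ?powR_gt0 ?expR_gt0.
have g0 := convolution_equation_unique nz gc gM geq.
exists (k / W) => s s0; have := g0 (ln s); rewrite /g gE lnK ?posrE// => /eqP.
by rewrite subr_eq0 => /eqP <-; rewrite divfK// gt_eqF// powR_gt0.
Qed.

End dilation_equation.

Section complex_powers.
Variables (R : realType) (q : nat) (psi : 'I_q -> R) (alpha : R).
Hypothesis psi0 : forall j, 0 < psi j.

Lemma cpow_sumE (theta : R) : \sum_(j < q) cpow (psi j) (alpha +i* theta)%C =
  ((\sum_(j < q) psi j `^ alpha * cos (ln (psi j) * theta)) +i*
   (\sum_(j < q) psi j `^ alpha * sin (ln (psi j) * theta)))%C.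
Proof.
elim/big_rec3: _ => // j a b z _ ->.
rewrite /cpow /cexp /= !mul0r subr0 addr0 powR_lnE// (mulrC alpha).
by apply/eqP; rewrite eq_complex /= !eqxx.
Qed.

Lemma cpow_sum_eq0 (theta : R) : \sum_(j < q) cpow (psi j) (alpha +i* theta)%C = 0 <->
  \sum_(j < q) psi j `^ alpha * cos (ln (psi j) * theta) = 0 /\
  \sum_(j < q) psi j `^ alpha * sin (ln (psi j) * theta) = 0.
Proof.
rewrite cpow_sumE; split=> [/eqP|[-> ->]//].
by rewrite eq_complex /= => /andP[/eqP -> /eqP ->].
Qed.

End complex_powers.

(** * From Laplace transforms back to laws *)

Section laws_from_laplace_transforms.
Variable R : realType.
Implicit Types mu : probability R R.

Let me (s : R) : measurable_fun setT (fun x : R => expR (- (s * x))).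
Proof. by meas. Qed.

Lemma laplace_affine mu (c D s : R) :
  (\int[mu]_x (expR (- (s * (c * x + D))))%:E =
   (expR (- (s * D)))%:E * laplace mu (s * c))%E.
Proof.
rewrite -ge0_integralZl//; last exact/measurable_EFinP.
by apply: eq_integral => x _; rewrite -EFinM -expRD; congr (expR _)%:E; ring.
Qed.

Lemma integral_probability_cst mu (r : R) : (\int[mu]_x r%:E = r%:E)%E.
Proof.
have h := @integral_cst _ _ _ mu setT measurableT r%:E.
by rewrite [LHS]h -[RHS]mule1; congr (_ * _)%E; exact: probability_setT.
Qed.

Lemma laplace_atom mu (x s : R) : mu [set x] = 1%E -> laplace mu s = (expR (- (s * x)))%:E.
Proof.
move=> mx; rewrite /laplace (ae_eq_integral (fun=> (expR (- (s * x)))%:E))//.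
- exact: integral_probability_cst.
- exact/measurable_EFinP.
- exists (~` [set x]); split; first exact: measurableC.
    by apply: (eq_trans (probability_setC mu (measurable_set1 x))); rewrite [X in (_ - X)%E]mx subee.
  by move=> y /= h yx; apply: h => _; rewrite yx.
Qed.

Lemma same_law_laplace_eq mu1 mu2 s : same_law mu1 mu2 -> laplace mu1 s = laplace mu2 s.
Proof.
move=> h; apply: eq_measure_integral => A mA _; exact: h.
Qed.

Lemma stable_of_log_laplace (alpha k g : R) mu : 0 < alpha -> Defs.nondegenerate mu ->
  (forall s, 0 < s -> laplace mu s = (expR (k * s `^ alpha + g * s))%:E) ->
  stable alpha mu.
Proof.
move=> alpha0 nd hmu; split => // a b a0 b0.
set c := (_ `^ alpha^-1).
have ab0 : 0 < a `^ alpha + b `^ alpha by rewrite addr_gt0// powR_gt0.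
have c0 : 0 < c by rewrite powR_gt0.
have ca : c `^ alpha = a `^ alpha + b `^ alpha.
  by rewrite /c -powRrM mulVf ?gt_eqF// powRr1// ltW.
(* The powers cancel because [c ^ alpha = a ^ alpha + b ^ alpha]; the shift balances the linear
   terms [g (a + b)] and [g c]. *)
exists (g * (c - a - b)).
have ms : measurable_fun setT (fun y : R * R => a * y.1 + b * y.2) by meas.
have mc : measurable_fun setT (fun y : R => c * y + g * (c - a - b)) by meas.
pose P : probability (R * R)%type R := (mu \x mu)%E.
apply: (@same_law_laplace _ _ _ _ _ P mu _ _ ms mc) => s s0; rewrite laplace_prod !hmu ?mulr_gt0//.
  by rewrite -EFinM ltry.
rewrite laplace_affine hmu ?mulr_gt0// -!EFinM -!expRD; congr (expR _)%:E.
rewrite !powRM ?(ltW s0) ?(ltW a0) ?(ltW b0) ?(ltW c0)// ca; ring.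
Qed.

(** With positive factors, one infinite factor would make the product infinite. *)
Lemma prode_lty (n : nat) (f : 'I_n -> \bar R) : (forall i, 0 < f i)%E ->
  (\prod_(i < n) f i < +oo)%E -> forall i, (f i < +oo)%E.
Proof.
move=> f0 + i; rewrite (bigD1 i)//=.
have : (0 < \prod_(j < n | j != i) f j)%E.
  by elim/big_ind : _ => // x y; exact: mule_gt0.
set z := (\prod_(_ < _ | _) _)%E => z0.
have := f0 i; case: (f i) => [r|//|//] _; first by rewrite ltry.
by rewrite gt0_mulye.
Qed.

Lemma Rintegral_cos_affine mu (t r c : R) :
  \int[mu]_x cos (t * (r * x + c)) =
  costr mu (r * t) * cos (t * c) - sintr mu (r * t) * sin (t * c).
Proof.
have mid : measurable_fun setT (fun x : R => x) by exact: measurable_id.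
have ci : L1 mu (fun x => cos (r * t * x)) by exact: (L1_cos _ mid).
have si : L1 mu (fun x => sin (r * t * x)) by exact: (L1_sin _ mid).
transitivity (\int[mu]_x (cos (t * c) * cos (r * t * x) - sin (t * c) * sin (r * t * x))).
  apply: eq_Rintegral => x _.
  by rewrite (_ : t * (r * x + c) = r * t * x + t * c) ?cosD; ring.
rewrite (RintegralB measurableT (L1Z _ ci) (L1Z _ si)).
rewrite (RintegralZl _ measurableT ci) (RintegralZl _ measurableT si).
by rewrite (mulrC (cos _)) (mulrC (sin _)).
Qed.

Lemma Rintegral_sin_affine mu (t r c : R) :
  \int[mu]_x sin (t * (r * x + c)) =
  sintr mu (r * t) * cos (t * c) + costr mu (r * t) * sin (t * c).
Proof.
have mid : measurable_fun setT (fun x : R => x) by exact: measurable_id.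
have ci : L1 mu (fun x => cos (r * t * x)) by exact: (L1_cos _ mid).
have si : L1 mu (fun x => sin (r * t * x)) by exact: (L1_sin _ mid).
transitivity (\int[mu]_x (cos (t * c) * sin (r * t * x) + sin (t * c) * cos (r * t * x))).
  apply: eq_Rintegral => x _.
  by rewrite (_ : t * (r * x + c) = r * t * x + t * c) ?sinD; ring.
rewrite (RintegralD measurableT (L1Z _ si) (L1Z _ ci)).
rewrite (RintegralZl _ measurableT ci) (RintegralZl _ measurableT si).
by rewrite (mulrC (cos _)) (mulrC (sin _)).
Qed.

(** The Levy measure is defined through the characteristic function; uniqueness of the Laplace
    transform identifies [mu1] with an affine image of [mu2], whose cosine and sine transforms are
    explicit. *)
Lemma laplace_law_affine mu1 mu2 (r c : R) :
  (forall s, 0 < s -> (laplace mu1 s < +oo)%E) ->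
  (forall s, 0 < s -> laplace mu1 s = ((expR (- (s * c)))%:E * laplace mu2 (s * r))%E) ->
  (forall t, costr mu1 t = costr mu2 (r * t) * cos (t * c) - sintr mu2 (r * t) * sin (t * c)) /\
  (forall t, sintr mu1 t = sintr mu2 (r * t) * cos (t * c) + costr mu2 (r * t) * sin (t * c)).
Proof.
move=> fin h.
have mid : measurable_fun setT (fun x : R => x) by exact: measurable_id.
have ma : measurable_fun setT (fun x : R => r * x + c) by meas.
have law : same_law (pushforward mu1 (fun x : R => x)) (pushforward mu2 (fun x : R => r * x + c)).
  apply: (same_law_laplace mid ma) => s s0; first exact: fin.
  by rewrite -[LHS]/(laplace mu1 s) (h s s0) [RHS](laplace_affine mu2 r c s).
split=> t.
- rewrite -[LHS]/(\int[mu1]_x cos (t * x)) -Rintegral_cos_affine.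
  have mcos : measurable_fun setT (fun x : R => cos (t * x)) by meas.
  exact: (same_law_Rintegral mid ma law mcos (L1_cos _ mid t) (L1_cos _ ma t)).
- rewrite -[LHS]/(\int[mu1]_x sin (t * x)) -Rintegral_sin_affine.
  have msin : measurable_fun setT (fun x : R => sin (t * x)) by meas.
  exact: (same_law_Rintegral mid ma law msin (L1_sin _ mid t) (L1_sin _ ma t)).
Qed.

Theorem right_skewed_stable_factor (alpha : R) (q : nat) (psi : 'I_q -> R)
    mu (X : probability R R) :
  0 < alpha -> alpha != 1 -> (0 < q)%N -> (forall j, 0 < psi j) ->
  (forall theta : R, \sum_(j < q) cpow (psi j) (alpha +i* theta)%C <> 0) ->
  (forall s, 0 < s -> laplace X s = (\prod_(j < q) laplace mu (s * psi j))%E) ->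
  right_skewed_stable alpha X -> right_skewed_stable alpha mu.
Proof.
move=> alpha0 alpha1 q0 psi0 nz hprod [[ndX stX] [nu [hnu supp]]].
have Xfin s : 0 < s -> (laplace X s < +oo)%E.
  by move=> s0; exact: (right_skewed_laplace_lty hnu supp s0).
have [k [beta hk]] := stable_log_laplace Xfin alpha0 alpha1 (conj ndX stX).
have i0 : 'I_q := Ordinal q0.
(* Nothing is assumed about the moments of [Z]; finiteness is inherited from the sum, one factor at
   a time. *)
have mufin s : 0 < s -> (laplace mu s < +oo)%E.
  move=> s0; have sp : 0 < s / psi i0 by rewrite divr_gt0.
  have := Xfin _ sp; rewrite hprod// => /(prode_lty (fun j => laplace_gt0 mu _))/(_ i0).
  by rewrite divfK// gt_eqF.
pose S := \sum_(j < q) psi j.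
have S0 : 0 < S.
  by rewrite /S (bigD1 i0)//= ltr_wpDr// sumr_ge0// => j _; exact: ltW.
pose W := \sum_(j < q) psi j `^ alpha.
have W0 : 0 < W.
  by rewrite /W (bigD1 i0)//= ltr_wpDr ?powR_gt0// sumr_ge0// => j _; exact: powR_ge0.
have hsum s : 0 < s -> \sum_(j < q) log_laplace mu (psi j * s) = k * s `^ alpha + beta * s.
  move=> s0; apply: (@expR_inj R); apply: (@EFin_inj R); rewrite -hk//.
  rewrite -(laplace_log Xfin)// hprod// expR_sum -prodEFin; apply: eq_bigr => j _.
  by rewrite (mulrC s) -(laplace_log mufin (mulr_gt0 (psi0 j) s0)).
(* The linear correction: [g * psi_j * s] sums over [j] to [beta * s]. *)
pose g := beta / S.
pose phi s := log_laplace mu s - g * s.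
have phi_sum s : 0 < s -> \sum_(j < q) phi (psi j * s) = k * s `^ alpha.
  move=> s0; rewrite sumrB hsum// -mulr_sumr -mulr_suml -/S.
  by rewrite /g; field; rewrite gt_eqF.
have phi_scale p s : 0 < p -> p <= 1 -> 0 < s -> phi (p * s) <= p * phi s.
  move=> p0 p1 s0; have := log_laplace_scale mufin p0 p1 s0.
  by rewrite /phi mulrBr (mulrCA g); set u := log_laplace _ _; set v := p * _; lra.
have phic : seq_continuous phi.
  move=> a b x u a0 uab ux; apply: cvgB; first exact: (seq_continuous_log_laplace mufin a0 uab).
  by apply: cvgM => //; exact: cvg_cst.
have [||k' hk'] := dilation_solution psi0 q0 alpha1 phi_scale phi_sum.
- exact: phic.
- move=> t; apply/negP; rewrite paddr_eq0 ?sqr_ge0// !sqrf_eq0 => /andP[/eqP c0 /eqP s0].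
  by apply: (nz t); apply/cpow_sum_eq0.
have kW : k' * W = k.
  have := phi_sum 1 ltr01; rewrite powR1 mulr1 => <-; rewrite /W mulr_sumr.
  by apply: eq_bigr => j _; rewrite mulr1 hk'.
have hmu s : 0 < s -> laplace mu s = (expR (k' * s `^ alpha + g * s))%:E.
  by move=> s0; rewrite (laplace_log mufin)// -hk'// /phi subrK.
have hX s : 0 < s -> laplace X s = (expR (k * s `^ alpha + beta * s))%:E.
  by move=> s0; rewrite (laplace_log Xfin)// hk.
(* If [Z] were the constant [x], the sum would be the constant [S * x], against the nondegeneracy of
   [X]. *)
have nd : Defs.nondegenerate mu.
  move=> x; apply/eqP => mx.
  have mid : measurable_fun setT (fun x : R => x) by exact: measurable_id.
  have mcst : measurable_fun setT (fun _ : R => S * x) by exact: measurable_cst.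
  have law : same_law (pushforward X (fun x : R => x)) (pushforward X (fun _ : R => S * x)).
    apply: (same_law_laplace mid mcst) => s s0; first exact: Xfin.
    rewrite -[LHS]/(laplace X s) hprod//.
    rewrite integral_probability_cst.
    under eq_bigr do rewrite (laplace_atom _ mx).
    rewrite prodEFin -expR_sum; congr (expR _)%:E.
    rewrite sumrN; congr (- _); rewrite -mulr_suml -mulr_sumr -/S; ring.
  have /eqP := ndX (S * x); apply.
  apply: (eq_trans (law [set S * x] (measurable_set1 _))).
  by rewrite -(probability_setT X); congr (X _); apply/seteqP; split.
split; first exact: (stable_of_log_laplace alpha0 nd hmu).
(* Chosen so that [k * r ^ alpha = k'], as [k = k' * W]; the shift [beta * r - g] then matches the
   linear terms. *)
pose r := W `^ (- alpha^-1).
have r0 : 0 < r by exact: powR_gt0.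
have ra : r `^ alpha = W^-1.
  by rewrite /r -powRrM mulNr mulVf ?gt_eqF// powR_inv1// ltW.
have [||hc hs] := @laplace_law_affine mu X r (beta * r - g).
- exact: mufin.
- move=> s s0; rewrite hmu// hX ?mulr_gt0// -EFinM -expRD; congr (expR _)%:E.
  rewrite powRM ?(ltW s0) ?(ltW r0)// ra -kW.
  by field; rewrite gt_eqF.
exact: (is_levy_measure_affine r0 hnu supp hc hs).
Qed.

End laws_from_laplace_transforms.

(** * A semistable law *)

Section integrable_characteristic_functions.
Variable R : realType.
Implicit Types m : {finite_measure set R -> \bar R}.

Let pos (s : R) : R := \1_(`[0, +oo[) s.
Let mpos : measurable_fun setT pos.
Proof. by apply: measurable_indic; exact: measurable_itv. Qed.

Let posE s : pos s = (0 <= s)%R%:R.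
Proof. by rewrite /pos indicE mem_setE in_itv/= andbT. Qed.

(** The folded triangle stretched to [[0, N]]; it increases to [2 * pos s], which allows both
    monotone and dominated convergence. *)
Let kappa (N s : R) : R := 2 * (Num.max 0 (1 - s / N) * pos s).

Let mkappa N : measurable_fun setT (kappa N).
Proof.
apply: measurable_funM; first exact: measurable_cst.
apply: measurable_funM => //; apply: measurable_maxr; first exact: measurable_cst.
by meas.
Qed.

Let pos_ge0 s : 0 <= pos s. Proof. by rewrite posE. Qed.

Let kappa_ge0 N s : 0 <= kappa N s.
Proof. by rewrite mulr_ge0// mulr_ge0// le_max lexx. Qed.

Let kappa_le N s : 0 < N -> kappa N s <= 2 * pos s.
Proof.
move=> N0; rewrite /kappa ler_wpM2l// posE; case: (leP 0 s) => s0; last by rewrite !mulr0.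
by rewrite !mulr1 ge_max ler01 gerDl oppr_le0 divr_ge0// ltW.
Qed.

Let kappa_mono s : {homo (fun n : nat => kappa n.+1%:R s) : n p / (n <= p)%N >-> n <= p}.
Proof.
move=> n p np; rewrite /kappa ler_wpM2l// posE; case: (leP 0 s) => s0; last by rewrite !mulr0.
rewrite !mulr1 ge_max le_max lexx/= le_max; apply/orP; right.
by rewrite lerD2l lerN2 ler_wpM2l// lef_pV2 ?posrE// ler_nat ltnS.
Qed.

Let kappa_cvg s : kappa n.+1%:R s @[n --> \oo] --> 2 * pos s.
Proof.
apply: cvgM; first exact: cvg_cst.
rewrite posE; case: (leP 0 s) => s0; last first.
  by rewrite (_ : (fun n => _) = fun=> 0); [exact: cvg_cst|apply/funext => n; rewrite mulr0].
rewrite (_ : (fun n => _) = fun n => Num.max 0 (1 - s / n.+1%:R)); last first.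
  by apply/funext => n; rewrite mulr1.
have h : 1 - s / n.+1%:R @[n --> \oo] --> (1 : R).
  rewrite -[X in _ --> X]subr0 -(mulr0 s); apply: cvgB; first exact: cvg_cst.
  by apply: cvgM; [exact: cvg_cst|exact: cvg_harmonic].
apply: (@cvg_sub0 _ _ (fun n => 1 - s / n.+1%:R)) => //.
apply: cvg_near_cst; near=> n; rewrite (_ : Num.max _ _ = 1 - s / n.+1%:R) ?subrr//.
apply/max_idPr; rewrite subr_ge0 ler_pdivrMr// mul1r; apply: ltW.
near: n; have [N _ hN] := nbhs_infty_gtr s; exists N => // n /= Nn.
by apply: hN => /=; rewrite leqW.
Unshelve. all: by end_near. Qed.

Variable tau : {finite_measure set R -> \bar R}.
Hypothesis tau_itv : forall h : R -> R, continuous h -> L1 tau h /\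
  \int[tau]_t h t = \int[@lebesgue_measure R]_(t in `[0, 1]) (2 * (1 - t) * h t).
Hypothesis tauE : forall x, fejer x = \int[tau]_t cos (x * t).

Let dilation (F : R -> R) (N : R) : 0 < N -> continuous F ->
  L1 (@leb R) (fun s => kappa N s * F s) /\
  N * \int[tau]_t F (N * t) = \int[@leb R]_s (kappa N s * F s).
Proof.
move=> N0 cF; have Nn0 : N != 0 by rewrite gt_eqF.
have cF' : continuous (fun t => F (N * t)).
  move=> t; apply: (@continuous_comp _ _ _ (fun t : R => N * t) F); last exact: cF.
  by apply: cvgM; [exact: cvg_cst|exact: cvg_id].
have cw : continuous (fun t : R => 2 * (1 - t) * F (N * t)).
  move=> t; apply: cvgM; last exact: cF'.
  by apply: cvgM; [exact: cvg_cst|apply: cvgB; [exact: cvg_cst|exact: cvg_id]].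
have [_ ->] := tau_itv cF'.
rewrite -(Rintegral_leb_itv _ _ cw).
have Ni0 : 0 < N^-1 by rewrite invr_gt0.
suff e : (fun s => kappa N s * F s) = (fun s : R =>
    2 * (1 - (N^-1 * s + 0)) * F (N * (N^-1 * s + 0)) * \1_(`[0, 1]) (N^-1 * s + 0)).
  rewrite e; split; first exact: (L1_leb_affine 0 Ni0 (L1_leb_itv 0 1 cw)).
  by rewrite (Rintegral_leb_affine 0 Ni0 (L1_leb_itv 0 1 cw)) mulrA divff// mul1r.
apply/funext => s; rewrite addr0 mulrA divff// mul1r /kappa.
have -> : \1_(`[0, 1]) (N^-1 * s) = (0 <= s <= N)%R%:R :> R.
  by rewrite indicE mem_setE in_itv/= pmulr_rge0// mulrC ler_pdivrMr// mul1r.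
rewrite posE; case: (leP 0 s) => s0 /=; last by rewrite !(mulr0, mul0r).
case: (leP s N) => sN /=.
  rewrite (max_idPr _); last by rewrite subr_ge0 ler_pdivrMr// mul1r.
  by field.
rewrite (max_idPl _); first by rewrite !(mulr0, mul0r).
by rewrite subr_le0 ler_pdivlMr// mul1r ltW.
Qed.

(** Cesaro means of a convergent integral. *)
Let dilation_cvg (F : R -> R) : continuous F -> L1 (@leb R) (fun s => 2 * pos s * F s) ->
  n.+1%:R * \int[tau]_t F (n.+1%:R * t) @[n --> \oo] --> \int[@leb R]_s (2 * pos s * F s).
Proof.
move=> cF Fi; have mF := continuous_measurable_fun cF.
rewrite (_ : (fun n => _) = fun n => \int[@leb R]_s (kappa n.+1%:R s * F s)); last first.
  by apply/funext => n; have [_ ->] := @dilation F n.+1%:R (ltr0n _ _) cF.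
have [|||_ //] := @Rintegral_dct _ _ _ (@leb R) (fun n s => kappa n.+1%:R s * F s)
  (fun s => 2 * pos s * F s) (fun s => `|2 * pos s * F s|) _ (L1_norm Fi).
- by move=> n; exact: measurable_funM.
- move=> n s; rewrite (normrM (kappa _ _)) (normrM (2 * pos s)) ler_wpM2r//.
  by rewrite (ger0_norm (kappa_ge0 _ _)) ger0_norm ?kappa_le// mulr_ge0.
- by move=> s; apply: cvgM; [exact: kappa_cvg|exact: cvg_cst].
Qed.

(** Normalisation only serves to obtain the probability structure; the Dirac mass is a default for
    mass zero or infinite, excluded here. *)
Lemma ex_probability_of_finite_measure m : m setT = 1%E ->
  exists P : probability R R, forall A, P A = m A.
Proof.
move=> m1; exists (mnormalize m (\d_(0 : R) : probability R R)) => A.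
transitivity (m A * (fine (m setT))^-1%:E)%E; last by rewrite m1 invr1 mule1.
suff : mnormalize m (\d_(0 : R) : probability R R) A = (m A * (fine (m setT))^-1%:E)%E by [].
by rewrite /mnormalize; case: ifPn => //; rewrite [X in X == 0%E]m1 [X in X == +oo%E]m1 onee_eq0.
Qed.

Variables (rho : nat -> {finite_measure set R -> \bar R}) (f : R -> R).
Hypotheses (cf : continuous f) (f_ge0 : forall t, 0 <= f t) (f_even : forall t, f (- t) = f t).
Hypotheses (f0 : f 0 = 1) (f_le1 : forall t, f t <= 1) (fi : L1 (@leb R) f).
Hypothesis rho_cos : forall t, costr (rho n) t @[n --> \oo] --> f t.
Hypothesis rho_sin : forall t, sintr (rho n) t @[n --> \oo] --> (0 : R).

(** As [f] is even, its cosine integrals over the line are those of [w]. *)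
Let w s := 2 * pos s * f s.
Let w_ge0 s : 0 <= w s. Proof. by rewrite mulr_ge0// mulr_ge0. Qed.
Let mf : measurable_fun setT f. Proof. exact: continuous_measurable_fun. Qed.

Let wi : L1 (@leb R) w.
Proof.
apply: (L1M_bounded (k := 2)) => //; first by meas.
by move=> s; rewrite ger0_norm ?mulr_ge0// posE -[leRHS]mulr1 ler_wpM2l// lern1 leq_b1.
Qed.

Let continuous_cosr (y : R) : continuous (fun s => cos (y * s)).
Proof.
move=> s; apply: (@continuous_comp _ _ _ (fun s : R => y * s) cos); last exact: continuous_cos.
by apply: cvgM; [exact: cvg_cst|exact: cvg_id].
Qed.

(* By Fejer's theorem the density, an integral against [f], is a limit of
   nonnegative Fejer means of [rho]. *)
Let density_ge0 (y : R) : 0 <= \int[@leb R]_s (cos (y * s) * w s).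
Proof.
have ccf : continuous (fun s => cos (y * s) * f s).
  by move=> s; apply: cvgM; [exact: continuous_cosr|exact: cf].
have e : (fun s => cos (y * s) * w s) = (fun s => 2 * pos s * (cos (y * s) * f s)).
  by apply/funext => s; rewrite /w; ring.
have ci : L1 (@leb R) (fun s => 2 * pos s * (cos (y * s) * f s)).
  rewrite -e; apply: (L1M_bounded (k := 1)) => //; first by meas.
  by move=> s; exact: cos_norm_le1.
have lim := dilation_cvg ccf ci.
rewrite e -(cvg_lim (@norm_hausdorff _ _) lim); apply: limr_ge.
  by apply/cvg_ex; eexists; exact: lim.
apply: nearW => k; rewrite mulr_ge0//; set N : R := k.+1%:R.
have [B hB] : exists B, forall n, fine (rho n setT) <= B.
  have : cvgn (fun n => costr (rho n) 0) by apply/cvg_ex; eexists; exact: rho_cos.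
  move=> /cvg_seq_bounded/pinfty_ex_gt0[B _ hB]; exists B => n.
  by rewrite -costr0; apply: le_trans (ler_norm _) _; exact: hB.
have [||||_ lim2] := @Rintegral_dct _ _ _ tau
  (fun n t => cos (N * t * y) * costr (rho n) (N * t) + sin (N * t * y) * sintr (rho n) (N * t))
  (fun t => cos (y * (N * t)) * f (N * t)) (cst (2 * B)).
- move=> n; have mN : measurable_fun setT (fun t : R => N * t) by meas.
  apply: measurable_funD; apply: measurable_funM; rewrite /=; try by meas.
    by apply: (measurableT_comp (measurable_costr (rho n)) mN).
  by apply: (measurableT_comp (measurable_sintr (rho n)) mN).
- exact: finite_measure_integrable_cst.
- move=> n t; rewrite /= mulr2n mulrDl mul1r; apply: le_trans (ler_normD _ _) _.
  rewrite !normrM; apply: lerD.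
    rewrite -[B]mul1r; apply: ler_pM => //; first exact: cos_norm_le1.
    exact: le_trans (costr_le _ _) (hB n).
  rewrite -[B]mul1r; apply: ler_pM => //; first exact: sin_norm_le1.
  exact: le_trans (sintr_le _ _) (hB n).
- move=> t; rewrite -[X in _ --> X]addr0 (mulrC y); apply: cvgD.
    by apply: cvgM; [exact: cvg_cst|exact: rho_cos].
  by rewrite -(mulr0 (sin (N * t * y))); apply: cvgM; [exact: cvg_cst|exact: rho_sin].
rewrite -(cvg_lim (@norm_hausdorff _ _) lim2); apply: limr_ge.
  by apply/cvg_ex; eexists; exact: lim2.
apply: nearW => n; rewrite -(Rintegral_fejer tauE); apply: Rintegral_ge0 => x _.
exact: fejer_ge0.
Qed.

(** Fourier inversion. The cosine transform [D] of [w] is nonnegative, and its Fejer means recover a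
    multiple of [f]; so [D] on the half-line is, after normalisation and symmetrisation, the density
    of the law sought. *)
Theorem ex_law_of_integrable_limit : exists P : probability R R,
  (forall t, costr P t = f t) /\ (forall t, sintr P t = 0).
Proof.
have mid : measurable_fun setT (fun x : R => x) by exact: measurable_id.
have [mw [_ mwh]] := ex_image_measure w_ge0 wi mid.
pose D := costr mw.
have mcos (t : R) : measurable_fun setT (fun x : R => cos (t * x)) by meas.
have coswi y : L1 (@leb R) (fun s => cos (y * s) * w s).
  by apply: (L1M_bounded (k := 1)) => // s; exact: cos_norm_le1.
have DE y : D y = \int[@leb R]_s (cos (y * s) * w s).
  by have [_ /(_ (coswi y))[_ <-]] := mwh _ (mcos y).
have D0 y : 0 <= D y by rewrite DE; exact: density_ge0.
have cD : continuous D by exact: (@continuous_cos_transform _ _ _ mw _ mid).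
have mD : measurable_fun setT D by exact: continuous_measurable_fun.
pose g s := pos s * f s.
have mg : measurable_fun setT g by exact: measurable_funM.
have gM y : `|g y| <= 1.
  rewrite /g ger0_norm ?mulr_ge0// posE; case: (leP 0 y) => _; last by rewrite mul0r.
  by rewrite mul1r.
pose I N t := N * \int[tau]_y (D (N * y) * cos (t * (N * y))).
(* Fubini turns a Fejer mean of the transform into a Fejer smoothing of the original function; the
   two terms come from the product formula for cosines. *)
have IE N t : 0 < N -> I N t = smoothing N g t + smoothing N g (- t).
  move=> N0; rewrite /I.
  have -> : \int[tau]_y (D (N * y) * cos (t * (N * y))) =
      \int[mw]_s \int[tau]_y (cos (N * y * s) * cos (t * (N * y))).
    rewrite (@Rfubini _ _ _ _ _ mw tau (fun z => cos (N * z.2 * z.1) * cos (t * (N * z.2)))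
      (cst 1) (cst 1)).
    - apply: eq_Rintegral => y _ /=; rewrite mulrC.
      rewrite -(RintegralZl _ measurableT (@L1_cos _ _ _ mw id mid (N * y))).
      by apply: eq_Rintegral => s _; rewrite mulrC.
    - by meas.
    - exact: finite_measure_integrable_cst.
    - exact: finite_measure_integrable_cst.
    - by move=> s y /=; rewrite normrM ler_pM// cos_norm_le1.
  have inner (s : R) : \int[tau]_y (cos (N * y * s) * cos (t * (N * y))) =
      2^-1 * (fejer (N * (s - t)) + fejer (N * (s - - t))).
    have ci (x : R) : L1 tau (fun y => cos (x * y)) by exact: (@L1_cos _ _ _ tau id mid x).
    rewrite !tauE -(RintegralD measurableT (ci _) (ci _)).
    rewrite -(RintegralZl _ measurableT (L1D (ci _) (ci _))).
    apply: eq_Rintegral => y _.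
    rewrite (_ : N * (s - t) * y = N * y * s - t * (N * y)); last by ring.
    rewrite (_ : N * (s - - t) * y = N * y * s + t * (N * y)); last by ring.
    by rewrite cosB cosD; field.
  under eq_Rintegral do rewrite inner.
  have mfej (x : R) : measurable_fun setT (fun s : R => fejer (N * (s - x))).
    have mN : measurable_fun setT (fun s : R => N * (s - x)) by meas.
    exact: (measurableT_comp (@measurable_fejer R) mN).
  have mh : measurable_fun setT (fun s : R => 2^-1 * (fejer (N * (s - t)) + fejer (N * (s - - t)))).
    apply: measurable_funM; first exact: measurable_cst.
    by apply: measurable_funD; exact: mfej.
  have fb (x : R) : `|fejer x| <= 1 by rewrite ger0_norm ?fejer_ge0// fejer_le1.
  have hwi : L1 (@leb R) (fun s : R => 2^-1 * (fejer (N * (s - t)) + fejer (N * (s - - t))) * w s).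
    apply: (L1M_bounded (k := 1)) => // s; rewrite normrM ger0_norm// mulrC ler_pdivrMr// mul1r.
    by apply: le_trans (ler_normD _ _) _; rewrite [2]mulr2n lerD.
  have [_ /(_ hwi)[_ ->]] := mwh _ mh.
  rewrite (smoothingE t N0 mg gM) (smoothingE (- t) N0 mg gM).
  have gi : L1 (@leb R) g.
    apply: (L1M_bounded (k := 1)) => // s; rewrite ger0_norm// posE lern1 leq_b1//.
  have sgi (x : R) : L1 (@leb R) (fun s : R => N * (fejer (N * (s - x)) * g s)).
    by apply: L1Z; apply: (L1M_bounded (k := 1)).
  rewrite -(RintegralD measurableT (sgi t) (sgi (- t))) -(RintegralZl _ measurableT hwi).
  by apply: eq_Rintegral => s _; rewrite /w /g; field.
(* [g] jumps at [0], so the means at [t = 0] have a limit of a different form. It is kept as a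
   separate constant until the continuity of [costr m0] identifies it. *)
pose c0 := 2 * \int[@leb R]_u (fejer u * pos u).
pose c t := if t == 0 then c0 else fejer_mass R * f t.
have shift_cvg (x u : R) : x + u / n.+1%:R @[n --> \oo] --> x.
  rewrite -[X in _ --> X]addr0 -(mulr0 u); apply: cvgD; first exact: cvg_cst.
  by apply: cvgM; [exact: cvg_cst|exact: cvg_harmonic].
have fshift (x u : R) : f (x + u / n.+1%:R) @[n --> \oo] --> f x.
  by apply: continuous_cvg; [exact: cf|exact: shift_cvg].
have I_cvg t : I n.+1%:R t @[n --> \oo] --> c t.
  rewrite (_ : (fun n => _) = fun n => smoothing n.+1%:R g t + smoothing n.+1%:R g (- t));
    last by apply/funext => n; exact: IE.
  have gpos (x : R) : 0 < x -> smoothing n.+1%:R g x @[n --> \oo] --> fejer_mass R * f x.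
    move=> x0; apply: (smoothing_pointwise mg gM) => u.
    apply: (@cvg_sub0 _ _ (fun n => f (x + u / n.+1%:R))) => //.
    apply: cvg_near_cst; near=> n; rewrite /g posE (_ : 0 <= _) ?mul1r ?subrr//.
    apply: ltW; near: n; exact: (cvgr_gt x (shift_cvg x u)).
  have gneg (x : R) : x < 0 -> smoothing n.+1%:R g x @[n --> \oo] --> (0 : R).
    move=> x0; rewrite -(mulr0 (fejer_mass R)); apply: (smoothing_pointwise mg gM) => u.
    apply: cvg_near_cst; near=> n; rewrite /g posE leNgt (_ : _ < 0) ?mul0r//.
    by near: n; exact: (cvgr_lt x (shift_cvg x u)).
  rewrite /c; case: ltgtP => [t0|t0|->].
  - rewrite -f_even -[X in _ --> X]add0r; apply: cvgD; first exact: gneg.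
    by apply: gpos; rewrite oppr_gt0.
  - rewrite -[X in _ --> X]addr0; apply: cvgD; first exact: gpos.
    by apply: gneg; rewrite oppr_lt0.
  - rewrite oppr0 /c0 mulr2n mulrDl mul1r.
    have z : smoothing n.+1%:R g 0 @[n --> \oo] --> \int[@leb R]_u (fejer u * pos u).
      have [|||_ //] := @Rintegral_dct _ _ _ (@leb R) (fun n u => fejer u * g (0 + u / n.+1%:R))
        (fun u => fejer u * pos u) (fun u => 1 * fejer u) _ (L1Z 1 (@L1_fejer R)).
      + move=> n; have /L1_measurable := L1_smoothing n.+1%:R 0 mg gM; exact.
      + by move=> n u; rewrite normrM ger0_norm ?fejer_ge0// mulrC ler_wpM2r ?fejer_ge0.
      + move=> u; apply: cvgM; first exact: cvg_cst.
        rewrite (_ : (fun n => _) = fun n => pos u * f (0 + u / n.+1%:R)).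
          have := fshift 0 u; rewrite f0 => h.
          by rewrite -[X in _ --> X]mulr1; apply: cvgM; [exact: cvg_cst|exact: h].
        by apply/funext => n; rewrite /g !posE add0r pmulr_lge0 ?invr_gt0.
    exact: (cvgD z z).
pose G y := 2 * pos y * D y.
have G0 y : 0 <= G y by rewrite mulr_ge0// mulr_ge0.
have mG : measurable_fun setT G by apply: measurable_funM => //; meas.
have cDc t : continuous (fun y => D y * cos (t * y)).
  by move=> y; apply: cvgM; [exact: cD|exact: continuous_cosr].
have Ikappa N t : 0 < N -> I N t = \int[@leb R]_y (kappa N y * (D y * cos (t * y))).
  by move=> N0; have [_] := dilation N0 (cDc t).
(* The integrability of [G] is not known beforehand; since [D >= 0] and the weights increase,
   monotone convergence at [t = 0] provides it. *)
have mass : (\int[@leb R]_y (G y)%:E = c0%:E)%E.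
  have e1 : ((I n.+1%:R 0)%:E @[n --> \oo] --> c0%:E)%E.
    by apply/fine_cvgP; split; [exact: nearW|have := I_cvg 0; rewrite /c eqxx].
  have e2 : ((I n.+1%:R 0)%:E @[n --> \oo] --> \int[@leb R]_y (G y)%:E)%E.
    have -> : (fun n => (I n.+1%:R 0)%:E) =
              (fun n => \int[@leb R]_y (kappa n.+1%:R y * D y)%:E)%E.
      apply/funext => n; have [ki _] := @dilation D n.+1%:R (ltr0n _ _) cD.
      rewrite Ikappa// -L1K//; congr EFin.
      by apply: eq_Rintegral => y _; rewrite mul0r cos0 mulr1.
    rewrite (_ : (\int[@leb R]_y (G y)%:E)%E =
        (\int[@leb R]_y limn (fun n => (kappa n.+1%:R y * D y)%:E))%E); last first.
      apply: eq_integral => y _; apply/esym/cvg_lim => //.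
      apply/fine_cvgP; split; first exact: nearW.
      by apply: cvgM; [exact: kappa_cvg|exact: cvg_cst].
    apply: cvg_monotone_convergence => //.
    - by move=> n; apply/measurable_EFinP; exact: measurable_funM.
    - by move=> n y _; rewrite lee_fin mulr_ge0.
    - by move=> y _ n p np; rewrite lee_fin ler_wpM2r//; exact: kappa_mono.
  by rewrite -(cvg_lim _ e1)// -(cvg_lim _ e2).
have Gi : L1 (@leb R) G by apply: L1_ge0 => //; rewrite mass ltry.
have [m0 [_ m0h]] := ex_image_measure G0 Gi mid.
have m0c t : costr m0 t = c t.
  have cGi : L1 (@leb R) (fun y => cos (t * y) * G y).
    by apply: (L1M_bounded (k := 1)) => // y; exact: cos_norm_le1.
  have [_ /(_ cGi)[_ e]] := m0h _ (mcos t).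
  have e2 : (fun y => cos (t * y) * G y) = (fun y => 2 * pos y * (D y * cos (t * y))).
    by apply/funext => y; rewrite /G; ring.
  rewrite -[LHS]/(\int[m0]_x cos (t * x)) e e2.
  rewrite e2 in cGi; have := dilation_cvg (cDc t) cGi => lim.
  by rewrite -(cvg_lim (@norm_hausdorff _ _) lim); apply/cvg_lim => //; exact: I_cvg.
have m0f t : costr m0 t = fejer_mass R * f t.
  have [t0|t0] := eqVneq t 0; last by rewrite m0c /c (negbTE t0).
  rewrite t0.
  have h1 : costr m0 (0 + 1 / n.+1%:R) @[n --> \oo] --> costr m0 0.
    apply: continuous_cvg; last exact: shift_cvg.
    exact: (@continuous_cos_transform _ _ _ m0 _ mid 0).
  have h2 : costr m0 (0 + 1 / n.+1%:R) @[n --> \oo] --> fejer_mass R * f 0.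
    rewrite (_ : (fun n => _) = fun n => fejer_mass R * f (0 + 1 / n.+1%:R)).
      by apply: cvgM; [exact: cvg_cst|exact: fshift].
    by apply/funext => n; rewrite m0c /c gt_eqF// add0r divr_gt0.
  by rewrite -(cvg_lim (@norm_hausdorff _ _) h1) -(cvg_lim (@norm_hausdorff _ _) h2).
(* Averaging [m0] with its reflection keeps the cosine transform and kills the sine transform;
   dividing by [fejer_mass R] normalises. *)
have mN : measurable_fun setT (fun x : R => - x) by meas.
have [m1 [_ m1h]] := ex_law m0 mN.
have k0 : 0 <= 2^-1 / fejer_mass R by rewrite divr_ge0// ltW// fejer_mass_gt0.
have [m2 m2h] := ex_sum_measure m0 m1 k0 k0.
have msin (t : R) : measurable_fun setT (fun x : R => sin (t * x)) by meas.
have c2 t : costr m2 t = f t.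
  have [_ /(_ (@L1_cos _ _ _ m0 _ mN t))[_ e1]] := m1h _ (mcos t).
  have [_ e] := m2h _ (@L1_cos _ _ _ m0 _ mid t) (@L1_cos _ _ _ m1 _ mid t).
  rewrite -[LHS]/(\int[m2]_x cos (t * x)) e e1.
  rewrite (_ : \int[m0]_x cos (t * - x) = \int[m0]_x cos (t * x)); last first.
    by apply: eq_Rintegral => x _; rewrite mulrN cosN.
  have := m0f t; rewrite -[LHS]/(\int[m0]_x cos (t * x)) => ->.
  by field; rewrite gt_eqF// fejer_mass_gt0.
have s2 t : sintr m2 t = 0.
  have [_ /(_ (@L1_sin _ _ _ m0 _ mN t))[_ e1]] := m1h _ (msin t).
  have [_ e] := m2h _ (@L1_sin _ _ _ m0 _ mid t) (@L1_sin _ _ _ m1 _ mid t).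
  rewrite -[LHS]/(\int[m2]_x sin (t * x)) e e1.
  rewrite (_ : \int[m0]_x sin (t * - x) = - 1 * \int[m0]_x sin (t * x)); first by ring.
  rewrite -(RintegralZl _ measurableT (@L1_sin _ _ _ m0 _ mid t)).
  by apply: eq_Rintegral => x _; rewrite mulrN sinN mulN1r.
have m2T : m2 setT = 1%E.
  have := c2 0; rewrite costr0 f0 => h; rewrite -[RHS]/(1%:E) -h fineK//.
  exact: fin_num_measure.
have [P PE] := ex_probability_of_finite_measure m2T.
exists P; split=> t.
- rewrite -c2; congr fine; apply: eq_measure_integral => A _ _; exact: PE.
- rewrite -(s2 t); congr fine; apply: eq_measure_integral => A _ _; exact: PE.
Unshelve. all: by end_near. Qed.

End integrable_characteristic_functions.

Lemma ex_symmetrization (R : realType) (n : {finite_measure set R -> \bar R}) :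
  exists s : {finite_measure set R -> \bar R}, forall (g : R -> R) (M : R),
    measurable_fun setT g -> (forall x, `|g x| <= M) ->
    \int[s]_x g x = \int[n]_x g x + \int[n]_x g (- x).
Proof.
have mN : measurable_fun setT (fun x : R => - x) by meas.
have [n' [_ hn]] := ex_law n mN.
have [s hs] := ex_sum_measure n n' ler01 ler01.
exists s => g M mg gM.
have gi : L1 n g by apply: L1_bounded mg gM.
have gi' : L1 n (fun x : R => g (- x)).
  have mgN : measurable_fun setT (fun x : R => g (- x)) by exact: (measurableT_comp mg mN).
  by apply: L1_bounded mgN (fun x => gM _).
have [_ /(_ gi')[i' e']] := hn g mg.
by have [_ ->] := hs g gi i'; rewrite !mul1r e'.
Qed.

(** * Exponents of symmetric laws with a log-modulated stable Levy density *)

Section perturbed_stable_exponent.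
Variables (R : realType) (alpha : R).
Hypotheses (alpha0 : 0 < alpha) (alpha2 : alpha < 2).

(* In the variable [u = ln x] the stable Levy density becomes [expR (- alpha u)],
   and a dilation [t |-> e^v t] becomes a translation of [u]. *)
Let E (t u : R) : R := (1 - cos (t * expR u)) * expR (- (alpha * u)).

Let E_ge0 t u : 0 <= E t u.
Proof. by rewrite mulr_ge0 ?expR_ge0// one_sub_cos_ge0. Qed.

Let mE t : measurable_fun setT (E t).
Proof. by rewrite /E; meas. Qed.

Let E_even t u : E (- t) u = E t u. Proof. by rewrite /E mulNr cosN. Qed.

(** From [expR y >= 1 + y ^ 2 / 2] at [y = delta |u|]. *)
Let decay (delta u : R) : 0 < delta ->
  expR (- (delta * `|u|)) <= (1 + 2 / delta ^+ 2) * (1 + u ^+ 2)^-1.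
Proof.
move=> d0; have y0 : 0 <= delta * `|u| by rewrite mulr_ge0// ltW.
have d2 : 0 < delta ^+ 2 by rewrite exprn_gt0.
have u2 := sqr_ge0 u; have u1 : 0 < 1 + u ^+ 2 by rewrite ltr_wpDr.
rewrite ler_pdivlMr// -(ler_pM2r (expR_gt0 (delta * `|u|))).
rewrite mulrAC -expRD addNr expR0 mul1r.
have := expR_ge1Dxn 1 y0; rewrite exprMn real_normK ?num_real// => h.
have k0 : 0 < 1 + 2 / delta ^+ 2 by rewrite ltr_wpDr// divr_ge0// ltW.
apply: le_trans (ler_wpM2l (ltW k0) h).
rewrite -subr_ge0 (_ : _ - _ = 2 / delta ^+ 2 + delta ^+ 2 * u ^+ 2 / 2).
  by rewrite addr_ge0// divr_ge0// ?(ltW d2)// mulr_ge0// ltW.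
by rewrite (_ : 2`!%:R = 2 :> R)//; field; rewrite gt_eqF.
Qed.

(** For [u >= 0] the cosine factor is bounded and the decay is [expR (- alpha u)]; for [u < 0] that
    factor is at most [t ^ 2 expR (2 u) / 2], leaving the rate [2 - alpha]. Both rates are positive
    as [0 < alpha < 2]. *)
Let E_le (T : R) : exists2 C, 0 <= C & forall t u, `|t| <= T -> E t u <= C * (1 + u ^+ 2)^-1.
Proof.
pose delta := Num.min alpha (2 - alpha).
have d0 : 0 < delta by rewrite lt_min alpha0 subr_gt0.
pose C := (2 + T ^+ 2) * (1 + 2 / delta ^+ 2).
exists C; first by rewrite mulr_ge0 ?addr_ge0 ?sqr_ge0// divr_ge0// sqr_ge0.
move=> t u tT; rewrite -mulrA.
have T2 : 0 <= 2 + T ^+ 2 by rewrite addr_ge0// sqr_ge0.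
apply: le_trans (ler_wpM2l T2 (decay u d0)).
have t2 : t ^+ 2 <= T ^+ 2.
  by apply: sqr_ler_norm; rewrite [leRHS]ger0_norm//; exact: le_trans tT.
rewrite /E; have [u0|u0] := leP 0 u.
  rewrite ger0_norm//; apply: ler_pM; rewrite ?one_sub_cos_ge0 ?expR_ge0//.
    by have := cos_geN1 (t * expR u); have := sqr_ge0 T; set c := cos _; lra.
  by rewrite ler_expR lerN2 ler_wpM2r// ge_min lexx.
rewrite ltr0_norm//.
apply: (@le_trans _ _ (t ^+ 2 / 2 * expR (- ((2 - alpha) * - u)))).
  rewrite (_ : expR (- ((2 - alpha) * - u)) = expR u ^+ 2 * expR (- (alpha * u))).
    rewrite mulrA ler_wpM2r ?expR_ge0//; apply: le_trans (one_sub_cos_le _) _.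
    by rewrite exprMn mulrAC.
  by rewrite expr2 -!expRD; congr expR; ring.
apply: ler_pM; rewrite ?expR_ge0 ?divr_ge0 ?sqr_ge0//.
  by have := sqr_ge0 t; lra.
by rewrite ler_expR lerN2 ler_wpM2r ?oppr_ge0 ?(ltW u0)// ge_min lexx orbT.
Qed.

Let L1_E (t M : R) (h : R -> R) : measurable_fun setT h -> (forall u, `|h u| <= M) ->
  L1 (@leb R) (fun u : R => E t u * h u).
Proof.
move=> mh hM; have [C C0 hC] := E_le `|t|.
apply: (@L1_dom _ _ _ _ _ (fun u : R => C * M * (1 + u ^+ 2)^-1)).
- exact: measurable_funM.
- exact/L1Z/L1_leb_cauchy.
- move=> u; rewrite normrM ger0_norm// [leRHS]mulrAC ler_pM//.
  exact: hC.
Qed.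

(** With [x = expR u], this is the integral over [x > 0] of [(1 - cos (t x)) x ^ (- 1 - alpha) h (ln
    x)]. *)
Definition levy_log_integral (h : R -> R) (t : R) : R := \int[@leb R]_u (E t u * h u).
Local Notation Q := levy_log_integral.

Lemma levy_log_integral0 h : Q h 0 = 0.
Proof.
rewrite /Q (_ : (fun u : R => _) = cst 0); last first.
  by apply/funext => u; rewrite /E mul0r cos0 subrr !mul0r.
by rewrite /Rintegral integral0.
Qed.

Lemma levy_log_integralN h t : Q h (- t) = Q h t.
Proof. by apply: eq_Rintegral => u _; rewrite E_even. Qed.

Lemma levy_log_integral_norm h t : Q h `|t| = Q h t.
Proof.
have [t0|/ltW t0] := leP 0 t; first by rewrite ger0_norm.
by rewrite ler0_norm// levy_log_integralN.
Qed.

Lemma continuous_levy_log_integral (h : R -> R) (M : R) : measurable_fun setT h ->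
  (forall u, `|h u| <= M) -> continuous (Q h).
Proof.
move=> mh hM t; apply/(@cvg_nbhsP _ R^o) => s st.
have M0 : 0 <= M by exact: le_trans (hM 0).
have [T T0 hT] : exists2 T : R, 0 < T & forall n, `|s n| <= T.
  have : cvgn s by apply/cvg_ex; eexists; exact: st.
  by move=> /cvg_seq_bounded/pinfty_ex_gt0[T ? h']; exists T => // n; exact: h'.
have [C C0 hC] := E_le T.
have [||||_ //] := @Rintegral_dct _ _ _ (@leb R) (fun n u => E (s n) u * h u)
  (fun u : R => E t u * h u) (fun u : R => C * M * (1 + u ^+ 2)^-1).
- by move=> n; exact: measurable_funM.
- exact/L1Z/L1_leb_cauchy.
- move=> n u; rewrite normrM ger0_norm// [leRHS]mulrAC ler_pM//.
  exact: hC.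
- move=> u; apply: cvgM; last exact: cvg_cst.
  apply: cvgM; last exact: cvg_cst.
  apply: cvgB; first exact: cvg_cst.
  apply: continuous_cvg; first exact: continuous_cos.
  by apply: cvgM => //; exact: cvg_cst.
Qed.

Lemma levy_log_integral_scale (h : R -> R) (M v : R) : measurable_fun setT h ->
  (forall u, `|h u| <= M) -> Q h (expR v) = expR (alpha * v) * Q (fun u : R => h (u - v)) 1.
Proof.
move=> mh hM.
rewrite /Q (Rintegral_leb_affine (- v) ltr01 (L1_E (expR v) mh hM)) mul1r.
have mhv : measurable_fun setT (fun u : R => h (u - v)).
  have mv : measurable_fun setT (fun u : R => u - v) by meas.
  exact: (measurableT_comp mh mv).
have hMv (u : R) : `|h (u - v)| <= M by [].
rewrite -(RintegralZl _ measurableT (L1_E 1 mhv hMv)).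
apply: eq_Rintegral => u _; rewrite !mul1r mulrA; congr (_ * _).
rewrite /E -expRD mul1r (_ : v + (u - v) = u); last by ring.
by rewrite mulrCA -expRD; congr (_ * expR _); ring.
Qed.

Lemma levy_log_integralD (h k : R -> R) (M N t : R) :
  measurable_fun setT h -> (forall u, `|h u| <= M) ->
  measurable_fun setT k -> (forall u, `|k u| <= N) ->
  Q (fun u : R => h u + k u) t = Q h t + Q k t.
Proof.
move=> mh hM mk kN.
rewrite /Q -(RintegralD measurableT (L1_E t mh hM) (L1_E t mk kN)).
by apply: eq_Rintegral => u _; rewrite mulrDr.
Qed.

Lemma levy_log_integralZ (h : R -> R) (M c t : R) :
  measurable_fun setT h -> (forall u, `|h u| <= M) ->
  Q (fun u : R => c * h u) t = c * Q h t.
Proof.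
move=> mh hM; rewrite /Q -(RintegralZl _ measurableT (L1_E t mh hM)).
by apply: eq_Rintegral => u _; rewrite mulrCA.
Qed.

Let mcst (c : R) : measurable_fun setT (fun _ : R => c). Proof. exact: measurable_cst. Qed.

Let L1_E1 t : L1 (@leb R) (fun u : R => E t u * 1).
Proof. by apply: (L1_E t (mcst 1) (M := 1)) => u; rewrite normr1. Qed.

Let one_sub_cos_ge (x : R) : 0 < x -> x <= 1 -> x ^+ 2 / 8 <= 1 - cos x.
Proof.
move=> x0 x1; rewrite one_sub_cosE; have := sin_sub_le (x / 2); rewrite ler_norml => /andP[+ _].
set s := sin _ => hs.
have s1 : x / 4 <= s by nra.
have : (x / 4) ^+ 2 <= s ^+ 2 by rewrite ler_sqr ?nnegrE//; lra.
by nra.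
Qed.

(** On [-1 <= u <= 0] the integrand is at least [expR u ^ 2 / 8 >= expR (- 2) / 8]. *)
Lemma levy_log_integral_gt0 : 0 < Q (fun=> 1) 1.
Proof.
have c0 : 0 < expR (- 2) / 8 :> R by rewrite divr_gt0 ?expR_gt0.
have cq : continuous (fun _ : R => expR (- 2) / 8 : R) by move=> x; exact: cvg_cst.
have : \int[@leb R]_x (expR (- 2) / 8 * \1_(`[-1, 0]) x) <= Q (fun=> 1) 1.
  apply: le_Rintegral => //; [exact: L1_leb_itv|move=> u _].
  rewrite indicE; case: (boolP (u \in _)) => [|_]; last by rewrite mulr0 mulr1 E_ge0.
  rewrite inE/= in_itv/= !mulr1 => /andP[u1 u0]; rewrite /E mul1r.
  have x1 : expR u <= 1 by rewrite expR_le1.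
  have x0 := expR_gt0 u.
  have hc : expR u ^+ 2 / 8 <= 1 - cos (expR u).
    exact: one_sub_cos_ge.
  apply: (@le_trans _ _ (expR u ^+ 2 / 8)).
    rewrite ler_wpM2r// expr2 -expRD ler_expR; lra.
  apply: le_trans hc _; rewrite ler_peMr ?one_sub_cos_ge0//.
  by rewrite -expR0 ler_expR oppr_ge0 mulr_ge0_le0// ltW.
have dF (t : R) : is_derive t 1 (fun t => expR (- 2) / 8 * t) (expR (- 2) / 8).
  by apply: is_derive_eq; rewrite /GRing.scale/=; ring.
have lt10 : -1 < 0 :> R by rewrite oppr_lt0.
apply: lt_le_trans; rewrite Rintegral_leb_itv// (Rintegral_FTC2 lt10 dF cq).
by rewrite mulr0 sub0r mulrN opprK mulr1.
Qed.

(* The identity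
     (1 - cos x) cos (t x) =
       - (1 - cos (t x)) + (1 - cos ((t + 1) x)) / 2 + (1 - cos ((t - 1) x)) / 2
   turns the hypothesis into the equality of the Fourier transforms of two
   finite symmetric measures. *)
Lemma levy_log_integral_injective (h : R -> R) : measurable_fun setT h ->
  (forall u, `|h u| <= 1) -> (forall t, Q h t = 0) -> Q (fun u : R => h u * h u) 1 = 0.
Proof.
move=> mh h1 Qh0.
(* Adding [1] to [h] makes both weights nonnegative. The measures are symmetrised afterwards, since
   the hypothesis controls cosines only. *)
pose w1 u := E 1 u * (1 + h u); pose w2 u := E 1 u * 1.
have h0 (u : R) : 0 <= 1 + h u by have := h1 u; rewrite ler_norml => /andP[? _]; lra.
have w10 (u : R) : 0 <= w1 u by rewrite mulr_ge0.
have w20 (u : R) : 0 <= w2 u by rewrite mulr_ge0.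
have m1h : measurable_fun setT (fun u : R => 1 + h u) by exact: measurable_funD.
have b1h (u : R) : `|1 + h u| <= 2.
  by rewrite ger0_norm//; have := h1 u; rewrite ler_norml => /andP[_ ?]; lra.
have w1i : L1 (@leb R) w1 by exact: L1_E m1h b1h.
have w2i : L1 (@leb R) w2 by exact: L1_E1.
have me : measurable_fun setT (fun u : R => expR u) by meas.
have [n1 [_ n1h]] := ex_image_measure w10 w1i me.
have [n2 [_ n2h]] := ex_image_measure w20 w2i me.
have [s1 sE1] := ex_symmetrization n1; have [s2 sE2] := ex_symmetrization n2.
have nE (w : R -> R) (n : {finite_measure set R -> \bar R}) : L1 (@leb R) w ->
    (forall g : R -> R, measurable_fun setT g ->
      ((forall y, 0 <= g y) -> (\int[n]_y (g y)%:E = \int[@leb R]_u (g (expR u) * w u)%:E)%E) /\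
      (L1 (@leb R) (fun u : R => g (expR u) * w u) -> L1 n g /\
        \int[n]_y g y = \int[@leb R]_u (g (expR u) * w u))) ->
    forall g : R -> R, measurable_fun setT g -> (forall x, `|g x| <= 1) ->
    \int[n]_x g x = \int[@leb R]_u (g (expR u) * w u).
  move=> iw hn g mg g1; have [_ H] := hn g mg; apply: (H _).2.
  apply: (L1M_bounded (k := 1)) => //.
  exact: (measurableT_comp mg me).
have nE1 := nE w1 n1 w1i n1h; have nE2 := nE w2 n2 w2i n2h.
have mcosr (t : R) : measurable_fun setT (fun x : R => cos (t * x)) by meas.
have msinr (t : R) : measurable_fun setT (fun x : R => sin (t * x)) by meas.
have cosr1 (t x : R) : `|cos (t * x)| <= 1 by exact: cos_norm_le1.
have sinr1 (t x : R) : `|sin (t * x)| <= 1 by exact: sin_norm_le1.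
have costr_eq t : costr s1 t = costr s2 t.
  rewrite -[LHS]/(\int[s1]_x cos (t * x)) -[RHS]/(\int[s2]_x cos (t * x)).
  rewrite (sE1 _ _ (mcosr t) (cosr1 t)) (sE2 _ _ (mcosr t) (cosr1 t)).
  have -> : (fun x : R => cos (t * - x)) = (fun x : R => cos (t * x)).
    by apply/funext => x; rewrite mulrN cosN.
  suff -> : \int[n1]_x cos (t * x) = \int[n2]_x cos (t * x) by [].
  rewrite (nE1 _ (mcosr t) (cosr1 t)) (nE2 _ (mcosr t) (cosr1 t)).
  have iw2 : L1 (@leb R) (fun u : R => cos (t * expR u) * w2 u).
    by apply: (L1M_bounded (k := 1)) => //; meas.
  have i3 (t' : R) : L1 (@leb R) (fun u : R => E t' u * h u) by exact: L1_E mh h1.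
  have -> : (fun u : R => cos (t * expR u) * w1 u) = (fun u : R => cos (t * expR u) * w2 u +
      (- 1 * (E t u * h u) + 2^-1 * (E (t + 1) u * h u + E (t - 1) u * h u))).
    apply/funext => u; rewrite /w1 /w2 /E.
    rewrite (mulrDl t 1) (mulrBl _ t 1) mul1r cosD cosB; by field.
  have j1 := L1Z (- 1) (i3 t); have j2 := L1D (i3 (t + 1)) (i3 (t - 1)).
  rewrite (RintegralD measurableT iw2 (L1D j1 (L1Z 2^-1 j2))).
  rewrite (RintegralD measurableT j1 (L1Z 2^-1 j2)).
  rewrite (RintegralZl _ measurableT (i3 t)) (RintegralZl _ measurableT j2).
  rewrite (RintegralD measurableT (i3 (t + 1)) (i3 (t - 1))).
  have e (t' : R) : \int[@leb R]_x (E t' x * h x) = 0 by exact: Qh0.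
  by rewrite !e; ring.
have sintr_eq t : sintr s1 t = sintr s2 t.
  have z (n : {finite_measure set R -> \bar R}) :
      \int[n]_x sin (t * x) + \int[n]_x sin (t * - x) = 0.
    have -> : (fun x : R => sin (t * - x)) = (fun x : R => - 1 * sin (t * x)).
      by apply/funext => x; rewrite mulrN sinN mulN1r.
    rewrite (RintegralZl _ measurableT (@L1_sin _ _ _ n id (@measurable_id _ _ _) t)); ring.
  rewrite -[LHS]/(\int[s1]_x sin (t * x)) -[RHS]/(\int[s2]_x sin (t * x)).
  by rewrite (sE1 _ _ (msinr t) (sinr1 t)) (sE2 _ _ (msinr t) (sinr1 t)) !z.
have seq := measure_unique_fourier costr_eq sintr_eq.
(* Testing the equality of the two measures on [h] itself, carried back to the variable [x], leaves
   the integral of [E 1 u * h u ^ 2]. *)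
pose g (x : R) := h (ln `|x|).
have mln : measurable_fun setT (fun x : R => ln `|x|).
  by apply: (measurableT_comp (@measurable_ln R)); meas.
have mg : measurable_fun setT g by exact: (measurableT_comp mh mln).
have g1 (x : R) : `|g x| <= 1 by exact: h1.
have : \int[s1]_x g x = \int[s2]_x g x.
  by congr fine; apply: eq_measure_integral => A mA _; exact: seq.
rewrite (sE1 _ _ mg g1) (sE2 _ _ mg g1).
have gN : (fun x : R => g (- x)) = g by apply/funext => x; rewrite /g normrN.
rewrite gN (nE1 _ mg g1) (nE2 _ mg g1).
have gE (u : R) : g (expR u) = h u by rewrite /g gtr0_norm ?expR_gt0// expRK.
have eg (w : R -> R) :
    \int[@leb R]_u (g (expR u) * w u) = \int[@leb R]_u (h u * w u).
  by apply: eq_Rintegral => u _; rewrite gE.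
rewrite (eg w1) (eg w2).
have -> : \int[@leb R]_u (h u * w1 u) = \int[@leb R]_u (h u * w2 u) + Q (fun u : R => h u * h u) 1.
  have hh (u : R) : `|h u * h u| <= 1 by rewrite normrM -[leRHS]mulr1 ler_pM.
  have mhh : measurable_fun setT (fun u : R => h u * h u) by exact: measurable_funM.
  have i1 : L1 (@leb R) (fun u : R => h u * w2 u) by exact: (L1M_bounded w2i mh h1).
  rewrite /Q -(RintegralD measurableT i1 (L1_E 1 mhh hh)).
  by apply: eq_Rintegral => u _; rewrite /w1 /w2; ring.
by set z := \int[_]_u _; set y := Q _ _; lra.
Qed.

Lemma levy_log_integral_le (h k : R -> R) (M N t : R) :
  measurable_fun setT h -> (forall u, `|h u| <= M) ->
  measurable_fun setT k -> (forall u, `|k u| <= N) ->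
  (forall u, h u <= k u) -> Q h t <= Q k t.
Proof.
move=> mh hM mk kN hk.
apply: (le_Rintegral _ (L1_E t mh hM) (L1_E t mk kN)) => // u _.
by rewrite ler_wpM2l.
Qed.

(** The Levy density is restricted to [|u| <= n], where it is finite, and symmetrised; the
    coefficient [1 / 2] in [b] compensates the doubling. *)
Lemma ex_levy_log_approximation (h : R -> R) (M : R) : continuous h ->
  (forall u, 0 <= h u) -> (forall u, `|h u| <= M) ->
  exists nu : nat -> {finite_measure set R -> \bar R}, forall t : R,
    (\int[nu n]_x (cos (t * x) - 1) @[n --> \oo] --> - Q h t) /\
    forall n, \int[nu n]_x sin (t * x) = 0.
Proof.
move=> ch h0 hM; have mh := continuous_measurable_fun ch.
pose b (u : R) := 2^-1 * (expR (- (alpha * u)) * h u).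
have cb : continuous b.
  move=> u; apply: cvgM; first exact: cvg_cst.
  apply: cvgM; last exact: ch.
  apply: continuous_cvg; first exact: continuous_expR.
  by apply: cvgN; apply: cvgM; [exact: cvg_cst|exact: cvg_id].
pose w (n : nat) (u : R) := b u * \1_(`[- n%:R, n%:R]) u.
have w0 n u : 0 <= w n u.
  by rewrite mulr_ge0// mulr_ge0// mulr_ge0// expR_ge0.
have wi n : L1 (@leb R) (w n) by exact: L1_leb_itv.
have me : measurable_fun setT (fun u : R => expR u) by meas.
have [n1 n1h] := choice (fun n => ex_image_measure (w0 n) (wi n) me).
have [s hs] := choice (fun n => ex_symmetrization (n1 n)).
have n1E n (g : R -> R) (B : R) : measurable_fun setT g -> (forall x, `|g x| <= B) ->
    \int[n1 n]_x g x = \int[@leb R]_u (g (expR u) * w n u).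
  move=> mg gB; have [_ H0] := n1h n; have [_ H] := H0 g mg; apply: (H _).2.
  apply: (L1M_bounded (k := B)) => //.
  exact: (measurableT_comp mg me).
exists s => t; split; last first.
  move=> n.
  have ms : measurable_fun setT (fun x : R => sin (t * x)) by meas.
  rewrite (hs n _ 1 ms); last by move=> x; exact: sin_norm_le1.
  have -> : (fun x : R => sin (t * - x)) = (fun x : R => - 1 * sin (t * x)).
    by apply/funext => x; rewrite mulrN sinN mulN1r.
  by rewrite (RintegralZl _ measurableT (@L1_sin _ _ _ (n1 n) id (@measurable_id _ _ _) t)); ring.
have mc : measurable_fun setT (fun x : R => cos (t * x) - 1) by meas.
have cb2 (x : R) : `|cos (t * x) - 1| <= 2.
  rewrite distrC ger0_norm ?one_sub_cos_ge0//.
  by have := cos_geN1 (t * x); set c := cos _; lra.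
have e n : \int[s n]_x (cos (t * x) - 1) =
    \int[@leb R]_u (- (E t u * h u) * \1_(`[- n%:R, n%:R]) u).
  rewrite (hs n _ 2 mc cb2).
  have -> : (fun x : R => cos (t * - x) - 1) = (fun x : R => cos (t * x) - 1).
    by apply/funext => x; rewrite mulrN cosN.
  have wc : L1 (@leb R) (fun u : R => (cos (t * expR u) - 1) * w n u).
    by apply: (L1M_bounded (k := 2)) => //; meas.
  rewrite (n1E n _ 2 mc cb2) -(RintegralD measurableT wc wc).
  by apply: eq_Rintegral => u _; rewrite /w /b /E; field.
have iE := L1_E t mh hM.
rewrite (funext e) (_ : - Q h t = \int[@leb R]_u (- (E t u * h u))); last first.
  rewrite -mulN1r -(RintegralZl _ measurableT iE).
  by apply: eq_Rintegral => u _; rewrite mulN1r.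
have [||||_ //] := @Rintegral_dct _ _ _ (@leb R)
  (fun n u => - (E t u * h u) * \1_(`[- n%:R, n%:R]) u) (fun u => - (E t u * h u))
  (fun u => `|E t u * h u|).
- move=> n; apply: measurable_funM; last exact: measurable_indic.
  by apply: measurable_oppr_comp; exact: measurable_funM.
- exact: L1_norm.
- move=> n u; by rewrite normrM normrN ler_piMr// ger0_norm.
- move=> u; apply: cvg_near_cst; near=> n.
  rewrite indicE mem_set ?mulr1//= in_itv/= -ler_norml.
  near: n; exact: nbhs_infty_ger.
Unshelve. all: by end_near. Qed.

End perturbed_stable_exponent.

(** * The law whose exponent oscillates in [ln |t|] *)

Section semistable_law.
Variables (R : realType) (alpha theta : R).
Hypotheses (alpha0 : 0 < alpha) (alpha2 : alpha < 2).
Local Notation Q := (levy_log_integral alpha).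

(** The modulation stays at least [1 / 2]: the density remains positive, and the exponent is bounded
    below by half the stable one. *)
Let h (u : R) : R := 1 + cos (theta * u) / 2.
Let J := Q h.
Let K := Q (fun=> 1) 1.
Let A := Q (fun u => cos (theta * u)) 1.
Let B := Q (fun u => sin (theta * u)) 1.

Let mcos : measurable_fun setT (fun u : R => cos (theta * u)). Proof. by meas. Qed.
Let msin : measurable_fun setT (fun u : R => sin (theta * u)). Proof. by meas. Qed.
Let cosb (u : R) : `|cos (theta * u)| <= 1. Proof. exact: cos_norm_le1. Qed.
Let sinb (u : R) : `|sin (theta * u)| <= 1. Proof. exact: sin_norm_le1. Qed.
Let m1 : measurable_fun setT (fun _ : R => 1 : R). Proof. exact: measurable_cst. Qed.
Let b1 (u : R) : `|(fun _ : R => 1 : R) u| <= 1. Proof. by rewrite normr1. Qed.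
Let K0 : 0 < K. Proof. exact: levy_log_integral_gt0. Qed.

Let h_ge (u : R) : 2^-1 <= h u.
Proof. by rewrite /h; have := cos_geN1 (theta * u); set c := cos _; lra. Qed.
Let h_le (u : R) : `|h u| <= 2.
Proof.
rewrite ger0_norm; last by apply: le_trans (h_ge u); rewrite invr_ge0.
by rewrite /h; have := cos_le1 (theta * u); set c := cos _; lra.
Qed.
Let ch : continuous h.
Proof.
move=> u; apply: cvgD; first exact: cvg_cst.
apply: cvgM; last exact: cvg_cst.
apply: continuous_cvg; first exact: continuous_cos.
by apply: cvgM; [exact: cvg_cst|exact: cvg_id].
Qed.
Let mh : measurable_fun setT h. Proof. exact: continuous_measurable_fun. Qed.

(** Dilating [t] by [expR v] translates [u] by [v], and translations act on the span of
    [cos (theta u)] and [sin (theta u)] by rotation. *)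
Let Qcos (v : R) : Q (fun u => cos (theta * u)) (expR v) =
  expR (alpha * v) * (A * cos (theta * v) + B * sin (theta * v)).
Proof.
rewrite (levy_log_integral_scale alpha0 alpha2 v mcos cosb); congr (_ * _).
have -> : (fun u => cos (theta * (u - v))) = (fun u =>
    cos (theta * v) * cos (theta * u) + sin (theta * v) * sin (theta * u)).
  by apply/funext => u; rewrite mulrBr cosB; ring.
have hb (c : R) (g : R -> R) : (forall u, `|g u| <= 1) -> forall u, `|c * g u| <= `|c|.
  by move=> g1 u; rewrite normrM ler_piMr.
rewrite (levy_log_integralD alpha0 alpha2 1 (measurable_funM (measurable_cst _) mcos) (hb _ _ cosb)
  (measurable_funM (measurable_cst _) msin) (hb _ _ sinb)).
rewrite (levy_log_integralZ alpha0 alpha2 _ 1 mcos cosb).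
rewrite (levy_log_integralZ alpha0 alpha2 _ 1 msin sinb).
by rewrite -/A -/B; ring.
Qed.

Let Qsin (v : R) : Q (fun u => sin (theta * u)) (expR v) =
  expR (alpha * v) * (B * cos (theta * v) - A * sin (theta * v)).
Proof.
rewrite (levy_log_integral_scale alpha0 alpha2 v msin sinb); congr (_ * _).
pose S : R := - sin (theta * v).
have -> : (fun u => sin (theta * (u - v))) = (fun u =>
    cos (theta * v) * sin (theta * u) + S * cos (theta * u)).
  by apply/funext => u; rewrite mulrBr sinB /S; ring.
have hb (c : R) (g : R -> R) : (forall u, `|g u| <= 1) -> forall u, `|c * g u| <= `|c|.
  by move=> g1 u; rewrite normrM ler_piMr.
rewrite (levy_log_integralD alpha0 alpha2 1 (measurable_funM (measurable_cst _) msin) (hb _ _ sinb)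
  (measurable_funM (measurable_cst _) mcos) (hb _ _ cosb)).
rewrite (levy_log_integralZ alpha0 alpha2 S 1 mcos cosb).
rewrite (levy_log_integralZ alpha0 alpha2 (cos (theta * v)) 1 msin sinb).
by rewrite -/A -/B /S; ring.
Qed.

Let Qone (v : R) : Q (fun=> 1) (expR v) = expR (alpha * v) * K.
Proof. exact: (levy_log_integral_scale alpha0 alpha2 v m1 b1). Qed.

Let J_exp (v : R) : J (expR v) =
  expR (alpha * v) * (K + (A * cos (theta * v) + B * sin (theta * v)) / 2).
Proof.
have mc2 : measurable_fun setT (fun u : R => 2^-1 * cos (theta * u)).
  by apply: measurable_funM => //; exact: measurable_cst.
have bc2 (u : R) : `|2^-1 * cos (theta * u)| <= 2^-1.
  by rewrite normrM (ger0_norm (_ : 0 <= 2^-1)) ?invr_ge0// ler_piMr ?invr_ge0.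
rewrite /J (_ : h = fun u => 1 + 2^-1 * cos (theta * u)); last first.
  by apply/funext => u; rewrite /h mulrC.
rewrite (levy_log_integralD alpha0 alpha2 _ m1 b1 mc2 bc2).
by rewrite (levy_log_integralZ alpha0 alpha2 _ _ mcos cosb) Qone Qcos; field.
Qed.

(** Monotonicity of the exponent in the density, with [h >= 1 / 2]. It makes [expR (- J t)]
    integrable. *)
Let J_ge (t : R) : K / 2 * `|t| `^ alpha <= J t.
Proof.
have [->|t0] := eqVneq t 0.
  by rewrite normr0 powR0 ?gt_eqF// mulr0 /J levy_log_integral0.
have tgt : 0 < `|t| by rewrite normr_gt0.
have -> : J t = J (expR (ln `|t|)).
  by rewrite lnK ?posrE// /J levy_log_integral_norm.
rewrite powR_lnE//; set v := ln _.
rewrite /J (levy_log_integral_scale alpha0 alpha2 v mh h_le) mulrC ler_wpM2l ?expR_ge0//.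
have mhv : measurable_fun setT (fun u : R => h (u - v)).
  have mv : measurable_fun setT (fun u : R => u - v) by meas.
  exact: (measurableT_comp mh mv).
have mk : measurable_fun setT (fun _ : R => 2^-1 * 1 : R) by exact: measurable_cst.
have bk (u : R) : `|(fun _ : R => 2^-1 * 1 : R) u| <= 1.
  by rewrite mulr1 ger0_norm ?invr_ge0// invf_le1// ler1n.
have hk (u : R) : (fun _ : R => 2^-1 * 1 : R) u <= h (u - v) by rewrite mulr1.
have := levy_log_integral_le alpha0 alpha2 1 mk bk mhv (fun u => h_le (u - v)) hk.
by rewrite (levy_log_integralZ alpha0 alpha2 2^-1 1 m1 b1) -/K (mulrC K).
Qed.

Let cJ : continuous J.
Proof. exact: (continuous_levy_log_integral alpha0 alpha2 mh h_le). Qed.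

Let J_ge0 (t : R) : 0 <= J t.
Proof.
by apply: le_trans (J_ge t); rewrite mulr_ge0 ?powR_ge0// divr_ge0// ltW.
Qed.

Let f (t : R) : R := expR (- J t).

(** With [alpha * N >= 2], [s ^ 2 <= |s| ^ (alpha N)] for [|s| >= 1], and [y ^ N / N! <= expR y] at
    [y = c |s| ^ alpha]; this is the origin of [N! / c ^ N]. *)
Let f_le (t : R) : exists2 C, 0 < C & forall t, f t <= C * (1 + t ^+ 2)^-1.
Proof.
pose c := K / 2; have c0 : 0 < c by rewrite divr_gt0.
pose N := (Num.truncn (2 / alpha)).+1.
have Na : 2 <= alpha * N%:R.
  rewrite mulrC -ler_pdivrMr//; apply: ltW; rewrite /N.
  have ta : 0 <= 2 / alpha by rewrite divr_ge0// ltW.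
  by have /andP[_ ->] := truncn_itv ta.
pose C := 2 + 2 * N`!%:R / c ^+ N.
have q0 : 0 <= 2 * N`!%:R / c ^+ N by rewrite divr_ge0 ?mulr_ge0// exprn_ge0// ltW.
exists C; first by rewrite /C ltr_wpDr.
move=> s; have s2 := sqr_ge0 s; have s1 : 0 < 1 + s ^+ 2 by rewrite ltr_wpDr.
rewrite ler_pdivlMr// /f -(ler_pM2r (expR_gt0 (J s))) mulrAC -expRD addNr expR0 mul1r.
have C0 : 0 <= C by rewrite /C addr_ge0.
apply: (@le_trans _ _ (C * expR (c * `|s| `^ alpha))); last first.
  by rewrite ler_wpM2l// ler_expR J_ge.
have y0 : 0 <= c * `|s| `^ alpha by rewrite mulr_ge0 ?powR_ge0// ltW.
have e1 : 1 <= expR (c * `|s| `^ alpha) by rewrite -expR0 ler_expR.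
rewrite /C mulrDl; have [sle|sgt] := leP `|s| 1.
  have : s ^+ 2 <= 1 by rewrite -real_normK ?num_real// expr_le1.
  have : 0 <= 2 * N`!%:R / c ^+ N * expR (c * `|s| `^ alpha) by rewrite mulr_ge0// expR_ge0.
  by set y := _ * expR _; set z := expR _ in e1 *; lra.
have s0 : 0 < `|s| by exact: lt_trans sgt.
have h1 : s ^+ 2 <= (`|s| `^ alpha) ^+ N.
  rewrite -real_normK ?num_real// -!powR_mulrn ?powR_ge0// -powRrM.
  by rewrite !powR_lnE// ler_expR ler_wpM2r// ln_ge0// ltW.
have h2 := expR_ge1Dxn N.-1 y0; rewrite prednK// exprMn in h2.
have h3 : s ^+ 2 <= N`!%:R / c ^+ N * expR (c * `|s| `^ alpha).
  apply: le_trans h1 _.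
  have cN : 0 < c ^+ N by rewrite exprn_gt0.
  have fN : (0 : R) < N`!%:R by rewrite ltr0n fact_gt0.
  move: h2; set y := (_ `^ alpha) ^+ N => h2.
  rewrite (_ : y = N`!%:R / c ^+ N * (c ^+ N * y / N`!%:R)); last by field; rewrite !gt_eqF.
  apply: ler_wpM2l; first by rewrite divr_ge0// ltW.
  by apply: le_trans h2; rewrite lerDr.
have e2 : 1 <= s ^+ 2 by rewrite -real_normK ?num_real// exprn_ege1// ltW.
rewrite -(mulrA 2); rewrite -(mulrA 2) .
move: h3 e1 e2; set y := N`!%:R / _ * _; set z := expR _; set x := s ^+ 2; lra.
Qed.

Lemma ex_semistable_law : exists P : probability R R,
  (forall t, costr P t = expR (- levy_log_integral alpha (fun u => 1 + cos (theta * u) / 2) t)) /\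
  (forall t, sintr P t = 0).
Proof.
have [tau [tau_itv tauE]] := ex_fejer_measure R.
have h0 (u : R) : 0 <= h u by apply: le_trans (h_ge u); rewrite invr_ge0.
have [nu hnu] := ex_levy_log_approximation alpha0 alpha2 ch h0 h_le.
have [||rho [rc rs _]] := @ex_poisson_limit _ nu (fun t => - J t) (fun=> 0).
- by move=> t; have [] := hnu t.
- move=> t; rewrite (_ : (fun n => _) = fun=> 0); first exact: cvg_cst.
  by apply/funext => n; have [_] := hnu t.
have cf : continuous f.
  move=> t; apply: continuous_cvg; first exact: continuous_expR.
  by apply: cvgN; exact: cJ.
have [C C0 hC] := f_le 0.
apply: (ex_law_of_integrable_limit tau_itv tauE (rho := rho) (f := f)) => //.
- by move=> t; exact: expR_ge0.
- by move=> t; rewrite /f /J levy_log_integralN.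
- by rewrite /f /J levy_log_integral0 oppr0 expR0.
- by move=> t; rewrite /f expR_le1 oppr_le0.
- apply: (@L1_dom _ _ _ _ _ (fun u : R => C * (1 + u ^+ 2)^-1)).
  + exact: continuous_measurable_fun.
  + exact/L1Z/L1_leb_cauchy.
  + by move=> u; rewrite ger0_norm ?expR_ge0.
- by move=> t; have := rc t; rewrite cos0 mulr1.
- by move=> t; have := rs t; rewrite sin0 mulr0.
Qed.

Section dilations.
Variables (q : nat) (psi : 'I_q -> R).
Hypothesis psi0 : forall j, 0 < psi j.
Hypothesis cos_sum0 : \sum_(j < q) psi j `^ alpha * cos (ln (psi j) * theta) = 0.
Hypothesis sin_sum0 : \sum_(j < q) psi j `^ alpha * sin (ln (psi j) * theta) = 0.

(** By the addition formulas, the oscillating parts are combinations of the sums in [cos_sum0] and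
    [sin_sum0], with coefficients depending on [t] only. *)
Lemma semistable_dilation_sum (t : R) :
  \sum_(j < q) levy_log_integral alpha (fun u => 1 + cos (theta * u) / 2) (t * psi j) =
  (levy_log_integral alpha (fun=> 1) 1 * \sum_(j < q) psi j `^ alpha) * `|t| `^ alpha.
Proof.
have [->|t0] := eqVneq t 0.
  rewrite normr0 powR0 ?gt_eqF// mulr0; apply: big1 => j _.
  by rewrite mul0r levy_log_integral0.
have tgt : 0 < `|t| by rewrite normr_gt0.
set v := ln `|t|.
have e (j : 'I_q) : J (t * psi j) = `|t| `^ alpha * (K * psi j `^ alpha +
    (A * cos (theta * v) + B * sin (theta * v)) / 2 * (psi j `^ alpha * cos (ln (psi j) * theta)) +
    (B * cos (theta * v) - A * sin (theta * v)) / 2 * (psi j `^ alpha * sin (ln (psi j) * theta))).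
  have -> : J (t * psi j) = J (expR (v + ln (psi j))).
    rewrite expRD !lnK ?posrE// /J -levy_log_integral_norm normrM.
    by rewrite (gtr0_norm (psi0 j)).
  rewrite J_exp !powR_lnE// -/v !mulrDr expRD cosD sinD !(mulrC (ln (psi j)) theta); by field.
rewrite (eq_bigr _ (fun j _ => e j)) -mulr_sumr !big_split/= -!mulr_sumr cos_sum0 sin_sum0.
by rewrite !mulr0 !addr0 mulrC.
Qed.

End dilations.

(** Homogeneity would make [A cos (theta v) + B sin (theta v)] constant, and the values at
    [theta v = pi] and [pi / 2] give [A = B = 0]. Then the exponents of [cos (theta u)] and
    [sin (theta u)] vanish identically, injectivity annihilates those of their squares, and adding
    gives [K = 0]. *)
Lemma semistable_not_stable_exponent : theta != 0 ->
  ~ (forall t, 0 < t -> J t = t `^ alpha * J 1).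
Proof.
move=> th0 hJ.
have AB v : A * cos (theta * v) + B * sin (theta * v) = A.
  have J1 := J_exp 0; rewrite !mulr0 expR0 cos0 sin0 mulr0 addr0 mulr1 mul1r in J1.
  have := hJ _ (expR_gt0 v); rewrite powR_lnE ?expR_gt0// expRK J1 J_exp.
  move=> /(mulfI (lt0r_neq0 (expR_gt0 _)))/addrI/(mulIf _); apply.
  by rewrite invr_eq0.
have A0 : A = 0.
  have := AB (pi / theta); rewrite (mulrC theta) divfK// cospi sinpi; lra.
have B0 : B = 0.
  have := AB (pi / 2 / theta); rewrite (mulrC theta) divfK// cos_pihalf sin_pihalf A0; lra.
have zero (g : R -> R) : (forall v, Q g (expR v) = 0) -> forall t, Q g t = 0.
  move=> hg t; have [->|t0] := eqVneq t 0; first exact: levy_log_integral0.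
  have tgt : 0 < `|t| by rewrite normr_gt0.
  by have := hg (ln `|t|); rewrite lnK ?posrE// levy_log_integral_norm.
have c2 := levy_log_integral_injective alpha0 alpha2 mcos cosb (zero _ (fun v => _)).
have s2 := levy_log_integral_injective alpha0 alpha2 msin sinb (zero _ (fun v => _)).
have bM (g : R -> R) : (forall u, `|g u| <= 1) -> forall u, `|g u * g u| <= 1.
  by move=> g1 u; rewrite normrM -[leRHS]mulr1 ler_pM.
have := levy_log_integralD alpha0 alpha2 1 (measurable_funM mcos mcos) (bM _ cosb)
  (measurable_funM msin msin) (bM _ sinb).
rewrite (_ : (fun u => _ + _) = fun=> 1); last first.
  by apply/funext => u /=; rewrite -!expr2 cos2Dsin2.
rewrite -/K c2 ?s2 => [|v|v].
- by move=> /eqP; rewrite addr0 gt_eqF.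
- by rewrite Qsin A0 B0; ring.
- by rewrite Qcos A0 B0; ring.
Qed.

End semistable_law.

(** * Stability read on symmetric characteristic functions *)

Section symmetric_laws.
Variable R : realType.
Implicit Types X P : probability R R.

Let mcosr (t : R) : measurable_fun setT (fun x : R => cos (t * x)). Proof. by meas. Qed.
Let msinr (t : R) : measurable_fun setT (fun x : R => sin (t * x)). Proof. by meas. Qed.
Let mpair (a b : R) : measurable_fun setT (fun y : R * R => a * y.1 + b * y.2).
Proof. by meas. Qed.
Let maff (c D : R) : measurable_fun setT (fun y : R => c * y + D). Proof. by meas. Qed.

Lemma symmetric_stable X (c alpha : R) : 0 < c -> 0 < alpha ->
  (forall t, costr X t = expR (- (c * `|t| `^ alpha))) -> (forall t, sintr X t = 0) ->
  stable alpha X.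
Proof.
move=> c0 alpha0 hc hs; split=> [x|a b a0 b0].
  (* A point mass has a characteristic function of modulus [1], whereas here its value at [1] is
     [expR (- c) < 1]. *)
  apply/eqP => Xx.
  have ae (g : R -> R) : measurable_fun setT g -> \int[X]_y g y = g x.
    move=> mg; rewrite /Rintegral (ae_eq_integral (fun=> (g x)%:E))//.
    - by rewrite [X in fine X]integral_probability_cst.
    - exact/measurable_EFinP.
    - exists (~` [set x]); split; first exact: measurableC.
        by apply: (eq_trans (probability_setC X (measurable_set1 x)));
          rewrite [X in (_ - X)%E]Xx subee.
      by move=> y /= h yx; apply: h => _; rewrite yx.
  have e1 : cos (1 * x) = expR (- c).
    by rewrite -(ae _ (mcosr 1)); have := hc 1; rewrite normr1 powR1 mulr1.
  have e2 : sin (1 * x) = 0 by rewrite -(ae _ (msinr 1)); exact: hs.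
  have := cos2Dsin2 (1 * x); rewrite e1 e2 expr0n addr0 expr2 -expRD => h.
  have : expR (- c + - c) < 1 by rewrite expR_lt1; lra.
  by rewrite h ltxx.
exists 0; set r := (_ `^ alpha^-1).
have ab0 : 0 < a `^ alpha + b `^ alpha by rewrite addr_gt0// powR_gt0.
have r0 : 0 < r by rewrite powR_gt0.
have ra : r `^ alpha = a `^ alpha + b `^ alpha.
  by rewrite /r -powRrM mulVf ?gt_eqF// powRr1// ltW.
pose XX : probability (R * R)%type R := (X \x X)%E.
apply: (@same_law_fourier _ _ _ _ _ XX X _ _ (mpair a b) (maff r 0)) => t.
- rewrite [LHS](cos_prod X X t a b) [RHS]Rintegral_cos_affine !hs !hc.
  rewrite !(mulr0, mul0r) cos0 mulr1 !subr0 -expRD; congr expR.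
  rewrite !normrM (gtr0_norm a0) (gtr0_norm b0) (gtr0_norm r0).
  by rewrite !powRM ?normr_ge0 ?(ltW a0) ?(ltW b0) ?(ltW r0)// ra; ring.
- by rewrite [LHS](sin_prod X X t a b) [RHS]Rintegral_sin_affine !hs (mulr0 t) sin0; ring.
Qed.

(** The stability relation at the single frequency [1], with [a] and [b] free, is already Cauchy's
    equation for [x |-> J (x ^ (1 / alpha))]. *)
Lemma stable_exponent P (J : R -> R) (alpha : R) : 0 < alpha -> continuous J ->
  (forall t, costr P t = expR (- J t)) -> (forall t, sintr P t = 0) ->
  stable alpha P -> forall t, 0 < t -> J t = t `^ alpha * J 1.
Proof.
move=> alpha0 cJ hc hs [_ st]; have an0 : alpha != 0 by rewrite gt_eqF.
have JD a b : 0 < a -> 0 < b -> J ((a `^ alpha + b `^ alpha) `^ alpha^-1) = J a + J b.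
  move=> a0 b0; have [D hD] := st a b a0 b0; set r := (_ `^ alpha^-1) in hD *.
  pose PP : probability (R * R)%type R := (P \x P)%E.
  have ec := @same_law_Rintegral _ _ _ _ _ PP P _ _ (mpair a b) (maff r D) hD _ (mcosr 1)
    (L1_cos PP (mpair a b) 1) (L1_cos P (maff r D) 1).
  have es := @same_law_Rintegral _ _ _ _ _ PP P _ _ (mpair a b) (maff r D) hD _ (msinr 1)
    (L1_sin PP (mpair a b) 1) (L1_sin P (maff r D) 1).
  have {}ec := eq_trans (esym (cos_prod P P 1 a b)) (eq_trans ec (Rintegral_cos_affine P 1 r D)).
  have {}es := eq_trans (esym (sin_prod P P 1 a b)) (eq_trans es (Rintegral_sin_affine P 1 r D)).
  rewrite !hs !hc !mul1r mulr1 in ec es.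
  (* The sine transforms vanish, so the imaginary parts give [sin D = 0]; positivity of the real
     parts then excludes [cos D = - 1]. *)
  have s0 : sin D = 0.
    move/esym/eqP: es; rewrite !(mul0r, mulr0, add0r, addr0) mulf_eq0 gt_eqF ?expR_gt0//=.
    by move=> /eqP.
  have c1 : cos D = 1.
    have : cos D ^+ 2 = 1 by have := cos2Dsin2 D; rewrite s0 expr0n addr0.
    move=> /eqP; rewrite sqrf_eq1 => /orP[/eqP//|/eqP cN].
    have : 0 < expR (- J a) * expR (- J b) by rewrite mulr_gt0 ?expR_gt0.
    rewrite s0 cN !(mul0r, mulr0) !subr0 in ec; rewrite ec mulrN1 oppr_gt0.
    by rewrite ltNge expR_ge0.
  rewrite s0 c1 !(mul0r, mulr0) !subr0 mulr1 -expRD in ec.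
  by have /expR_inj e := ec; apply/oppr_inj; rewrite -e opprD.
pose F x := J (x `^ alpha^-1).
have pK x : 0 < x -> (x `^ alpha^-1) `^ alpha = x.
  move=> x0; have ai0 : alpha^-1 != 0 by rewrite invr_eq0.
  by have := powR_eqK x0 ai0; rewrite invrK.
have FD x y : 0 < x -> 0 < y -> F (x + y) = F x + F y.
  by move=> x0 y0; rewrite /F -JD ?powR_gt0// !pK.
have Fc : seq_continuous F.
  move=> a b x u a0 uab ux; rewrite /F.
  apply: continuous_cvg; first exact: cJ.
  exact: (@seq_continuous_powR R alpha^-1 a b x u a0 uab ux).
move=> t t0; have := additive_linear FD Fc (powR_gt0 alpha t0).
by rewrite /F powR_eqK// powR1.
Qed.

End symmetric_laws.

Section distributions.
Context (R : realType) d (T : measurableType d) (P : probability T R) (Y : {RV P >-> R}).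

Lemma costr_distribution t : costr (distribution P Y) t = \int[P]_w cos (t * Y w).
Proof.
congr fine; rewrite integral_distribution//.
- by apply/measurable_EFinP; meas.
- exact: (L1_cos P (measurable_funPT Y) t).
Qed.

Lemma sintr_distribution t : sintr (distribution P Y) t = \int[P]_w sin (t * Y w).
Proof.
congr fine; rewrite integral_distribution//.
- by apply/measurable_EFinP; meas.
- exact: (L1_sin P (measurable_funPT Y) t).
Qed.

Lemma laplace_distribution s :
  laplace (distribution P Y) s = (\int[P]_w (expR (- (s * Y w)))%:E)%E.
Proof.
rewrite /laplace ge0_integral_distribution//.
by apply/measurable_EFinP; meas.
Qed.

End distributions.

Lemma same_law_costr (R : realType) (m1 m2 : probability R R) t :
  same_law m1 m2 -> costr m1 t = costr m2 t.
Proof. by move=> h; congr fine; apply: eq_measure_integral => A mA _; exact: h. Qed.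

Lemma same_law_sintr (R : realType) (m1 m2 : probability R R) t :
  same_law m1 m2 -> sintr m1 t = sintr m2 t.
Proof. by move=> h; congr fine; apply: eq_measure_integral => A mA _; exact: h. Qed.

Theorem proposition6p2 (R : realType) (alpha : R) (q : nat) (psi : 'I_q -> R)
    (halpha : (0 < alpha /\ alpha < 1) \/ (1 < alpha /\ alpha < 2))
    (hq : (2 <= q)%N) (hpsi : forall j, 0 < psi j) :
  ((forall theta : R, \sum_(j < q) cpow (psi j) (alpha +i* theta) <> 0) ->
   forall (d : measure_display) (T : measurableType d) (P : probability T R)
     (Z : 'I_q -> {RV P >-> R}),
     iid_RVs Z ->
     right_skewed_stable alpha (distribution P (\sum_(j < q) psi j *: Z j)) ->
     forall j, right_skewed_stable alpha (distribution P (Z j)))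
  /\
  (~ (forall theta : R, \sum_(j < q) cpow (psi j) (alpha +i* theta) <> 0) ->
   exists (d0 : measure_display) (T0 : measurableType d0)
     (P0 : probability T0 R) (Z0 : {RV P0 >-> R}),
     ~ stable alpha (distribution P0 Z0) /\
     forall (d : measure_display) (T : measurableType d) (P : probability T R)
       (Z : 'I_q -> {RV P >-> R}),
       independent_RVs Z ->
       (forall j, same_law (distribution P (Z j)) (distribution P0 Z0)) ->
       stable alpha (distribution P (\sum_(j < q) psi j *: Z j))).
Proof.
have [alpha0 alpha1 alpha2] : [/\ 0 < alpha, alpha != 1 & alpha < 2].
  case: halpha => -[h1 h2]; split=> //.
  - by rewrite lt_eqF.
  - by apply: lt_trans h2 _; rewrite ltr1n.
  - exact: lt_trans h1.
  - by rewrite gt_eqF.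
have q0 : (0 < q)%N by exact: leq_trans hq.
have allq (j : 'I_q) : (j < q)%N = true by exact: ltn_ord.
split=> [nz d T P Z [indepZ idZ] hX j|].
  apply: (right_skewed_stable_factor alpha0 alpha1 q0 hpsi nz _ hX) => s s0.
  rewrite -partial_sum_all laplace_distribution laplace_partial_sum//.
  by apply: eq_big => [i|i _]; [exact: allq|exact: same_law_laplace_eq (idZ i j)].
move=> /existsNP[theta /contrapT/(cpow_sum_eq0 alpha hpsi)[c0 s0]].
pose W := \sum_(j < q) psi j `^ alpha.
have W0 : 0 < W.
  rewrite /W (bigD1 (Ordinal q0))//= ltr_wpDr ?powR_gt0// sumr_ge0// => j _.
  exact: powR_ge0.
(* At [theta = 0] the sum is [W > 0], so a zero of the symbol has a nonzero frequency. *)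
have th0 : theta != 0.
  apply/eqP => th; have : W = 0.
    by rewrite -c0; apply: eq_bigr => j _; rewrite th mulr0 cos0 mulr1.
  by move=> e; rewrite e ltxx in W0.
have [P0 [P0c P0s]] := ex_semistable_law theta alpha0 alpha2.
have mid : measurable_fun setT (idfun : R -> R) by exact: measurable_id.
(* The law is realised by the identity on the line equipped with [P0]. *)
pose Z0 : {RV P0 >-> R} := HB.pack (idfun : R -> R) (isMeasurableFun.Build _ _ _ _ _ mid).
exists _, R, P0, Z0.
have m1 : measurable_fun setT (fun u : R => 1 + cos (theta * u) / 2).
  by apply: measurable_funD; [exact: measurable_cst|apply: measurable_funM => //; meas].
have b1 (u : R) : `|1 + cos (theta * u) / 2| <= 2.
  have := cos_le1 (theta * u); have := cos_geN1 (theta * u); set c := cos _ => h1 h2.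
  by rewrite ger0_norm; lra.
split.
  move=> st; apply: (semistable_not_stable_exponent alpha0 alpha2 th0).
  apply: (@stable_exponent _ _ _ _ alpha0 _ _ _ st).
  - exact: (continuous_levy_log_integral alpha0 alpha2 m1 b1).
  - by move=> t; rewrite -P0c.
  - by move=> t; rewrite -[RHS](P0s t).
move=> d T P Z indepZ idZ; rewrite -partial_sum_all.
have Zc j t : costr (distribution P (Z j)) t =
    expR (- levy_log_integral alpha (fun u => 1 + cos (theta * u) / 2) t).
  by rewrite (same_law_costr t (idZ j)) -P0c.
have Zs j t : sintr (distribution P (Z j)) t = 0.
  by rewrite (same_law_sintr t (idZ j)) -[RHS](P0s t).
have K0 := levy_log_integral_gt0 alpha0 alpha2.
apply: (symmetric_stable (mulr_gt0 K0 W0) alpha0) => t.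
- rewrite costr_distribution; have [-> _] := fourier_partial_sum psi indepZ Zs t (leqnn q).
  rewrite (eq_bigl _ _ allq) (eq_bigr _ (fun j _ => Zc j _)) -expR_sum; congr expR.
  by rewrite sumrN (semistable_dilation_sum alpha0 alpha2 hpsi c0 s0).
- by rewrite sintr_distribution; have [_ ->] := fourier_partial_sum psi indepZ Zs t (leqnn q).
Qed.
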